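(* Let $\mathfrak{e}\subset\mathbb{R}$ be a compact and regular Parreau--Widom set, and let $w$ be an upper semi-continuous weight on $\mathfrak{e}$. Then $$(a)\ \inf_{n\ge 1} W_n(\mathfrak{e},w)>0 \quad\Longleftrightarrow\quad (b)\ \int \log w(z)\,d\rho_{\mathfrak{e}}(z)>-\infty .$$ Moreover, if either $(a)$ or $(b)$ holds, then also $\sup_{n\ge1} W_n(\mathfrak{e},w)<\infty$.
   Context: A weight on an infinite compact set $\mathfrak{e}$ is an upper semi-continuous function $w:\mathfrak{e}\to[0,\infty)$ that is positive at infinitely many points of $\mathfrak{e}$. $\|\cdot\|_{\mathfrak{e}}$ is the sup norm over $\mathfrak{e}$. $\mathrm{C}(\mathfrak{e})$ is the logarithmic capacity of $\mathfrak{e}$, and $\rho_{\mathfrak{e}}$ is the equilibrium measure of $\mathfrak{e}$ (for sets of positive capacity). The Widom factors are $$W_n(\mathfrak{e},w)=\frac{t_n(\mathfrak{e},w)}{\mathrm{C}(\mathfrak{e})^n},\qquad t_n(\mathfrak{e},w)=\min\{\|wP\|_{\mathfrak{e}} : P \text{ a monic polynomial of degree } n\},$$ $n\ge1$. Here $g_{\mathfrak{e}}(z,\infty)$ is the Green function of $\overline{\mathbb{C}}\setminus\mathfrak{e}$ with logarithmic pole at $\infty$. $\mathfrak{e}$ is regular if it is regular for potential theory (every point of $\mathfrak{e}$ that is a boundary point of $\overline{\mathbb{C}}\setminus\mathfrak{e}$ is regular for the Dirichlet problem on $\overline{\mathbb{C}}\setminus\mathfrak{e}$). A compact regular set $\mathfrak{e}$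 is a Parreau--Widom set if $PW(\mathfrak{e}):=\sum_\ell g_{\mathfrak{e}}(\zeta_\ell,\infty)<\infty$, where $\{\zeta_\ell\}$ are the critical points of $g_{\mathfrak{e}}(\cdot,\infty)$ in $\mathbb{C}\setminus\mathfrak{e}$ (points where $\nabla g_{\mathfrak{e}}(\cdot,\infty)=0$). *)

(* Defs.v *)
From HB Require Import structures.
From mathcomp Require Import all_boot all_order all_algebra.
From mathcomp Require Export complex.
From mathcomp Require Import all_classical all_reals all_analysis.

Set Implicit Arguments.
Unset Strict Implicit.
Unset Printing Implicit Defensive.

Import Order.TTheory GRing.Theory Num.Theory.
Import numFieldNormedType.Exports.
Import ComplexField.

Local Open Scope classical_set_scope.
Local Open Scope ring_scope.

Section PotentialTheory.
Variable R : realType.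

(* The complex plane is [R * R], as a real normed space: this gives the
   topology and the real directional derivatives ['D_v]. The norm [`|z|] of
   this space is the max norm, hence [modulus]. *)
Notation plane := (R * R)%type.

Definition modulus (z : plane) : R := Num.sqrt (z.1 ^+ 2 + z.2 ^+ 2).

(* z |-> 1 / z *)
Definition inversion (z : plane) : plane :=
  (z.1 / modulus z ^+ 2, - z.2 / modulus z ^+ 2).

Definition usc_on d (T : topologicalType) (Y : porderType d)
    (A : set T) (f : T -> Y) : Prop :=
  forall x, A x -> forall a : Y, (f x < a)%O ->
    \forall y \near within A (nbhs x), (f y < a)%O.

(* Of class C^2 (all iterated directional derivatives of order two exist and
   are continuous) with zero Laplacian; meant for [U] open. *)
Definition harmonic (U : set plane) (f : plane -> R) : Prop :=
  forall z, U z ->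
    (forall a b : plane,
      [/\ derivable f z a, derivable ('D_a f) z b &
          {for z, continuous ('D_b ('D_a f))}]) /\
    'D_(1, 0) ('D_(1, 0) f) z + 'D_(0, 1) ('D_(0, 1) f) z = 0.

Definition circle_mean (u : plane -> \bar R) (z : plane) (r : R) : \bar R :=
  (((2 * pi)^-1)%:E *
   \int[lebesgue_measure]_(t in `[0%R, (2 * pi)%R])
     u (z.1 + r * cos t, z.2 + r * sin t)%R)%E.

Definition subharmonic (U : set plane) (u : plane -> \bar R) : Prop :=
  [/\ forall z, U z -> (u z < +oo)%E,
      usc_on U u &
      forall z, U z -> \forall r \near 0^'+, (u z <= circle_mean u z r)%E].

(* A function on the Riemann sphere minus [E] is given by [u : plane -> \bar R]
   and by its value [c] at infinity; it is subharmonic there when it is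
   subharmonic in the two charts z and 1/z. *)
Definition subharmonic_on_sphere (E : set plane) (u : plane -> \bar R)
    (c : \bar R) : Prop :=
  subharmonic (~` E) u /\
  subharmonic [set z | z = (0, 0) \/ ~ E (inversion z)]
    (fun z => if z == (0, 0) then c else u (inversion z)).

(* For [E] compact this is the boundary of the sphere minus [E]. *)
Definition outer_boundary (E : set plane) : set plane :=
  E `&` closure (~` E).

Definition perron_family (E : set plane) (phi : plane -> R)
    : set (plane -> \bar R) :=
  [set u | (exists c, subharmonic_on_sphere E u c) /\
     forall z, outer_boundary E z ->
       (limf_esup u (within (~` E) (nbhs z)) <= (phi z)%:E)%E].

Definition perron_solution (E : set plane) (phi : plane -> R) (z : plane)
    : \bar R :=
  ereal_sup [set u z | u in perron_family E phi].

Definition dirichlet_regular_at (E : set plane) (z : plane) : Prop :=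
  forall phi : plane -> R, {within outer_boundary E, continuous phi} ->
    perron_solution E phi x @[x --> within (~` E) (nbhs z)] --> (phi z)%:E.

Definition dirichlet_regular (E : set plane) : Prop :=
  forall z, outer_boundary E z -> dirichlet_regular_at E z.

(* Green function of the sphere minus the compact set [E], with pole at
   infinity. Irregular boundary points form a polar set, so this is the usual
   requirement of zero boundary values quasi-everywhere; when [E] is regular,
   the boundary values are zero everywhere. *)
Definition is_green (E : set plane) (g : plane -> R) : Prop :=
  [/\ harmonic (~` E) g,
      forall r, exists M, forall z, ~ E z -> modulus z <= r -> `|g z| <= M,
      exists M r, forall z, r < modulus z -> `|g z - ln (modulus z)| <= M &
      forall z, outer_boundary E z -> dirichlet_regular_at E z ->
        g x @[x --> within (~` E) (nbhs z)] --> (0 : R)].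

Definition critical_points (E : set plane) (g : plane -> R) : set plane :=
  [set z | [/\ ~ E z, 'D_(1, 0) g z = 0 & 'D_(0, 1) g z = 0]].

Definition parreau_widom (E : set plane) : Prop :=
  [/\ compact E, dirichlet_regular E &
      exists g, is_green E g /\
        (\esum_(z in critical_points E g) (g z)%:E < +oo)%E].

Definition on_real_axis (e : set R) : set plane := [set (x, 0) | x in e].

(* [lne 0 = -oo], so the diagonal contributes [+oo]. *)
Definition log_energy (e : set R) (mu : probability (measurableTypeR R) R)
    : \bar R :=
  (\int[mu]_(x in e) \int[mu]_(y in e) - lne (`|x - y|)%:E)%E.

(* [expeR -oo = 0] covers the case where all energies are infinite. *)
Definition capacity (e : set R) : R :=
  fine (expeR (- ereal_inf [set log_energy e mu | mu in
    [set mu : probability (measurableTypeR R) R | mu e = 1%E]]))%E.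

Definition is_equilibrium_measure (e : set R)
    (rho : probability (measurableTypeR R) R) : Prop :=
  [/\ rho e = 1%E, (log_energy e rho < +oo)%E &
      forall mu : probability (measurableTypeR R) R, mu e = 1%E ->
        (log_energy e rho <= log_energy e mu)%E].

Definition is_weight (e : set R) (w : R -> R) : Prop :=
  [/\ forall x, e x -> 0 <= w x, usc_on e w &
      infinite_set [set x | e x /\ 0 < w x]].

Definition weighted_sup_norm (e : set R) (w : R -> R) (P : {poly R[i]}) : R :=
  sup [set w x * Normc.normc P.[x%:C%C] | x in e].

Definition chebyshev_number (e : set R) (w : R -> R) (n : nat) : R :=
  inf [set weighted_sup_norm e w P | P in
    [set P : {poly R[i]} | P \is monic /\ size P = n.+1]].

Definition widom_factor (e : set R) (w : R -> R) (n : nat) : R :=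
  chebyshev_number e w n / capacity e ^+ n.

End PotentialTheory.

(* Main.v *)
(* Write [I] for the energy of the equilibrium measure, so that the capacity is
   [exp (- I)], and [U] for its logarithmic potential.

   Potential theory. Frostman's bound [- I <= U] and the maximum principle give
   [g <= U + I] off the set. Conversely Leja points, spread out as a measure by
   a limit along an ultrafilter, turn the Bernstein-Walsh inequality into
   [I <= g z - ln |z| + o(1)] at infinity. The nonnegative defect [U + I - g]
   thus tends to 0 at infinity; comparing it with logarithmic barriers makes it
   vanish, first far from the set, then on half planes. Hence [g = U + I] and
   [U = - I] on the set, which is all that regularity is used for.

   (b) implies (a): integrate [ln (w |P|)] against the equilibrium measure.

   Upper bound: for a polynomial [q > 0] on the set with [w q <= 1], let [P] be
   the monic polynomial of degree [n] whose ratio [P / q] alternates between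
   [t] and [- t] at [n + 1] points. Averaging over [c] in [0, 1) yields a level
   [c] at which [ln |P / (t q) - c|] has integral bounded below by a constant.
   The [n] zeros of [P - c t q] interlace with the alternation points, and [U + I]
   at each is at most the value of [g] at a critical point in the same gap, so
   these values sum up to at most [PW]. Hence
   [W_n <= exp (6 + PW - int ln q)] as soon as [size q <= n].

   With [q] constant this bounds the Widom factors. If [int ln w = - oo],
   polynomials [q] close to Lipschitz minorants of [1 / w] make the bound
   arbitrarily small, so that (a) implies (b). *)

From HB Require Import structures.
Require Import Defs.
From mathcomp Require Import all_boot all_order all_algebra.
From mathcomp Require Import all_classical all_reals all_analysis.
From mathcomp Require finmap.
From mathcomp Require Import measurable_realfun polyrcf zify ring lra.

Set Implicit Arguments.
Unset Strict Implicit.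
Unset Printing Implicit Defensive.

Import Order.TTheory GRing.Theory Num.Theory.
Import numFieldNormedType.Exports.

Local Open Scope classical_set_scope.
Local Open Scope ring_scope.

(** * The maximum principle *)

(** Two obstacles shape the proof. [is_green] determines [g] at infinity only up to a bounded error,
    so the maximum principle yields [g <= U + I] and no reverse bound. The missing information is
    the minimality of the energy: if any finitely many points of the set can be followed by a point
    whose product of distances to them is large, these points generate a measure of energy at most
    [gam], whence [I <= gam]. Throughout, harmonicity enters as a condition on five-point
    differences, and most comparisons at infinity are paid for by a small multiple of [g].

    In the upper bound the natural level is 0, but the integral of [ln |P / (t q)|] has no evident
    lower bound, as [P] may be tiny on much of the set. Since [- ln |c - v|] has a bounded mean over
    [c] in [0, 1), uniformly in [v], some level [c] works, and [c < 1] preserves the signs at the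
    alternation points. The constant 6 is 1 from the shift of the kernel, 4 from a geometric series
    over dyadic scales, and 1 for choosing a level close to the mean. *)

Lemma le_of_eq {R : realType} {x y : R} : x = y -> x <= y.
Proof. by move->. Qed.

Section MaximumPrinciple.
Context {R : realType}.
Local Notation plane := (R * R)%type.
Implicit Types (D E : set plane) (f g F : plane -> R) (z : plane).

Definition five_point F z (r : R) : R :=
  F (z.1 + r, z.2) + F (z.1 - r, z.2) + F (z.1, z.2 + r) + F (z.1, z.2 - r)
  - 4 * F z.

(* Vanishing of the generalised Laplacian: unlike [harmonic], this passes to
   averages of functions without differentiating under the integral. *)
Definition flat_at F z : Prop :=
  forall eps : R, 0 < eps ->
    \forall r \near (0 : R)^'+, `|five_point F z r| <= eps * r ^+ 2.

Lemma flat_atD f g z : flat_at f z -> flat_at g z ->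
  flat_at (fun x => f x + g x) z.
Proof.
move=> hf hg eps e0; have e20 : 0 < eps / 2 by rewrite divr_gt0.
near=> r.
have H1 : `|five_point f z r| <= eps / 2 * r ^+ 2 by near: r; exact: hf.
have H2 : `|five_point g z r| <= eps / 2 * r ^+ 2 by near: r; exact: hg.
have -> : five_point (fun x => f x + g x) z r =
  five_point f z r + five_point g z r by rewrite /five_point; ring.
by rewrite (le_trans (ler_normD _ _))// (le_trans (lerD H1 H2))//; lra.
Unshelve. all: by end_near. Qed.

Lemma flat_atZ (c : R) f z : flat_at f z -> flat_at (fun x => c * f x) z.
Proof.
move=> hf eps e0; have e20 : 0 < eps / (`|c| + 1) by rewrite divr_gt0 ?ltr_wpDl.
near=> r.
have H1 : `|five_point f z r| <= eps / (`|c| + 1) * r ^+ 2.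
  by near: r; exact: hf.
have -> : five_point (fun x => c * f x) z r = c * five_point f z r.
  by rewrite /five_point; ring.
rewrite normrM (le_trans (ler_wpM2l _ H1))// mulrA ler_wpM2r ?sqr_ge0//.
have c0 : 0 < `|c| + 1 by rewrite ltr_wpDl.
by rewrite mulrA ler_pdivrMr// mulrDr mulr1 mulrC lerDl ltW.
Unshelve. all: by end_near. Qed.

Lemma flat_at_cst (c : R) z : flat_at (fun=> c) z.
Proof.
move=> eps e0; near=> r.
have -> : five_point (fun=> c) z r = 0 by rewrite /five_point; ring.
by rewrite normr0 mulr_ge0 ?sqr_ge0 ?ltW.
Unshelve. all: by end_near. Qed.

Lemma near_five_point (P : plane -> Prop) z :
  (\forall y \near z, P y) ->
  \forall r \near (0 : R)^'+, [/\ P (z.1 + r, z.2), P (z.1 - r, z.2),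
    P (z.1, z.2 + r) & P (z.1, z.2 - r)].
Proof.
case/nbhs_ballP => d /= d0 dP; near=> r.
have r0 : 0 < r by near: r; exact: nbhs_right_gt.
have rd : r < d by near: r; exact: nbhs_right_lt.
have rr : `|r| < d by rewrite gtr0_norm.
split; apply: dP; split => /=; rewrite /ball/= ?subrr ?normr0//.
- by rewrite opprD addrA subrr sub0r normrN.
- by rewrite opprB addrC subrK.
- by rewrite opprD addrA subrr sub0r normrN.
- by rewrite opprB addrC subrK.
Unshelve. all: by end_near. Qed.

(** Clipping [F] from below at half of a positive value extends it continuously to the whole plane,
    so a maximum exists on a large square. A flat function may have a local maximum, hence the
    perturbation by [eta |z|^2]: at a maximum of the sum the five-point difference of [F] is at most
    [- 4 eta r^2], while flatness bounds it below by [- eta r^2]. *)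
Lemma maximum_principle D F : open D ->
  (forall z, D z -> {for z, continuous F}) ->
  (forall z, D z -> flat_at F z) ->
  (forall z, ~ D z -> forall eps : R, 0 < eps ->
     \forall y \near z, D y -> F y <= eps) ->
  (forall eps : R, 0 < eps -> exists M : R, forall z, D z ->
     (M < `|z.1|) || (M < `|z.2|) -> F z <= eps) ->
  forall z, D z -> F z <= 0.
Proof.
move=> oD cF flF bF iF z0 Dz0; rewrite leNgt; apply/negP => Fz0.
set s := F z0 in Fz0.
have s2 : 0 < s / 2 by rewrite divr_gt0.
have hs2 : s / 2 < s by lra.
move: (s / 2) s2 hs2 => h s2 hs2.
pose phi z := if `[< D z >] then Num.max (F z) (h) else h.
have phiD z : D z -> phi z = Num.max (F z) (h).
  by rewrite /phi => /asboolT ->.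
have cphi : continuous phi.
  move=> z; have [Dz|nDz] := pselect (D z).
    have E : {near z, (fun z => Num.max (F z) (h)) =1 phi}.
      have /nbhs_interior : nbhs z D by exact: open_nbhs_nbhs.
      by apply: filterS => y /nbhs_singleton Dy; rewrite phiD.
    rewrite /prop_for /continuous_at phiD//.
    apply: cvg_trans; first exact: (near_eq_cvg E).
    apply: (@continuous_max _ _ F (fun=> h) z (cF _ Dz)).
    exact: cvg_cst.
  have phiz : phi z = h by rewrite /phi; case: asboolP.
  rewrite /prop_for /continuous_at phiz.
  apply: cvg_near_cst; move: (bF _ nDz _ s2); apply: filterS => y.
  rewrite /phi; case: asboolP => // Dy /(_ Dy) Fy.
  by apply/max_idPr.
have [M0 HM] := iF _ s2.
pose M := `|M0| + `|z0.1| + `|z0.2| + 1.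
have M1 : 1 <= M by rewrite lerDr !addr_ge0.
have M_gt0 : 0 < M by exact: lt_le_trans M1.
(* So small that the quadratic term stays below [s - h] on the square; this forces [phi > h] at the
   maximum, which therefore lies in [D] and off the edge. *)
pose eta := (s - h) / (4 * M ^+ 2 + 1).
have M2 : 0 < 4 * M ^+ 2 + 1 by rewrite ltr_wpDl// mulr_ge0// sqr_ge0.
have eta0 : 0 < eta by rewrite divr_gt0// subr_gt0.
pose K : set plane := `[- M, M]%classic `*` `[- M, M]%classic.
have cK : compact K by apply: compact_setX; exact: segment_compact.
pose q (z : plane) := phi z + eta * (z.1 ^+ 2 + z.2 ^+ 2).
have cq : continuous q.
  move=> z; apply: cvgD; first exact: cphi.
  apply: cvgM; first exact: cvg_cst.
  by apply: cvgD; apply: cvgM; first [exact: cvg_fst|exact: cvg_snd].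
have Kz0 : K z0.
  have A1 : `|z0.1| <= M.
    by rewrite /M; move: (normr_ge0 M0) (normr_ge0 z0.2); lra.
  have A2 : `|z0.2| <= M.
    by rewrite /M; move: (normr_ge0 M0) (normr_ge0 z0.1); lra.
  by split; rewrite /= in_itv/= -ler_norml.
have [z1 Kz1 z1max] : exists2 c, c \in K & forall t, t \in K -> q t <= q c.
  apply: compact_EVT_max => //; first by exists z0.
  by apply: continuous_subspaceT.
move: Kz1; rewrite inE => -[]; rewrite /= !in_itv/= -!ler_norml => K1 K2.
have q1 : s <= q z1.
  apply: (@le_trans _ _ (q z0)); last by apply: z1max; rewrite inE.
  rewrite /q phiD//; apply: ler_wpDr; last by rewrite le_max lexx.
  by rewrite mulr_ge0 ?addr_ge0 ?sqr_ge0 ?ltW.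
have small : eta * (z1.1 ^+ 2 + z1.2 ^+ 2) < s - h.
  have : z1.1 ^+ 2 + z1.2 ^+ 2 < 4 * M ^+ 2 + 1.
    have : z1.1 ^+ 2 <= M ^+ 2 by move: K1; rewrite ler_norml => /andP[? ?]; nra.
    have : z1.2 ^+ 2 <= M ^+ 2 by move: K2; rewrite ler_norml => /andP[? ?]; nra.
    by move: (sqr_ge0 M); lra.
  rewrite -(ltr_pM2l eta0) => /lt_le_trans; apply.
  by rewrite /eta mulfVK// gt_eqF.
have phi1 : h < phi z1 by move: q1; rewrite /q; lra.
have Dz1 : D z1.
  by move: phi1; rewrite /phi; case: asboolP => //; rewrite ltxx.
have F1 : phi z1 = F z1.
  move: phi1; rewrite phiD// lt_max ltxx orbF => ?.
  by apply/max_idPl/ltW.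
have N1 : `|z1.1| < M /\ `|z1.2| < M.
  have : ~~ ((M0 < `|z1.1|) || (M0 < `|z1.2|)).
    by apply/negP => /(HM _ Dz1); rewrite leNgt -F1 phi1.
  rewrite negb_or -!leNgt => /andP[a b]; rewrite /M.
  move: (ler_norm M0) (normr_ge0 z0.1) (normr_ge0 z0.2).
  by split; lra.
have nearK : \forall y \near z1, F y + eta * (y.1 ^+ 2 + y.2 ^+ 2) <= q z1.
  have n1 : \forall y \near z1, `|y.1| < M.
    have : `|y.1| @[y --> z1] --> `|z1.1| by apply: cvg_norm; exact: cvg_fst.
    by move/(cvgr_lt `|z1.1|); apply; exact: N1.1.
  have n2 : \forall y \near z1, `|y.2| < M.
    have : `|y.2| @[y --> z1] --> `|z1.2| by apply: cvg_norm; exact: cvg_snd.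
    by move/(cvgr_lt `|z1.2|); apply; exact: N1.2.
  have nD : \forall y \near z1, D y by apply: open_nbhs_nbhs; split.
  near=> y.
  have Dy : D y by near: y.
  apply: (@le_trans _ _ (q y)).
    by rewrite /q phiD// lerD2r le_max lexx.
  apply: z1max; rewrite inE; split; rewrite /= in_itv/= -ler_norml ltW//.
    by near: y.
  by near: y.
have nF := near_five_point nearK.
have nfl := flF _ Dz1 _ eta0.
have [r [r0 [/= A1 A2 A3 A4] A5]] : exists r : R, [/\ 0 < r,
    [/\ F (z1.1 + r, z1.2) + eta * ((z1.1 + r) ^+ 2 + z1.2 ^+ 2) <= q z1,
      F (z1.1 - r, z1.2) + eta * ((z1.1 - r) ^+ 2 + z1.2 ^+ 2) <= q z1,
      F (z1.1, z1.2 + r) + eta * (z1.1 ^+ 2 + (z1.2 + r) ^+ 2) <= q z1 &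
      F (z1.1, z1.2 - r) + eta * (z1.1 ^+ 2 + (z1.2 - r) ^+ 2) <= q z1] &
    `|five_point F z1 r| <= eta * r ^+ 2].
  apply: (@filter_ex _ (0 : R)^'+); near=> r; split.
  - by near: r; exact: nbhs_right_gt.
  - by near: r; exact: nF.
  - by near: r; exact: nfl.
move: A5; rewrite ler_norml => /andP[A5 _].
move: A5; rewrite /five_point.
move: A1 A2 A3 A4; rewrite /q F1.
have r2 : 0 < r ^+ 2 by rewrite exprn_gt0.
have er : 0 < eta * r ^+ 2 by rewrite mulr_gt0.
by move=> A1 A2 A3 A4 A5; nra.
Unshelve. all: by end_near. Qed.

End MaximumPrinciple.

(** * Harmonic functions are continuous and flat *)

Section HarmonicFlat.
Context {R : realType}.

Lemma is_derive_slice (V : normedModType R) (f : V -> R) (z v : V) (t : R) :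
  derivable f (t *: v + z) v ->
  is_derive t 1 (fun s : R => f (s *: v + z)) ('D_v f (t *: v + z)).
Proof.
have E : (fun h : R => h^-1 *: (((fun s : R => f (s *: v + z)) \o shift t)
    (h *: (1 : R)) - f (t *: v + z))) =
    (fun h : R => h^-1 *: ((f \o shift (t *: v + z)) (h *: v) - f (t *: v + z))).
  by apply/funext => h /=; rewrite [h%:A]mulr1 scalerDl addrA.
by move=> df; split; rewrite /derivable /derive E.
Qed.

Lemma slice_mvt (V : normedModType R) (f : V -> R) (z v : V) (r : R) : 0 <= r ->
  (forall t, 0 <= t <= r -> derivable f (t *: v + z) v) ->
  exists2 c, 0 <= c <= r & f (r *: v + z) - f z = 'D_v f (c *: v + z) * r.
Proof.
move=> r0 df.
have [||c] := @MVT_segment R (fun s : R => f (s *: v + z))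
    (fun s => 'D_v f (s *: v + z)) 0 r r0.
- move=> x xr; apply: is_derive_slice; apply: df.
  by move: xr; rewrite in_itv/= => /andP[/ltW -> /ltW ->].
- apply: derivable_within_continuous => x; rewrite in_itv/= => /df /is_derive_slice.
  by case.
by rewrite in_itv/= scale0r add0r subr0; exists c.
Qed.

(** The second derivative is controlled at [z] only. The mean value theorem for the symmetric sum
    minus [L s^2] leaves a difference of first derivatives at two points near [z], and
    differentiability of ['D_v f] at [z] applies to it. *)
Lemma second_difference (V : normedModType R) (f : V -> R) (z v : V) :
  (\forall t \near (0 : R), derivable f (t *: v + z) v) ->
  derivable ('D_v f) z v ->
  forall eps : R, 0 < eps -> \forall r \near (0 : R)^'+,
    `|f (r *: v + z) + f (- r *: v + z) - 2 * f z
      - r ^+ 2 * 'D_v ('D_v f) z| <= eps * r ^+ 2.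
Proof.
move=> df d2f eps e0; set L := 'D_v ('D_v f) z.
have e2 : 0 < eps / 2 by rewrite divr_gt0.
have H : \forall h \near (0 : R), `|'D_v f (h *: v + z) - 'D_v f z - L * h| <=
    eps / 2 * `|h|.
  have /cvgrPdist_le/(_ _ e2) : (h^-1 *: (('D_v f \o shift z) (h *: v) - 'D_v f z))
    @[h --> (0 : R)^'] --> L by [].
  rewrite near_withinE; apply: filterS => h /=.
  have [->|h0] := eqVneq h 0.
    by rewrite scale0r add0r subrr mulr0 subr0 normr0 mulr0.
  move=> /(_ isT); rewrite -(ler_pM2r (x := `|h|)) ?normr_gt0// -normrM.
  apply: le_trans; rewrite -normrN opprB; apply/le_of_eq; congr (`|_|).
  by rewrite mulrBl /GRing.scale/= mulrAC mulVf// mul1r; ring.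
have [d /= d0 dP] := (nbhs_ballP _ _).1 (filterI df H).
have {}dP t : `|t| < d -> derivable f (t *: v + z) v /\
    `|'D_v f (t *: v + z) - 'D_v f z - L * t| <= eps / 2 * `|t|.
  by move=> td; apply: dP; rewrite /ball/= sub0r normrN.
near=> r.
have r0 : 0 < r by near: r; exact: nbhs_right_gt.
have rd : r < d by near: r; exact: nbhs_right_lt.
have abs t : t \in `]0, r[%R -> `|t| < d /\ `|- t| < d.
  rewrite in_itv/= => /andP[t0 tr]; rewrite normrN; split;
  by rewrite gtr0_norm// (lt_trans tr).
pose psi (s : R) := f (s *: v + z) + f (s *: (- v) + z) - L * s ^+ 2.
have dpsi (t : R) : `|t| < d -> is_derive t 1 psi
    ('D_v f (t *: v + z) - 'D_v f (- t *: v + z) - L * (2 * t)).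
  move=> td.
  have [D1 _] := dP _ td.
  have [|D2 _] := dP (- t); first by rewrite normrN.
  have I1 := is_derive_slice D1.
  have I2 : is_derive (- t) 1 (fun s : R => f (s *: v + z)) _ := is_derive_slice D2.
  have I3 : is_derive t 1 (fun s : R => f (s *: - v + z)) (- 'D_v f (- t *: v + z)).
    have -> : (fun s : R => f (s *: - v + z)) =
        (fun s : R => f (s *: v + z)) \o -%R.
      by apply/funext => s /=; rewrite scalerN scaleNr.
    by rewrite -mulrN1; apply: is_derive1_comp.
  rewrite /psi.
  apply: is_derive_eq.
  rewrite /GRing.scale/=. by ring.
have [] := @MVT_segment R psi (fun t => 'D_v f (t *: v + z) -
  'D_v f (- t *: v + z) - L * (2 * t)) 0 r (ltW r0).
- by move=> t /abs[td _]; exact: dpsi.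
- apply: derivable_within_continuous => t; rewrite in_itv/= => /andP[t0 tr].
  have /dpsi[] // : `|t| < d by rewrite ger0_norm// (le_lt_trans tr).
move=> c; rewrite in_itv/= => /andP[c0 cr].
rewrite /psi !scale0r !add0r subr0 expr0n/= mulr0 subr0 => E.
have cd : `|c| < d by rewrite ger0_norm// (le_lt_trans cr).
have [_ H1] := dP _ cd.
have [_ H2] : derivable f (- c *: v + z) v /\
    `|'D_v f (- c *: v + z) - 'D_v f z - L * (- c)| <= eps / 2 * `|- c|.
  by apply: dP; rewrite normrN.
have -> : f (r *: v + z) + f (- r *: v + z) - 2 * f z - r ^+ 2 * L =
   (('D_v f (c *: v + z) - 'D_v f z - L * c) -
    ('D_v f (- c *: v + z) - 'D_v f z - L * (- c))) * r.
  have -> : - r *: v = r *: (- v) by rewrite scalerN scaleNr.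
  transitivity (f (r *: v + z) + f (r *: - v + z) - L * r ^+ 2 - (f z + f z)).
    by ring.
  by rewrite E; ring.
rewrite normrM (gtr0_norm r0) expr2 mulrA ler_wpM2r ?(ltW r0)//.
rewrite (le_trans (ler_normB _ _))//.
rewrite (le_trans (lerD H1 H2))// normrN ger0_norm// -mulrDl.
by rewrite -splitr ler_wpM2l// ltW.
Unshelve. all: by end_near. Qed.

Local Notation plane := (R * R)%type.

Lemma shift_fst (t : R) (z : plane) : t *: (1, 0) + z = (z.1 + t, z.2).
Proof.
rewrite [LHS]surjective_pairing; congr (_, _) => /=.
  by rewrite [t *: _]mulr1 addrC.
by rewrite [t *: _]mulr0 add0r.
Qed.

Lemma shift_snd (t : R) (z : plane) : t *: (0, 1) + z = (z.1, z.2 + t).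
Proof.
rewrite [LHS]surjective_pairing; congr (_, _) => /=.
  by rewrite [t *: _]mulr0 add0r.
by rewrite [t *: _]mulr1 addrC.
Qed.

(** Two nearby points are joined by a horizontal and a vertical segment, and the mean value theorem
    applies to each. *)
Lemma bounded_partials_continuous (f : plane -> R) (z : plane) (K : R) :
  (\forall y \near z, [/\ derivable f y (1, 0), derivable f y (0, 1),
     `|'D_(1, 0) f y| <= K & `|'D_(0, 1) f y| <= K]) ->
  {for z, continuous f}.
Proof.
move=> H; have [d /= d0 dP] := (nbhs_ballP _ _).1 H.
have K0 : 0 <= K.
  have [_ _ + _] := nbhs_singleton H.
  exact: le_trans (normr_ge0 _).
have conv (a b c t : R) : `|c - a| < d -> `|c - b| < d -> a <= t <= b ->
    `|c - t| < d.
  by rewrite !ltr_norml => /andP[? ?] /andP[? ?] /andP[? ?]; apply/andP; split; lra.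
have lip1 (a b y : R) : a <= b -> `|z.1 - a| < d -> `|z.1 - b| < d ->
    `|z.2 - y| < d -> `|f (b, y) - f (a, y)| <= K * `|b - a|.
  move=> ab az bz yz.
  have ba0 : 0 <= b - a by rewrite subr_ge0.
  have dt t : 0 <= t <= b - a -> ball z d (a + t, y).
    by move=> /andP[t0 tb]; split => //=; apply: (conv a b) => //; lra.
  have [t /dt/dP[+ _ _ _]|c /dt/dP[_ _ + _]] := @slice_mvt _ f (a, y) (1, 0) _ ba0.
    by rewrite shift_fst.
  rewrite !shift_fst/= (addrC a (b - a)) subrK => D ->; rewrite normrM ler_wpM2r//.
have lip2 (a b x : R) : a <= b -> `|z.2 - a| < d -> `|z.2 - b| < d ->
    `|z.1 - x| < d -> `|f (x, b) - f (x, a)| <= K * `|b - a|.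
  move=> ab az bz xz.
  have ba0 : 0 <= b - a by rewrite subr_ge0.
  have dt t : 0 <= t <= b - a -> ball z d (x, a + t).
    by move=> /andP[t0 tb]; split => //=; apply: (conv a b) => //; lra.
  have [t /dt/dP[_ + _ _]|c /dt/dP[_ _ _ +]] := @slice_mvt _ f (x, a) (0, 1) _ ba0.
    by rewrite shift_snd.
  rewrite !shift_snd/= (addrC a (b - a)) subrK => D ->; rewrite normrM ler_wpM2r//.
apply/cvgrPdist_le => eps e0.
have K1 : 0 < 2 * (K + 1) by rewrite mulr_gt0// ltr_wpDl.
have e1 : 0 < Num.min d (eps / (2 * (K + 1))) by rewrite lt_min d0 divr_gt0.
have n1 : \forall y \near z, ball z (Num.min d (eps / (2 * (K + 1)))) y.
  exact: nbhsx_ballx.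
near=> y.
have [y1 y2] : ball z (Num.min d (eps / (2 * (K + 1)))) y by near: y.
move: y1 y2; rewrite /ball/= !lt_min => /andP[y1 y1'] /andP[y2 y2'].
have z1 : `|z.1 - z.1| < d by rewrite subrr normr0.
have z2 : `|z.2 - z.2| < d by rewrite subrr normr0.
have B1 : `|f (z.1, y.2) - f (y.1, y.2)| <= K * `|z.1 - y.1|.
  by have [h|/ltW h] := leP y.1 z.1; [|rewrite distrC (distrC z.1)]; exact: lip1.
have B2 : `|f (z.1, z.2) - f (z.1, y.2)| <= K * `|z.2 - y.2|.
  by have [h|/ltW h] := leP y.2 z.2; [|rewrite distrC (distrC z.2)]; exact: lip2.
have -> : f z - f y = (f (z.1, z.2) - f (z.1, y.2)) +
    (f (z.1, y.2) - f (y.1, y.2)).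
  by rewrite addrA subrK -!surjective_pairing.
rewrite (le_trans (ler_normD _ _))// (le_trans (lerD B2 B1))//.
rewrite -mulrDr.
apply: (@le_trans _ _ ((K + 1) * (eps / (2 * (K + 1)) + eps / (2 * (K + 1))))).
  by apply: ler_pM; rewrite ?addr_ge0 ?lerDl// lerD// ltW.
apply/le_of_eq; field.
by rewrite gt_eqF// ltr_wpDl.
Unshelve. all: by end_near. Qed.

Lemma harmonic_continuous (U : set plane) (f : plane -> R) : open U ->
  Defs.harmonic U f -> forall z, U z -> {for z, continuous f}.
Proof.
move=> oU hf.
have dcont (a : plane) z : U z -> {for z, continuous ('D_a f)}.
  move=> Uz.
  have bnd b : \forall y \near z, `|'D_b ('D_a f) y| <= `|'D_b ('D_a f) z| + 1.
    have [/(_ a b)[_ _ c] _] := hf _ Uz.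
    have := @cvgr_norm_le _ _ _ _ _ _ _ c; apply.
    by rewrite ltrDl.
  apply: (@bounded_partials_continuous _ _
   (Num.max (`|'D_(1, 0) ('D_a f) z| + 1) (`|'D_(0, 1) ('D_a f) z| + 1))).
  have nU : \forall y \near z, U y by exact: open_nbhs_nbhs.
  apply: (filterS _ (filterI nU (filterI (bnd (1, 0)) (bnd (0, 1))))).
  move=> y [Uy [b1 b2]].
  have [h _] := hf _ Uy.
  split; [by case: (h a (1, 0))|by case: (h a (0, 1))| |].
  - by rewrite le_max; apply/orP; left; exact: b1.
  - by rewrite le_max; apply/orP; right; exact: b2.
move=> z Uz.
have bnd b : \forall y \near z, `|'D_b f y| <= `|'D_b f z| + 1.
  have := @cvgr_norm_le _ _ _ _ _ _ _ (dcont b _ Uz); apply.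
  by rewrite ltrDl.
apply: (@bounded_partials_continuous _ _
 (Num.max (`|'D_(1, 0) f z| + 1) (`|'D_(0, 1) f z| + 1))).
have nU : \forall y \near z, U y by exact: open_nbhs_nbhs.
apply: (filterS _ (filterI nU (filterI (bnd (1, 0)) (bnd (0, 1))))).
move=> y [Uy [b1 b2]].
have [h _] := hf _ Uy.
have [d1 _ _] := h (1, 0) 0; have [d2 _ _] := h (0, 1) 0.
split; [exact: d1|exact: d2| |].
- by rewrite le_max; apply/orP; left; exact: b1.
- by rewrite le_max; apply/orP; right; exact: b2.
Qed.

Lemma harmonic_flat (U : set plane) (f : plane -> R) : open U ->
  Defs.harmonic U f -> forall z, U z -> flat_at f z.
Proof.
move=> oU hf z Uz eps e0; have e2 : 0 < eps / 2 by rewrite divr_gt0.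
have H (v : plane) : \forall r \near (0 : R)^'+,
    `|f (r *: v + z) + f (- r *: v + z) - 2 * f z
      - r ^+ 2 * 'D_v ('D_v f) z| <= eps / 2 * r ^+ 2.
  apply: second_difference => //; last by have [/(_ v v)[]] := hf _ Uz.
  have : t *: v + z @[t --> (0 : R)] --> 0 *: v + z.
    by apply: cvgD; [apply: cvgZr_tmp; exact: cvg_id|exact: cvg_cst].
  rewrite scale0r add0r.
  have nU : \forall y \near z, U y by apply: open_nbhs_nbhs.
  move=> /(_ _ nU) nT0.
  have nT : \forall t \near (0 : R), U (t *: v + z) by exact: nT0.
  apply: (filterS _ nT) => t Ut.
  by case: (hf _ Ut) => /(_ v v)[].
have [_ L0] := hf _ Uz.
have H10 := H (1, 0); have H01 := H (0, 1).
apply: (filterS _ (filterI H10 H01)) => r [H1 H2].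
have := lerD H1 H2; rewrite -mulrDl -splitr; apply: le_trans.
apply: (le_trans _ (ler_normD _ _)); apply/le_of_eq; congr (`|_|).
rewrite !shift_fst !shift_snd /five_point.
have -> : 'D_(0, 1) ('D_(0, 1) f) z = - 'D_(1, 0) ('D_(1, 0) f) z.
  by apply/eqP; rewrite -addr_eq0 addrC; apply/eqP.
by ring.
Qed.

End HarmonicFlat.

(** * Frostman's bound for the equilibrium measure *)

Section Kernel.
Context {R : realType}.
Local Open Scope ereal_scope.

Lemma measurable_lne : measurable_fun [set: R] (fun r : R => lne r%:E).
Proof.
rewrite /=; apply: measurable_fun_ifT => //=; first exact: measurable_fun_ler.
by apply/measurable_EFinP; exact: measurable_ln.
Qed.

Local Notation T := (measurableTypeR R).

Lemma measurable_idTR : measurable_fun [set: T] (idfun : T -> R).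
Proof. by move=> _ A mA; rewrite setTI. Qed.

(** The logarithmic kernel raised by [L] and cut at 0: Tonelli's theorem and Fatou's lemma then
    apply without integrability conditions. The diagonal keeps the value [+oo], and the cut is
    inactive at distances up to [expR L]. *)
Definition log_kernel (L : R) (z : R * R) : \bar R :=
  maxe 0 (L%:E - lne (`|z.1 - z.2|)%:E).

Lemma measurable_log_kernel (L : R) :
  measurable_fun [set: T * T] (log_kernel L : T * T -> \bar R).
Proof.
apply: measurable_maxe => //; apply: emeasurable_funB => //.
apply: (measurableT_comp measurable_lne).
apply: measurableT_comp => //; apply: measurable_funB.
  exact: (measurableT_comp measurable_idTR measurable_fst).
exact: (measurableT_comp measurable_idTR measurable_snd).
Qed.

Lemma measurable_log_kernel_r (L x : R) :
  measurable_fun [set: T] (fun y : T => log_kernel L (x, y)).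
Proof.
exact: (measurableT_comp (measurable_log_kernel L) (pair1_measurable x)).
Qed.

Lemma log_kernel_ge0 (L : R) z : 0 <= log_kernel L z.
Proof. by rewrite /log_kernel le_max lexx. Qed.

Lemma log_kernel_sym (L x y : R) : log_kernel L (x, y) = log_kernel L (y, x).
Proof. by rewrite /log_kernel/= distrC. Qed.

Lemma log_kernelE (L : R) (z : R * R) : (`|z.1 - z.2| <= expR L)%R ->
  log_kernel L z = L%:E - lne (`|z.1 - z.2|)%:E.
Proof.
move=> h; apply/max_idPr => /=; case: ifPn => [_|]; first by rewrite leey.
rewrite -ltNge => h0; rewrite -EFinB lee_fin subr_ge0.
by rewrite -(expRK L) ler_ln ?posrE// expR_gt0.
Qed.

(** The delicate case is an infinite integral of [f]: the positive part of [f - L] then has infinite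
    integral too, whereas its negative part is at most [|L|]. *)
Lemma integral_sub_cst (d : measure_display) (T : measurableType d)
    (mu : probability T R) (D : set T) (f : T -> \bar R) (L : R) :
  measurable D -> mu D = 1 -> measurable_fun D f ->
  (forall x, D x -> 0 <= f x) ->
  \int[mu]_(x in D) (f x - L%:E) = \int[mu]_(x in D) f x - L%:E.
Proof.
move=> mD D1 mf f0.
have icst (M : R) : mu.-integrable D (fun=> M%:E).
  by have := finite_measure_integrable_cst mu M mD.
have cstE (M : R) : \int[mu]_(x in D) M%:E = M%:E.
  by rewrite integral_cst// [X in _ * X]D1 mule1.
have [foo|] := ltP (\int[mu]_(x in D) f x) +oo.
  have fi : mu.-integrable D f.
    apply/integrableP; split => //.
    by rewrite (eq_integral f)// => x; rewrite inE => /f0 ?; rewrite gee0_abs.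
  by rewrite integralB// cstE.
rewrite leye_eq => /eqP foo; rewrite foo addye//.
have mg : measurable_fun D (fun x => f x - L%:E) by exact: emeasurable_funB.
have mgp : measurable_fun D (fun x => f x - L%:E)^\+ by exact: measurable_funepos.
have mgn : measurable_fun D (fun x => f x - L%:E)^\- by exact: measurable_funeneg.
have pos : \int[mu]_(x in D) (fun x => f x - L%:E)^\+ x = +oo.
  have : +oo <= \int[mu]_(x in D) (fun x => f x - L%:E)^\+ x + `|L|%:E.
    rewrite -foo -(cstE `|L|%R) -ge0_integralD//.
    apply: ge0_le_integral => //.
      by apply: emeasurable_funD.
    move=> x Dx; rewrite funeposE; have := f0 _ Dx.
    case: (f x) => [r _|_|]; last by rewrite leeNy_eq.
      2: by rewrite addye// max_l ?leey.
    rewrite -EFinB -EFin_max -EFinD lee_fin.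
    rewrite -lerBlDr le_max; apply/orP; left.
    by rewrite lerD2l lerN2 ler_norm.
  by case: (integral _ _ _).
rewrite integralE pos addye// -ltNye lteNr/=.
apply: (@le_lt_trans _ _ (\int[mu]_(x in D) `|L|%:E)); last by rewrite cstE ltry.
apply: ge0_le_integral => //.
move=> x Dx; rewrite funenegE; have := f0 _ Dx.
case: (f x) => [r r0|_|]; last by rewrite leeNy_eq.
  2: by rewrite addye// max_r ?leNye// lee_fin.
rewrite -EFinB -EFinN -EFin_max lee_fin ge_max normr_ge0 andbT opprB.
by rewrite (le_trans _ (ler_norm L))// gerBl -lee_fin.
Qed.

Lemma ge0_integral_mrestr (d : measure_display) (T : measurableType d)
    (mu : {measure set T -> \bar R}) (N : set T) (mN : measurable N)
    (f : T -> \bar R) : measurable_fun setT f -> (forall x, 0 <= f x) ->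
  \int[mrestr mu mN]_x f x = \int[mu]_(x in N) f x.
Proof.
move=> mf f0.
have NN : mrestr mu mN (~` N) = 0 by rewrite /mrestr/= setICl measure0.
rewrite (ge0_negligible_integral (measurableC mN) measurableT mf _ NN)//.
rewrite setTD setCK; apply: eq_measure_integral => A mA AN.
by change (mu (A `&` N) = mu A); rewrite setIidl.
Qed.

Section Reweight.
Context (d : measure_display) (T : measurableType d).
Context (mu : probability T R) (N : set T) (mN : measurable N).
Context (a b : {nonneg R}).
Context (ab1 : (a%:num * (1 - fine (mu N)) + b%:num * fine (mu N) = 1)%R).

(** The measure with density [a] off [N] and [b] on [N]. Its body mentions [ab1] so that the
    probability structure, which depends on this proof, can be attached to it. *)
Definition reweight := let _ := ab1 in measure_add
  (mscale a (mrestr mu (measurableC mN))) (mscale b (mrestr mu mN)).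

HB.instance Definition _ := Measure.on reweight.

Lemma reweightE (A : set T) :
  reweight A = a%:num%:E * mu (A `&` ~` N) + b%:num%:E * mu (A `&` N).
Proof. by rewrite /reweight measure_addE. Qed.

Let reweightT : reweight setT = 1.
Proof.
rewrite reweightE !setTI probability_setC//.
rewrite -(@fineK _ (mu N)) ?fin_num_measure// -EFinB -!EFinM -EFinD.
by rewrite ab1.
Qed.

HB.instance Definition _ := Measure_isProbability.Build _ _ _ reweight reweightT.

Lemma ge0_integral_reweight (f : T -> \bar R) :
  measurable_fun setT f -> (forall x, 0 <= f x) ->
  \int[reweight]_x f x =
    a%:num%:E * \int[mu]_(x in ~` N) f x + b%:num%:E * \int[mu]_(x in N) f x.
Proof.
move=> mf f0; rewrite ge0_integral_measure_add//.
by rewrite !ge0_integral_mscale// !ge0_integral_mrestr.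
Qed.

End Reweight.

Lemma ge0_integral_full (d : measure_display) (T : measurableType d)
    (mu : probability T R) (D : set T) (f : T -> \bar R) :
  measurable D -> mu D = 1 -> measurable_fun setT f -> (forall x, 0 <= f x) ->
  \int[mu]_(x in D) f x = \int[mu]_x f x.
Proof.
move=> mD D1 mf f0.
have DC : mu (~` D) = 0 by rewrite probability_setC// [X in _ - X]D1 subee.
rewrite [RHS](ge0_negligible_integral (measurableC mD) measurableT mf _ DC)//.
by rewrite setTD setCK.
Qed.

End Kernel.
Arguments reweight {R d T} mu {N} mN {a b} ab1.

Section Frostman.
Context {R : realType}.
Local Open Scope ereal_scope.
Local Notation T := (measurableTypeR R).
Implicit Types (mu rho : probability (measurableTypeR R) R) (e : set R).

Definition log_pot (L : R) mu (x : R) := \int[mu]_y log_kernel L (x, y).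

Lemma measurable_log_pot (L : R) mu : measurable_fun [set: T] (log_pot L mu).
Proof.
have := @measurable_fun_fubini_tonelli_F _ _ (measurableTypeR R)
  (measurableTypeR R) R mu (log_kernel L).
apply; first exact: measurable_log_kernel.
exact: log_kernel_ge0.
Qed.

Lemma log_pot_ge0 (L : R) mu x : 0 <= log_pot L mu x.
Proof. by apply: integral_ge0 => y _; exact: log_kernel_ge0. Qed.

Lemma log_energyE e mu (B L : R) : measurable (e : set T) -> mu e = 1 ->
  (forall x, e x -> `|x| <= B)%R -> (2 * B <= expR L)%R ->
  log_energy e mu = \int[mu]_x log_pot L mu x - L%:E.
Proof.
move=> me mue eB BL.
rewrite -(ge0_integral_full me mue (measurable_log_pot L mu) (log_pot_ge0 L mu)).
rewrite -integral_sub_cst//; last 2 first.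
  exact: measurable_funTS (measurable_log_pot L mu).
  by move=> x _; exact: log_pot_ge0.
apply: eq_integral => x; rewrite inE => ex.
rewrite /log_pot -(ge0_integral_full me mue (measurable_log_kernel_r L x)); last first.
  by move=> y; exact: log_kernel_ge0.
rewrite -integral_sub_cst//; last 2 first.
  exact: measurable_funTS (measurable_log_kernel_r L x).
  by move=> y _; exact: log_kernel_ge0.
apply: eq_integral => y; rewrite inE => ey.
rewrite log_kernelE/=.
  by rewrite addeAC subee// add0e.
rewrite (le_trans (ler_normB _ _))// (le_trans _ BL)// mulr_natl mulr2n.
by rewrite lerD// eB.
Qed.

Lemma tonelli_restr (d : measure_display) (U : measurableType d)
    (mu : probability U R) (N : set U) (k : U * U -> \bar R) :
  measurable N -> measurable_fun [set: U * U] k -> (forall z, 0 <= k z) ->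
  \int[mu]_x \int[mu]_(y in N) k (x, y) = \int[mu]_(y in N) \int[mu]_x k (x, y).
Proof.
move=> mN mk k0.
have Noo : mu N < +oo by rewrite (le_lt_trans (probability_le1 mu mN))// ltry.
have kx x : measurable_fun setT (fun y => k (x, y)).
  exact: measurableT_comp mk (pair1_measurable x).
have mG := @measurable_fun_fubini_tonelli_G _ _ U U R mu k mk k0.
rewrite -(ge0_integral_mrestr mu mN mG); last first.
  by move=> y; apply: integral_ge0.
rewrite /fubini_G -(@fubini_tonelli _ _ U U R mu (mfrestr mN Noo) k)//.
by apply: eq_integral => x _; rewrite -(ge0_integral_mrestr mu mN).
Qed.

Section Minimizer.
Context (e : set R) (rho : probability (measurableTypeR R) R) (B L : R).
Context (me : measurable (e : set T)) (rho_eq : is_equilibrium_measure e rho).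
Context (eB : forall x, e x -> (`|x| <= B)%R) (BL : (2 * B <= expR L)%R).

Let P := log_pot L rho.
Let mP : measurable_fun [set: T] P := measurable_log_pot L rho.
Let P0 : forall x, 0 <= P x := log_pot_ge0 L rho.
Let E := \int[rho]_x P x.

Let rho_e : rho e = 1. Proof. by case: rho_eq. Qed.

Let Efin : E \is a fin_num.
Proof.
rewrite ge0_fin_numE ?integral_ge0//.
have [_ + _] := rho_eq; rewrite (log_energyE me rho_e eB BL) -/P -/E.
by rewrite lteBlDr// => /lt_le_trans; apply; rewrite leey.
Qed.

Let Emin (mu : probability (measurableTypeR R) R) : mu e = 1 ->
  E <= \int[mu]_x log_pot L mu x.
Proof.
move=> mue; have [_ _ /(_ _ mue)] := rho_eq.
rewrite (log_energyE me rho_e eB BL) (log_energyE me mue eB BL).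
by rewrite leeD2rE.
Qed.

(* Otherwise moving mass away from [{P > E}] would decrease the energy. *)
Lemma equilibrium_pot_ae : rho [set x | E < log_pot L rho x] = 0.
Proof.
set N := [set x | _].
have mN : measurable (N : set T).
  rewrite -[N]setTI.
  exact: (emeasurable_fun_o_infty measurableT mP).
apply/eqP; apply: contrapT => /negP m_neq0.
set m := fine (rho N).
have mE : rho N = m%:E by rewrite fineK// fin_num_measure.
have m1 : (m <= 1)%R by rewrite -lee_fin -mE probability_le1.
have m0 : (0 < m)%R.
  rewrite lt_neqAle eq_sym -lee_fin -mE measure_ge0 andbT.
  by apply: contra m_neq0 => /eqP m0; rewrite mE m0.
pose k (z : T * T) := log_kernel L z.
pose A := ~` N.
have mA : measurable (A : set T) by exact: measurableC.
have mk2 : measurable_fun [set: T * T] k by exact: measurable_log_kernel.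
have mk x : measurable_fun [set: T] (fun y : T => k (x, y)).
  exact: measurable_log_kernel_r.
have k0 z : 0 <= k z by exact: log_kernel_ge0.
have AN0 : [disjoint A & N] by rewrite disj_set2E setICl.
have AUN : A `|` N = setT by rewrite setUC setUv.
have splitI (f : T -> \bar R) : measurable_fun [set: T] f -> (forall x, 0 <= f x) ->
    \int[rho]_x f x = \int[rho]_(x in A) f x + \int[rho]_(x in N) f x.
  by move=> mf f0; rewrite -ge0_integral_setU// AUN.
have mI (D : set T) : measurable D ->
    measurable_fun [set: T] (fun x : T => \int[rho]_(y in D) k (x, y)).
  move=> mD.
  have Doo : rho D < +oo by rewrite (le_lt_trans (probability_le1 rho mD))// ltry.
  have := @measurable_fun_fubini_tonelli_F _ _ T T R (mfrestr mD Doo) k mk2 k0.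
  rewrite /fubini_F; congr measurable_fun; apply/funext => x.
  by rewrite -(ge0_integral_mrestr rho mD).
have I0 (D : set T) (x : T) : 0 <= \int[rho]_(y in D) k (x, y).
  by apply: integral_ge0.
pose al (x : T) := \int[rho]_(y in A) k (x, y).
pose nu (x : T) := \int[rho]_(y in N) k (x, y).
have PE x : P x = al x + nu x by rewrite /P /log_pot splitI.
pose AA := \int[rho]_(x in A) al x; pose AN := \int[rho]_(x in A) nu x.
pose NA := \int[rho]_(x in N) al x; pose NN := \int[rho]_(x in N) nu x.
have mal : measurable_fun [set: T] al by exact: mI.
have mnu : measurable_fun [set: T] nu by exact: mI.
have mS (f : T -> \bar R) (D : set T) : measurable_fun [set: T] f ->
    measurable_fun D f by exact: measurable_funTS.
have PD (D : set T) : measurable D ->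
    \int[rho]_(x in D) P x = \int[rho]_(x in D) al x + \int[rho]_(x in D) nu x.
  move=> mD; rewrite -ge0_integralD//.
  - by apply: eq_integral => x _; rewrite PE.
  - by move=> x _; exact: I0.
  - exact: mS.
  - by move=> x _; exact: I0.
  - exact: mS.
have EP : E = \int[rho]_x P x by [].
have PL x : P x = log_pot L rho x by [].
have Pk x : P x = \int[rho]_y k (x, y) by [].
move: EP; clearbody E => EP; clearbody mP P0; clearbody P.
have EE : E = (AA + AN) + (NA + NN).
  rewrite EP; exact: etrans (splitI P mP P0) (f_equal2 _ (PD A mA) (PD N mN)).
have JE : \int[rho]_(x in N) P x = NA + NN by exact: PD.
have JE' : \int[rho]_(x in N) P x = AN + NN.
  transitivity (\int[rho]_x nu x); last by apply: splitI => // x; exact: I0.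
  rewrite [RHS](tonelli_restr rho mN mk2 k0); apply: eq_integral => y _.
  by rewrite Pk; apply: eq_integral => x _; rewrite /k log_kernel_sym.
have ge0s : [/\ 0 <= AA, 0 <= AN, 0 <= NA & 0 <= NN].
  have iI0 (D : set T) (f : T -> \bar R) : (forall x, 0 <= f x) ->
    0 <= \int[rho]_(x in D) f x by move=> f0; apply: integral_ge0 => x _.
  split; [exact: (iI0 A al (I0 A))|exact: (iI0 A nu (I0 N))|
    exact: (iI0 N al (I0 A))|exact: (iI0 N nu (I0 N))].
have [AA0 AN0' NA0 NN0] := ge0s.
have AAE : \int[rho]_(x in A) al x = AA by [].
have ANE : \int[rho]_(x in A) nu x = AN by [].
have NAE : \int[rho]_(x in N) al x = NA by [].
have NNE : \int[rho]_(x in N) nu x = NN by [].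
clearbody AA AN NA NN.
have [fAA fAN fNA fNN] : [/\ AA \is a fin_num, AN \is a fin_num,
    NA \is a fin_num & NN \is a fin_num].
  move: Efin; rewrite EE !ge0_fin_numE ?adde_ge0// => h.
  split; apply: le_lt_trans h.
  - by rewrite -addeA leeDl// !adde_ge0.
  - by rewrite (addeC AA) -addeA leeDl// !adde_ge0.
  - by rewrite addeC -addeA leeDl// !adde_ge0.
  - by rewrite addeA leeDr// !adde_ge0.
move: EE JE JE'.
rewrite -(fineK fAA) -(fineK fAN) -(fineK fNA) -(fineK fNN) -!EFinD.
set aa := fine AA; set an := fine AN; set na := fine NA; set nn := fine NN.
move=> EE JE JE'.
have anna : an = na by move: JE'; rewrite JE => -[] /addIr.
(* The competitor is [rho + t (m rho - rho|N)]: it moves mass away from [N] and keeps the total mass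
   1. *)
have perturb (t : R) : (0 <= t <= 1)%R ->
    (aa + an + (na + nn) <= (1 + t * m) * ((1 + t * m) * aa + (1 + t * m - t) * an)
     + (1 + t * m - t) * ((1 + t * m) * na + (1 + t * m - t) * nn))%R.
  move=> /andP[t0 t1].
  have tm0 : (0 <= t * m)%R by rewrite mulr_ge0// ltW.
  have a0 : (0 <= 1 + t * m)%R by rewrite addr_ge0.
  have b0 : (0 <= 1 + t * m - t)%R by lra.
  have ab1 : ((NngNum a0)%:num * (1 - fine (rho N)) + (NngNum b0)%:num * fine (rho N) = 1)%R.
    by rewrite mE /=; ring.
  pose mt : probability T R := reweight rho mN ab1.
  have mtC : mt (~` e) = 0.
    have meC : measurable (~` e : set T) by exact: measurableC.
    have eC0 : rho (~` e) = 0 by rewrite probability_setC// [X in _ - X]rho_e subee.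
    rewrite [LHS]reweightE.
    have z1 : rho (~` e `&` ~` N) = 0.
      by apply: (subset_measure0 _ _ _ eC0) => //; exact: measurableI.
    have z2 : rho (~` e `&` N) = 0.
      by apply: (subset_measure0 _ _ _ eC0) => //; exact: measurableI.
    by rewrite [X in _ * X + _]z1 [X in _ + _ * X]z2 !mule0 adde0.
  have mte : mt e = 1.
    by rewrite -[e]setCK probability_setC ?[X in _ - X]mtC ?sube0//; exact: measurableC.
  have potE x : log_pot L mt x = (1 + t * m)%:E * al x + (1 + t * m - t)%:E * nu x.
    by rewrite /log_pot ge0_integral_reweight.
  have mc (c : R) (f : T -> \bar R) (D : set T) : measurable_fun [set: T] f ->
    measurable_fun D (fun x => c%:E * f x).
    by move=> mf; apply: measurable_funeM; exact: mS.
  have lin (D : set T) : measurable D -> \int[rho]_(x in D) log_pot L mt x =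
     (1 + t * m)%:E * \int[rho]_(x in D) al x + (1 + t * m - t)%:E * \int[rho]_(x in D) nu x.
    move=> mD; rewrite -ge0_integralZl_EFin//; [|by move=> x _; exact: I0|exact: mS].
    rewrite -ge0_integralZl_EFin//; [|by move=> x _; exact: I0|exact: mS].
    rewrite -ge0_integralD//.
    - by apply: eq_integral => x _; exact: potE.
    - by move=> x _; rewrite mule_ge0 ?lee_fin//; exact: I0.
    - exact: mc.
    - by move=> x _; rewrite mule_ge0 ?lee_fin//; exact: I0.
    - exact: mc.
  have := Emin mte; rewrite ge0_integral_reweight//; last 2 first.
    exact: measurable_log_pot.
    by move=> x; exact: log_pot_ge0.
  rewrite (lin _ mA) (lin _ mN) AAE ANE NAE NNE EE.
  rewrite -(fineK fAA) -(fineK fAN) -(fineK fNA) -(fineK fNN).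
  by move=> H; rewrite -lee_fin; exact: H.
set S := (aa + an + (na + nn))%R in EE perturb.
have J : (na + nn <= S * m)%R.
  rewrite leNgt; apply/negP => J.
  (* The competitor has energy [S + t (t K - 2 dl)] for the raised kernel: [K] is the energy of
     [m rho - rho|N], and [dl] is the excess of the integral of [P] over [N] above [m S]. For small
     [t] a positive [dl] contradicts minimality. *)
  pose K := (m ^+ 2 * S - 2 * m * (na + nn) + nn)%R.
  pose dl := (na + nn - S * m)%R.
  have dl0 : (0 < dl)%R by rewrite subr_gt0.
  have K1 : (0 < `|K| + 1)%R by rewrite ltr_wpDl.
  pose t := Num.min 1%R (dl / (`|K| + 1))%R.
  have t0 : (0 < t)%R by rewrite lt_min ltr01 divr_gt0.
  have t1 : (t <= 1)%R by rewrite ge_min lexx.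
  have tK : (t * K < 2 * dl)%R.
    have : (t * K <= dl)%R.
      rewrite (le_trans (ler_wpM2l (ltW t0) (ler_norm K)))//.
      apply: (@le_trans _ _ (dl / (`|K| + 1) * `|K|)%R).
        by rewrite ler_wpM2r// ge_min lexx orbT.
      by rewrite mulrAC ler_pdivrMr// ler_wpM2l ?ltW// ltrDl.
    lra.
  have /perturb : (0 <= t <= 1)%R by rewrite ltW.
  suff -> : ((1 + t * m) * ((1 + t * m) * aa + (1 + t * m - t) * an) +
      (1 + t * m - t) * ((1 + t * m) * na + (1 + t * m - t) * nn) =
      S + t * (t * K - 2 * dl))%R.
    rewrite lerDl pmulr_rge0//; lra.
  by rewrite /S /K /dl /S anna; ring.
have S0 : (0 <= S)%R by rewrite -lee_fin -EE EP; exact: integral_ge0.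
have mPE : measurable_fun N (fun x : T => P x - S%:E).
  by apply: emeasurable_funB => //; exact: mS.
have PS x : N x -> S%:E < P x by rewrite -EE PL.
have PS0 x : N x -> 0 <= P x - S%:E by move=> /PS/ltW; rewrite sube_ge0.
have INE : \int[rho]_(x in N) (P x - S%:E) = 0.
  apply/eqP; rewrite eq_le integral_ge0 ?andbT//.
  have : \int[rho]_(x in N) P x <= (S * m)%:E by rewrite JE lee_fin.
  have -> : \int[rho]_(x in N) P x = \int[rho]_(x in N) (P x - S%:E) + (S * m)%:E.
    rewrite -[RHS]/(_ + S%:E * m%:E) -mE -integral_cst// -ge0_integralD//.
    by apply: eq_integral => x _; rewrite subeK.
  by rewrite -leeBrDr// subee.
have : ae_eq rho N (fun x : T => P x - S%:E) (cst 0).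
  apply/(ae_eq_integral_abs rho mN mPE).
  by rewrite -INE; apply: eq_integral => x; rewrite inE => /PS0 ?; rewrite gee0_abs.
move=> [M [mM M0 subM]]; move: m_neq0; rewrite (_ : rho N = 0) ?eqxx//.
apply: (subset_measure0 mN mM _ M0) => x Nx; apply: subM => /= /(_ Nx) h.
by have := PS x Nx; rewrite -sube_gt0 h ltxx.
Qed.

End Minimizer.
End Frostman.

(** * Monotonicity, convexity and continuity of the kernel *)

Section KernelBounds.
Context {R : realType}.
Implicit Types (x y a b : R).

Lemma ln_le_subr1 x : 0 < x -> ln x <= x - 1.
Proof.
move=> x0; have := @le_ln1Dx R (x - 1); rewrite addrCA subrr addr0; apply.
by rewrite ltrBrDl subrr.
Qed.

(** Both logarithms lie below the tangent at the mean [m]. *)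
Lemma ln_concave (l u v : R) : 0 <= l <= 1 -> 0 < u -> 0 < v ->
  l * ln u + (1 - l) * ln v <= ln (l * u + (1 - l) * v).
Proof.
move=> /andP[l0 l1] u0 v0; set m := l * u + (1 - l) * v.
have m0 : 0 < m.
  rewrite /m; have [->|ln0] := eqVneq l 0; first by rewrite mul0r add0r subr0 mul1r.
  have l0' : 0 < l by rewrite lt_neqAle eq_sym ln0.
  by rewrite ltr_pwDl ?mulr_gt0// mulr_ge0 ?subr_ge0// ltW.
have h w : 0 < w -> ln w <= ln m + (w / m - 1).
  move=> w0; rewrite -lerBlDl -ln_div ?posrE//.
  by apply: ln_le_subr1; rewrite divr_gt0.
have h1 := ler_wpM2l l0 (h u u0).
have h2 : (1 - l) * ln v <= (1 - l) * (ln m + (v / m - 1)).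
  by rewrite ler_wpM2l ?h// subr_ge0.
apply: (le_trans (lerD h1 h2)); apply/le_of_eq.
have -> : l * (ln m + (u / m - 1)) + (1 - l) * (ln m + (v / m - 1)) =
   ln m + ((l * u + (1 - l) * v) / m - 1) by ring.
by rewrite divff ?gt_eqF// subrr addr0.
Qed.

Local Open Scope ereal_scope.

Lemma log_kernel_pos (L x y : R) : x != y ->
  log_kernel L (x, y) = (Num.max 0 (L - ln `|x - y|))%:E.
Proof.
move=> xy; rewrite /log_kernel lne_EFin ?normr_gt0 ?subr_eq0//.
by rewrite EFin_max EFinB.
Qed.

Lemma log_kernel_diag (L x : R) : log_kernel L (x, x) = +oo.
Proof.
rewrite /log_kernel/= subrr normr0 lexx /= addey//.
by apply/max_idPr; rewrite leey.
Qed.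

Lemma log_kernel_le (L a b y : R) : (`|a - y| <= `|b - y|)%R ->
  log_kernel L (b, y) <= log_kernel L (a, y).
Proof.
move=> ab; have [->|ay] := eqVneq a y; first by rewrite log_kernel_diag leey.
have a0 : (0 < `|a - y|)%R by rewrite normr_gt0 subr_eq0.
have b0 : (0 < `|b - y|)%R by exact: lt_le_trans ab.
have yb : b != y by rewrite -subr_eq0 -normr_gt0.
rewrite !log_kernel_pos// lee_fin ge_max !le_max lexx/=.
by rewrite lerD2l lerN2 ler_ln ?posrE// ab orbT.
Qed.

(** On one side of [y] the distance to [y] is affine; composing with the convex function [- ln] and
    taking the maximum with 0 preserve convexity. *)
Lemma log_kernel_convex (L l a b x y : R) : (0 < l < 1)%R ->
  x = (l * a + (1 - l) * b)%R ->
  (y <= a /\ y <= b)%R \/ (a <= y /\ b <= y)%R ->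
  log_kernel L (x, y) <= l%:E * log_kernel L (a, y) + (1 - l)%:E * log_kernel L (b, y).
Proof.
move=> /andP[l0 l1] xE yab.
have l1' : (0 < 1 - l)%R by rewrite subr_gt0.
have [->|ya] := eqVneq a y.
  by rewrite log_kernel_diag gt0_muley ?lte_fin// addye ?leey// -ltNye (@lt_le_trans _ _ 0)// mule_ge0 ?log_kernel_ge0// lee_fin ltW.
have [->|yb] := eqVneq b y.
  by rewrite log_kernel_diag gt0_muley ?lte_fin// addey ?leey// -ltNye (@lt_le_trans _ _ 0)// mule_ge0 ?log_kernel_ge0// lee_fin ltW.
have xyE : (`|x - y| = l * `|a - y| + (1 - l) * `|b - y|)%R.
  case: yab => -[h1 h2].
    have h3 : (y <= x)%R by rewrite xE; nra.
    by rewrite !ger0_norm ?subr_ge0// xE; ring.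
  have h3 : (x <= y)%R by rewrite xE; nra.
  by rewrite !ler0_norm ?subr_le0// xE; ring.
have ay0 : (0 < `|a - y|)%R by rewrite normr_gt0 subr_eq0.
have by0 : (0 < `|b - y|)%R by rewrite normr_gt0 subr_eq0.
have xy : x != y by rewrite -subr_eq0 -normr_gt0 xyE addr_gt0// mulr_gt0.
rewrite !log_kernel_pos// -!EFinM -EFinD lee_fin ge_max; apply/andP; split.
  by apply: addr_ge0; apply: mulr_ge0; rewrite ?(ltW l0) ?(ltW l1')// le_max lexx.
apply: (@le_trans _ _ (l * (L - ln `|a - y|) + (1 - l) * (L - ln `|b - y|))%R).
  rewrite xyE; have := @ln_concave l _ _ _ ay0 by0; rewrite ltW//= ltW// => /(_ isT).
  by lra.
by apply: lerD; apply: ler_wpM2l; rewrite ?(ltW l0) ?(ltW l1')// le_max lexx orbT.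
Qed.

Lemma cvg_log_kernel (L x y : R) (u : R^nat) : u @ \oo --> x ->
  log_kernel L (u n, y) @[n --> \oo] --> log_kernel L (x, y).
Proof.
move=> ux; have d : `|u n - y|%R @[n --> \oo] --> `|x - y|%R.
  by apply: cvg_norm; apply: cvgB => //; exact: cvg_cst.
have [xy|xy] := eqVneq x y.
  rewrite xy log_kernel_diag; apply/cvgeyPge => A.
  rewrite xy subrr normr0 in d.
  have : \forall n \near \oo, (`|u n - y| < expR (L - A))%R.
    by apply: (cvgr_lt 0%R) => //; exact: expR_gt0.
  apply: filterS => n un.
  have [->|uy] := eqVneq (u n) y; first by rewrite log_kernel_diag leey.
  rewrite log_kernel_pos// lee_fin le_max; apply/orP; right.
  rewrite lerBrDr -lerBrDl -(expRK (L - A)%R) ler_ln ?posrE ?expR_gt0 ?ltW//.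
  by rewrite normr_gt0 subr_eq0.
have xy0 : (0 < `|x - y|)%R by rewrite normr_gt0 subr_eq0.
have near0 : \forall n \near \oo, u n != y.
  have : \forall n \near \oo, (0 < `|u n - y|)%R.
    by apply: (cvgr_gt `|x - y|%R).
  by apply: filterS => n; rewrite normr_gt0 subr_eq0.
apply: (@cvg_trans _ ((Num.max 0 (L - ln `|u n - y|))%:E @[n --> \oo])).
  by apply: near_eq_cvg; apply: filterS near0 => n uy; rewrite log_kernel_pos.
rewrite log_kernel_pos//; apply: cvg_EFin; first exact: nearW.
have c : {for `|x - y|%R, continuous (fun v : R => Num.max 0 (L - ln v))%R}.
  apply: (@continuous_max _ _ (fun=> 0%R) (fun v : R => (L - ln v)%R)).
    exact: cvg_cst.
  by apply: cvgB; [exact: cvg_cst|exact: continuous_ln].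
exact: (continuous_cvg _ c d).
Qed.
End KernelBounds.

(** * Frostman's bound at every point of an interval *)

Section FrostmanEverywhere.
Context {R : realType}.
Local Notation T := (measurableTypeR R).
Local Open Scope ereal_scope.
Context (e : set R) (rho : probability T R) (B L : R).
Context (me : measurable (e : set T)) (rho_eq : is_equilibrium_measure e rho).
Context (eB : forall x, e x -> (`|x| <= B)%R) (BL : (2 * B <= expR L)%R).

Let P := log_pot L rho.
Let E := \int[rho]_x P x.

(** Lower semicontinuity of the potential: Fatou's lemma for the nonnegative kernel, which is
    continuous in its first variable, the value [+oo] included. *)
Lemma log_pot_closed (u : R^nat) (x : R) : u @ \oo --> x ->
  (forall n, P (u n) <= E) -> P x <= E.
Proof.
move=> ux Pu.
have mk z : measurable_fun [set: T] (fun y : T => log_kernel L (z, y)).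
  exact: measurable_log_kernel_r.
have -> : P x = \int[rho]_y limn_einf (fun n => log_kernel L (u n, y)).
  apply: eq_integral => y _.
  by have [-> _] := cvg_limn_einf_sup (@cvg_log_kernel _ L x y u ux).
apply: (le_trans (fatou _ _ _ _)) => //.
  by move=> n y _; exact: log_kernel_ge0.
rewrite limn_einf_lim; apply: lime_le; first exact: is_cvg_einfs.
apply: nearW => n; apply: (@le_trans _ _ (P (u n))) => //.
by apply: ereal_inf_lbound; exists n => //=.
Qed.

Lemma log_pot_adherent (x : R) :
  (forall eps : R, (0 < eps)%R -> exists2 s, (`|x - s| < eps)%R & P s <= E) ->
  P x <= E.
Proof.
move=> h; have /choice[u hu] : forall n : nat,
    exists s, (`|x - s| < n.+1%:R^-1)%R /\ P s <= E.
  by move=> n; have [|s ? ?] := h (n.+1%:R^-1)%R; [rewrite invr_gt0|exists s].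
apply: (@log_pot_closed u) => [|n]; last by case: (hu n).
apply/cvgrPdist_lt => eps e0; near=> n; have [+ _] := hu n.
by move/lt_trans; apply; near: n; exact: near_infty_natSinv_lt (PosNum e0).
Unshelve. all: by end_near. Qed.

(* Outside the set where [P <= E], use the convexity of the kernel between the
   nearest points of that set on either side. *)
Lemma log_pot_le (a : R) : (`|a| <= B)%R -> P a <= E.
Proof.
move=> aB; rewrite leNgt; apply/negP => Pa.
have rho_e : rho e = 1 by case: rho_eq.
pose N := [set x | E < P x].
have N0 : rho N = 0 by exact: (equilibrium_pot_ae me rho_eq eB BL).
have mP : measurable_fun [set: T] P by exact: measurable_log_pot.
have mN : measurable (N : set T).
  by rewrite -[N]setTI; exact: (emeasurable_fun_o_infty measurableT mP).
pose S := e `\` N.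
have mS : measurable (S : set T) by exact: measurableD.
have S1 : rho S = 1.
  have eN0 : rho (e `&` N) = 0.
    by apply: (subset_measure0 _ mN _ N0) => //; exact: measurableI.
  by have := measureDI rho me mN; rewrite [X in _ = _ + X]eN0 adde0 -/S [X in X = _]rho_e.
have PS x : S x -> P x <= E by move=> [_]; rewrite /N/= => /negP; rewrite -leNgt.
have Efin : E \is a fin_num.
  rewrite ge0_fin_numE; first exact: lt_le_trans Pa (leey _).
  by apply: integral_ge0 => x _; exact: log_pot_ge0.
(* A contradiction arises as soon as the kernel at [a] is dominated, on the set [S] of full measure,
   by a convex combination of kernels at two points where [P <= E]. *)
have key l (a1 b1 : R) : (0 <= l <= 1)%R -> P a1 <= E -> P b1 <= E ->
   (forall y, S y -> log_kernel L (a, y) <=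
    l%:E * log_kernel L (a1, y) + (1 - l)%:E * log_kernel L (b1, y)) -> False.
  move=> /andP[l0 l1] Pa1 Pb1 H.
  have l1' : (0 <= 1 - l)%R by rewrite subr_ge0.
  have PE z : P z = \int[rho]_(y in S) log_kernel L (z, y).
    rewrite (ge0_integral_full mS S1)//; first exact: measurable_log_kernel_r.
    by move=> y; exact: log_kernel_ge0.
  have mk z : measurable_fun S (fun y : T => log_kernel L (z, y)).
    exact: measurable_funTS (measurable_log_kernel_r L z).
  have k0 z y : 0 <= log_kernel L (z, y) by exact: log_kernel_ge0.
  suff : P a <= E by rewrite leNgt Pa.
  apply: (@le_trans _ _ (l%:E * P a1 + (1 - l)%:E * P b1)).
    have ZE (c : R) z : (0 <= c)%R ->
        c%:E * P z = \int[rho]_(y in S) (c%:E * log_kernel L (z, y)).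
      by move=> c0; rewrite PE ge0_integralZl_EFin //; exact: mk.
    rewrite PE (ZE l)// (ZE (1 - l)%R)//.
    have lk0 c z y : (0 <= c)%R -> 0 <= c%:E * log_kernel L (z, y).
      by move=> c0; rewrite mule_ge0 ?lee_fin.
    rewrite -(ge0_integralD rho mS (fun y _ => lk0 l a1 y l0) _
      (fun y _ => lk0 (1 - l)%R b1 y l1')); try (apply: measurable_funeM; exact: mk).
    apply: (@ge0_le_integral _ _ _ rho S mS _ _ (fun y _ => k0 a y) (mk a) _ H).
    by apply: emeasurable_funD; apply: measurable_funeM; exact: mk.
  apply: (@le_trans _ _ (l%:E * E + (1 - l)%:E * E)).
    by apply: leeD; apply: lee_wpmul2l; rewrite ?lee_fin.
  by rewrite -ge0_muleDl ?lee_fin// -EFinD addrC subrK mul1e.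
pose lft := [set x | S x /\ (x <= a)%R].
pose rgt := [set x | S x /\ (a <= x)%R].
have left_end : lft !=set0 -> exists a1, [/\ P a1 <= E, (a1 < a)%R &
   forall y, S y -> (y <= a)%R -> (y <= a1)%R].
  move=> lft0; have hs : has_sup lft by split => //; exists a => x [].
  have Psup : P (sup lft) <= E.
    apply: log_pot_adherent => eps e0.
    have [s ls ss] := sup_adherent e0 hs; exists s; last by case: ls => /PS.
    have sl : (s <= sup lft)%R by exact: ub_le_sup hs.2 _ ls.
    by rewrite ger0_norm ?subr_ge0//; lra.
  exists (sup lft); split => //.
    rewrite lt_neqAle; apply/andP; split.
      by apply: contraTneq Psup => ->; rewrite -ltNge.
    by apply: ge_sup => // x [].
  by move=> y Sy ya; apply: ub_le_sup hs.2 _ _.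
have right_end : rgt !=set0 -> exists b1, [/\ P b1 <= E, (a < b1)%R &
   forall y, S y -> (a <= y)%R -> (b1 <= y)%R].
  move=> rgt0; have hs : has_inf rgt by split => //; exists a => x [].
  have Pinf : P (inf rgt) <= E.
    apply: log_pot_adherent => eps e0.
    have [s ls ss] := inf_adherent e0 hs; exists s; last by case: ls => /PS.
    have sl : (inf rgt <= s)%R by exact: ge_inf hs.2 _ ls.
    by rewrite ler0_norm ?subr_le0//; lra.
  exists (inf rgt); split => //.
    rewrite lt_neqAle; apply/andP; split.
      by apply: contraTneq Pinf => <-; rewrite -ltNge.
    by apply: lb_le_inf => // x [].
  by move=> y Sy ya; apply: ge_inf hs.2 _ _.
have [s Ss] : S !=set0.
  apply/set0P/eqP => S0; move: S1; rewrite S0 measure0 => /eqP.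
  by rewrite eqe eq_sym oner_eq0.
have [lft0|/set0P/negP/negPn/eqP lft0] := pselect (lft !=set0).
  have [a1 [Pa1 a1a ya1]] := left_end lft0.
  have [rgt0|/set0P/negP/negPn/eqP rgt0] := pselect (rgt !=set0).
    have [b1 [Pb1 ab1 yb1]] := right_end rgt0.
    have ba0 : (0 < b1 - a1)%R by lra.
    pose l := ((b1 - a) / (b1 - a1))%R.
    have l0 : (0 < l)%R by rewrite divr_gt0//; lra.
    have l1 : (l < 1)%R by rewrite ltr_pdivrMr//; lra.
    have aE : a = (l * a1 + (1 - l) * b1)%R.
      by rewrite /l; field; rewrite gt_eqF.
    apply: (key l a1 b1) => //; first by rewrite !ltW.
    move=> y Sy; apply: log_kernel_convex => //; first by rewrite l0.
    have [ya|/ltW ya] := leP y a.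
      by left; have := ya1 _ Sy ya; split => //; lra.
    by right; have := yb1 _ Sy ya; split => //; lra.
  (* All of [S] lies to the left of [a], hence nearer to [a1] than to [a]; monotonicity in the
     distance replaces convexity. *)
  apply: (key 1%R a1 a1) => //; first by rewrite ler01 lexx.
  move=> y Sy; rewrite mul1e subrr mul0e adde0; apply: log_kernel_le.
  have [ya|/ltW ya] := leP y a; last first.
    by have : rgt y by []; rewrite rgt0.
  by have ? := ya1 _ Sy ya; rewrite !ger0_norm; lra.
have [b1 [Pb1 ab1 yb1]] : exists b1, [/\ P b1 <= E, (a < b1)%R &
   forall y, S y -> (a <= y)%R -> (b1 <= y)%R].
  apply: right_end; exists s; split => //.
  have [sa|/ltW//] := leP s a.
  by have : lft s by []; rewrite lft0.
apply: (key 1%R b1 b1) => //; first by rewrite ler01 lexx.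
move=> y Sy; rewrite mul1e subrr mul0e adde0; apply: log_kernel_le.
have [ya|/ltW ya] := leP y a.
  by have : lft y by []; rewrite lft0.
by have ? := yb1 _ Sy ya; rewrite !ler0_norm; lra.
Qed.
End FrostmanEverywhere.

(** * The logarithmic potential *)

Section LogModulus.
Context {R : realType}.
Local Notation plane := (R * R)%type.
Local Notation T := (measurableTypeR R).
Implicit Types (z w p : plane) (x a b r : R).

(* The logarithm of the modulus, with the junk value 0 at the origin. Where this
   matters, [log_kernel] is used instead. *)
Definition log_mod z : R := ln (z.1 ^+ 2 + z.2 ^+ 2) / 2.

Lemma ler_sqr_inv a b : 0 <= b -> a ^+ 2 <= b ^+ 2 -> a <= b.
Proof.
move=> b0; rewrite -(real_normK (num_real a)) ler_sqr ?nnegrE//.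
exact: le_trans (ler_norm a).
Qed.

Lemma modulus_ge0 z : 0 <= modulus z. Proof. exact: sqrtr_ge0. Qed.

Lemma sqr_modulus z : modulus z ^+ 2 = z.1 ^+ 2 + z.2 ^+ 2.
Proof. by rewrite sqr_sqrtr// addr_ge0 ?sqr_ge0. Qed.

Lemma log_modE z : log_mod z = ln (modulus z).
Proof.
rewrite /log_mod -sqr_modulus; have := modulus_ge0 z.
rewrite le_eqVlt => /predU1P[<-|m0]; first by rewrite expr0n/= ln0// mul0r.
by rewrite lnXn// mulr2n; lra.
Qed.

Lemma modulus_sub z x : modulus (z.1 - x, z.2) <= modulus z + `|x|.
Proof.
have m0 := modulus_ge0 z; have x0 := normr_ge0 x.
apply: ler_sqr_inv; rewrite ?addr_ge0//.
rewrite sqr_modulus/= [leRHS]sqrrD sqr_modulus real_normK ?num_real//.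
have z1 : `|z.1| <= modulus z.
  apply: ler_sqr_inv; rewrite ?modulus_ge0// sqr_modulus real_normK ?num_real//.
  by rewrite lerDl sqr_ge0.
have : `|z.1| * `|x| <= modulus z * `|x| by rewrite ler_wpM2r.
have : - (z.1 * x) <= `|z.1| * `|x| by rewrite -normrM -normrN ler_norm.
by rewrite sqrrB; lra.
Qed.

Lemma modulus_sub_ge z x : modulus z - `|x| <= modulus (z.1 - x, z.2).
Proof.
rewrite lerBlDr; have := modulus_sub (z.1 - x, z.2) (- x).
by rewrite /= opprK subrK normrN -surjective_pairing.
Qed.

Lemma modulus_ge_fst z : `|z.1| <= modulus z.
Proof.
apply: ler_sqr_inv; rewrite ?modulus_ge0// sqr_modulus.
by rewrite real_normK ?num_real// lerDl sqr_ge0.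
Qed.

Lemma modulus_ge_snd z : `|z.2| <= modulus z.
Proof.
apply: ler_sqr_inv; rewrite ?modulus_ge0// sqr_modulus.
by rewrite real_normK ?num_real// lerDr sqr_ge0.
Qed.

Lemma modulus_le_norm z : modulus z <= `|z.1| + `|z.2|.
Proof.
apply: ler_sqr_inv; rewrite ?addr_ge0// sqr_modulus sqrrD.
rewrite !real_normK ?num_real// -addrA lerD2l lerDr.
by rewrite mulrn_wge0// mulr_ge0.
Qed.

Lemma measurable_log_mod z :
  measurable_fun [set: T] (fun x : T => log_mod (z.1 - x, z.2)).
Proof.
have m1 : measurable_fun [set: T] (fun x : T => z.1 - x : R).
  by apply: measurable_funB => //; exact: measurable_idTR.
rewrite /log_mod /=; apply: measurable_funM; last exact: measurable_cst.
apply: measurableT_comp; first exact: measurable_ln.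
by apply: measurable_funD => //; exact: measurable_funX.
Qed.

(* The five-point difference is [ln |1 - (r / (z - p)) ^ 4|]. *)
Lemma five_point_log_mod (p z : plane) (d r : R) : 0 < d ->
  d ^+ 2 <= (z.1 - p.1) ^+ 2 + (z.2 - p.2) ^+ 2 -> 0 <= r <= d / 2 ->
  `|five_point (fun y => log_mod (y.1 - p.1, y.2 - p.2)) z r| <=
    3 * r ^+ 4 / d ^+ 4.
Proof.
move=> d0; set u := z.1 - p.1; set v := z.2 - p.2 => ds /andP[r0 rd].
set s := u ^+ 2 + v ^+ 2 in ds.
have d20 : 0 < d ^+ 2 by rewrite exprn_gt0.
have s0 : 0 < s by exact: lt_le_trans ds.
have rs : 4 * r ^+ 2 <= s by apply: le_trans ds; nra.
(* With [w = u + i v] and [s = |w|^2], this is [|1 - (r / w)^4|^2 - 1]; the polynomial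
   [u^4 - 6 u^2 v^2 + v^4] is the real part of [w^4]. *)
pose X := (r ^+ 8 - 2 * r ^+ 4 * (u ^+ 4 - 6 * u ^+ 2 * v ^+ 2 + v ^+ 4)) / s ^+ 4.
have re : `|u ^+ 4 - 6 * u ^+ 2 * v ^+ 2 + v ^+ 4| <= s ^+ 2.
  rewrite ler_norml /s; apply/andP; split.
    rewrite -subr_ge0; have -> : u ^+ 4 - 6 * u ^+ 2 * v ^+ 2 + v ^+ 4 - - (u ^+ 2 + v ^+ 2) ^+ 2 =
      2 * (u ^+ 2 - v ^+ 2) ^+ 2 by ring.
    by rewrite mulr_ge0// sqr_ge0.
  rewrite -subr_ge0; have -> : (u ^+ 2 + v ^+ 2) ^+ 2 - (u ^+ 4 - 6 * u ^+ 2 * v ^+ 2 + v ^+ 4) =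
      8 * (u * v) ^+ 2 by ring.
  by rewrite mulr_ge0// sqr_ge0.
have r4s : r ^+ 4 <= s ^+ 2 / 16.
  rewrite ler_pdivlMr//; have -> : r ^+ 4 * 16 = (4 * r ^+ 2) ^+ 2 by ring.
  by rewrite lerXn2r// nnegrE ?(ltW s0)// mulr_ge0// sqr_ge0.
have r40 : 0 <= r ^+ 4 by rewrite exprn_ge0.
have s20 : 0 < s ^+ 2 by rewrite exprn_gt0.
have s40 : 0 < s ^+ 4 by rewrite exprn_gt0.
have XB : `|X| <= 3 * r ^+ 4 / s ^+ 2.
  rewrite /X normrM (ger0_norm (x := (s ^+ 4)^-1)) ?invr_ge0 ?(ltW s40)//.
  rewrite ler_pdivrMr//.
  have -> : 3 * r ^+ 4 / s ^+ 2 * s ^+ 4 = 3 * r ^+ 4 * s ^+ 2.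
    by field; rewrite gt_eqF.
  rewrite (le_trans (ler_normB _ _))// (ger0_norm (exprn_ge0 8 r0)).
  rewrite normrM (ger0_norm (x := 2 * r ^+ 4)) ?mulr_ge0//.
  have : r ^+ 8 <= r ^+ 4 * s ^+ 2.
    have -> : r ^+ 8 = r ^+ 4 * r ^+ 4 by ring.
    by rewrite ler_wpM2l//; lra.
  have : 2 * r ^+ 4 * `|u ^+ 4 - 6 * u ^+ 2 * v ^+ 2 + v ^+ 4| <= 2 * r ^+ 4 * s ^+ 2.
    by rewrite ler_wpM2l// mulr_ge0.
  lra.
have X4 : `|X| <= 3 / 16.
  rewrite (le_trans XB)// ler_pdivrMr//; lra.
have X1 : 0 < 1 + X by move: X4; rewrite ler_norml => /andP[? ?]; lra.
have five : five_point (fun y => log_mod (y.1 - p.1, y.2 - p.2)) z r = ln (1 + X) / 2.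
  rewrite /five_point /log_mod /=.
  have -> : z.1 + r - p.1 = u + r by rewrite /u; ring.
  have -> : z.1 - r - p.1 = u - r by rewrite /u; ring.
  have -> : z.2 + r - p.2 = v + r by rewrite /v; ring.
  have -> : z.2 - r - p.2 = v - r by rewrite /v; ring.
  rewrite -/u -/v -/s.
  have pos a b : 4 * r ^+ 2 <= a ^+ 2 + b ^+ 2 -> 0 < a ^+ 2 + b ^+ 2 -> 0 < (a + r) ^+ 2 + b ^+ 2.
    move=> h1 h2; rewrite lt_neqAle addr_ge0 ?sqr_ge0// andbT eq_sym.
    apply/negP => /eqP E.
    have /andP[/eqP E1 /eqP E2] : (a + r == 0) && (b == 0).
      by have := E => /eqP; rewrite paddr_eq0 ?sqr_ge0// !expf_eq0.
    have a2 : a = - r by lra.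
    by move: h1 h2; rewrite a2 E2; nra.
  have p1 : 0 < (u + r) ^+ 2 + v ^+ 2 by exact: pos.
  have p2 : 0 < (u - r) ^+ 2 + v ^+ 2.
    rewrite -sqrrN opprB addrC [r - u]addrC addrC.
    by apply: pos; rewrite sqrrN.
  have p3 : 0 < u ^+ 2 + (v + r) ^+ 2.
    by rewrite addrC; apply: pos; rewrite addrC.
  have p4 : 0 < u ^+ 2 + (v - r) ^+ 2.
    rewrite addrC -sqrrN opprB addrC [r - v]addrC addrC.
    by apply: pos; rewrite sqrrN addrC.
  have -> : 1 + X = ((u + r) ^+ 2 + v ^+ 2) * ((u - r) ^+ 2 + v ^+ 2) *
     ((u ^+ 2 + (v + r) ^+ 2) * (u ^+ 2 + (v - r) ^+ 2)) / s ^+ 4.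
    by rewrite /X /s; field; rewrite gt_eqF.
  rewrite ln_div ?posrE ?mulr_gt0// lnXn// !lnM ?posrE ?mulr_gt0//.
  rewrite -mulr_natr; lra.
rewrite five normrM (ger0_norm (x := 2^-1))//.
clearbody X.
have X1' : -1 < X by lra.
have lnX : `|ln (1 + X)| <= 2 * `|X|.
  rewrite ler_norml; apply/andP; split; last first.
    by have := le_ln1Dx X1'; have := normr_ge0 X; have := ler_norm X; lra.
  have := ln_le_subr1 (x := (1 + X)^-1); rewrite invr_gt0 => /(_ X1).
  rewrite lnV ?posrE// => h.
  have : (1 + X)^-1 - 1 <= 2 * `|X|.
    have -> : (1 + X)^-1 - 1 = - X / (1 + X) by field; rewrite gt_eqF.
    rewrite ler_pdivrMr// (le_trans (ler_norm _))// normrN.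
    rewrite mulrAC -[leLHS]mul1r ler_wpM2r//.
    by move: X4; rewrite ler_norml => /andP[? ?]; lra.
  lra.
rewrite ler_pdivrMr//; apply: (le_trans lnX).
have : `|X| <= 3 * r ^+ 4 / d ^+ 4; last lra.
rewrite (le_trans XB)// ler_wpM2l// ?mulr_ge0//.
rewrite lef_pV2 ?posrE ?exprn_gt0//.
have -> : d ^+ 4 = (d ^+ 2) ^+ 2 by ring.
by rewrite lerXn2r// nnegrE ltW.
Qed.

Lemma log_mod_lipschitz (w w' : plane) (d : R) : 0 < d ->
  d ^+ 2 <= w.1 ^+ 2 + w.2 ^+ 2 -> d ^+ 2 <= w'.1 ^+ 2 + w'.2 ^+ 2 ->
  `|log_mod w - log_mod w'| <=
    `|w.1 ^+ 2 + w.2 ^+ 2 - (w'.1 ^+ 2 + w'.2 ^+ 2)| / d ^+ 2.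
Proof.
wlog le : w w' / w'.1 ^+ 2 + w'.2 ^+ 2 <= w.1 ^+ 2 + w.2 ^+ 2.
  move=> H d0 h h'; have [/H|/ltW/H] := leP (w'.1 ^+ 2 + w'.2 ^+ 2) (w.1 ^+ 2 + w.2 ^+ 2).
    exact.
  by rewrite distrC => /(_ d0 h' h) /le_trans; apply; rewrite distrC.
move=> d0; rewrite /log_mod.
move: le; set s := w.1 ^+ 2 + w.2 ^+ 2; set s' := w'.1 ^+ 2 + w'.2 ^+ 2 => le.
move=> h h'.
have d20 : 0 < d ^+ 2 by rewrite exprn_gt0.
have s0 : 0 < s by exact: lt_le_trans h.
have s'0 : 0 < s' by exact: lt_le_trans h'.
rewrite -mulrBl -ln_div ?posrE// ger0_norm; last first.
  by rewrite mulr_ge0// ln_ge0// ler_pdivlMr// mul1r.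
rewrite ger0_norm ?subr_ge0//.
apply: (@le_trans _ _ (ln (s / s'))).
  rewrite ler_pdivrMr// mulr_natr mulr2n lerDl ln_ge0// ler_pdivlMr// mul1r//.
rewrite (le_trans (ln_le_subr1 _)) ?divr_gt0//.
have -> : s / s' - 1 = (s - s') / s' by field; rewrite gt_eqF.
by rewrite ler_wpM2l ?subr_ge0// lef_pV2 ?posrE.
Qed.

End LogModulus.

(** * The potential of the equilibrium measure *)

Section LogPotential.
Context {R : realType}.
Local Notation plane := (R * R)%type.
Local Notation T := (measurableTypeR R).
Implicit Types (z w p : plane) (x a b r : R).

Definition potential (e : set R) (rho : probability T R) z : R :=
  \int[rho]_(x in e) log_mod (z.1 - x, z.2).

Lemma compact_norm_bound (e : set R) : compact e ->
  exists2 B : R, 1 <= B & forall x, e x -> `|x| <= B.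
Proof.
move=> /compact_bounded[M [_ MB]]; exists (Num.max 1 (M + 1)).
  by rewrite le_max lexx.
by move=> x ex; apply: MB => //; rewrite lt_max ltrDl ltr01 orbT.
Qed.

Context (e : set R) (rho : probability T R).
Context (ce : compact e) (rho_eq : is_equilibrium_measure e rho).

Let me : measurable (e : set T). Proof. exact: compact_measurable. Qed.
Let rho_e : rho e = 1%E. Proof. by case: rho_eq. Qed.

Definition robin : R := fine (log_energy e rho).

Lemma log_energy_robin : log_energy e rho = robin%:E.
Proof.
have [B B1 eB] := compact_norm_bound ce.
have BL : 2 * B <= expR (2 * B) by rewrite (le_trans _ (expR_ge1Dx _))// lerDr.
rewrite fineK//; have [_ + _] := rho_eq.
rewrite (log_energyE me rho_e eB BL) => h.
have I0 : (0 <= \int[rho]_x log_pot (2 * B) rho x)%E.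
  by apply: integral_ge0 => x _; exact: log_pot_ge0.
rewrite fin_numB andbT ge0_fin_numE//.
by move: h; rewrite lteBlDr// => /lt_le_trans; apply; rewrite leey.
Qed.

Lemma robin_min (mu : probability T R) : mu e = 1%E -> (robin%:E <= log_energy e mu)%E.
Proof. by case: rho_eq => _ _ h /h; rewrite log_energy_robin. Qed.

(** Moving vertically off the axis only increases distances to the set, so Frostman's bound at the
    projection [z.1] serves the whole plane. Where [log_mod] takes its junk value 0 the kernel is
    [+oo], which keeps the last inequality true. *)
Lemma potential_kernel z : exists L : R, [/\
  (\int[rho]_(x in e) log_kernel L (z.1, x) <= (robin + L)%:E)%E,
  forall x, e x -> 0 <= L - log_mod (z.1 - x, z.2) &
  forall x, e x -> ((L - log_mod (z.1 - x, z.2))%:E <= log_kernel L (z.1, x))%E].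
Proof.
have [B0 B01 eB0] := compact_norm_bound ce.
pose B := B0 + `|z.1| + `|z.2|.
have n1 := normr_ge0 z.1; have n2 := normr_ge0 z.2.
have eB x : e x -> `|x| <= B by move=> /eB0; rewrite /B; lra.
have B1 : 1 <= B by rewrite /B; lra.
pose L := 2 * B.
have BL : 2 * B <= expR L by rewrite (le_trans _ (expR_ge1Dx _))// lerDr.
have zB : `|z.1| <= B by rewrite /B; lra.
exists L.
have lemod x : e x -> modulus (z.1 - x, z.2) <= expR L.
  move=> ex; rewrite (le_trans (modulus_sub _ _))// (le_trans _ BL)//.
  by have := modulus_le_norm z; have := eB0 _ ex; rewrite /B; lra.
have lnL x : e x -> 0 <= L - log_mod (z.1 - x, z.2).
  move=> ex; rewrite subr_ge0 log_modE; have := modulus_ge0 (z.1 - x, z.2).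
  rewrite le_eqVlt => /predU1P[<-|m0]; first by rewrite ln0//; rewrite /L; lra.
  by rewrite -(expRK L) ler_ln ?posrE ?expR_gt0// lemod.
split => //.
- rewrite (ge0_integral_full me rho_e (measurable_log_kernel_r L z.1)); last first.
    by move=> y; exact: log_kernel_ge0.
  have := log_pot_le me rho_eq eB BL zB; rewrite /log_pot => /le_trans; apply.
  have := log_energyE me rho_e eB BL; rewrite log_energy_robin EFinD => ->.
  by rewrite subeK.
- move=> x ex; have [->|zx] := eqVneq z.1 x; first by rewrite log_kernel_diag leey.
  rewrite log_kernel_pos// lee_fin le_max; apply/orP; right.
  rewrite lerD2l lerN2 log_modE ler_ln ?posrE ?normr_gt0 ?subr_eq0//.
    exact: (modulus_ge_fst (z.1 - x, z.2)).
  apply: lt_le_trans (modulus_ge_fst (z.1 - x, z.2)).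
  by rewrite normr_gt0 subr_eq0.
Qed.

Lemma log_kernel_integrable (L a c : R) :
  (\int[rho]_(x in e) log_kernel L (a, x) <= c%:E)%E ->
  rho.-integrable e (fun x : T => log_kernel L (a, x)).
Proof.
move=> h; apply/integrableP; split.
  exact: measurable_funTS (measurable_log_kernel_r L a).
under eq_integral do rewrite gee0_abs ?log_kernel_ge0//.
exact: le_lt_trans h (ltry _).
Qed.

Lemma log_mod_integrable z :
  rho.-integrable e (fun x : T => (log_mod (z.1 - x, z.2))%:E).
Proof.
have [L [kL f0 fk]] := potential_kernel z.
have ki := log_kernel_integrable kL.
have ci : rho.-integrable e (fun=> L%:E).
  by have := finite_measure_integrable_cst rho L me.
have mf : measurable_fun e (fun x : T => log_mod (z.1 - x, z.2)).
  exact: measurable_funTS (measurable_log_mod z).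
have fi : rho.-integrable e (fun x : T => (L - log_mod (z.1 - x, z.2))%:E).
  apply: le_integrable ki => //.
    by apply/measurable_EFinP; apply: measurable_funB.
  by move=> x ex; rewrite gee0_abs ?lee_fin ?f0// gee0_abs ?fk// log_kernel_ge0.
have := integrableB me ci fi; apply: eq_integrable => // x _ /=.
by rewrite -EFinB opprB addrC subrK.
Qed.

Lemma potential_ge z : - robin <= potential e rho z.
Proof.
have [L [kL f0 fk]] := potential_kernel z.
have ki := log_kernel_integrable kL.
have ci : rho.-integrable e (EFin \o (fun=> L)).
  by have := finite_measure_integrable_cst rho L me.
have li := log_mod_integrable z.
have mf : measurable_fun e (fun x : T => (L - log_mod (z.1 - x, z.2))%:E).
  apply/measurable_EFinP; apply: measurable_funB => //.
  exact: measurable_funTS (measurable_log_mod z).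
have h : \int[rho]_(x in e) (L - log_mod (z.1 - x, z.2)) <= robin + L.
  rewrite -lee_fin fineK; last first.
    by apply: integrable_fin_num => //; have := integrableB me ci li.
  apply: le_trans kL; apply: ge0_le_integral => //.
  exact: measurable_funTS (measurable_log_kernel_r L z.1).
move: h; rewrite (RintegralB me ci li) Rintegral_cst//.
rewrite [X in fine X]rho_e/= mulr1 -/(potential e rho z); lra.
Qed.

(** The kernel based at [a] is integrable and equals [+oo] at [a]. *)
Lemma equilibrium_atomless a : rho (e `&` [set a]) = 0%E.
Proof.
have [L [kL _ _]] := potential_kernel (a, 0).
have [N [mN N0 sub]] := integrable_ae me (log_kernel_integrable kL).
apply: (subset_measure0 _ mN _ N0) => [|x [ex /= xa]].
  by apply: measurableI => //; exact: measurable_set1.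
by apply: sub => /= /(_ ex); rewrite -xa log_kernel_diag.
Qed.

(** The modulus grows along vertical lines. The point [x = z.1] has to be removed before
    integrating: there [log_mod] is 0 instead of [-oo] on the axis, and the pointwise inequality may
    fail. It is a null set. *)
Lemma potential_fst_le z : potential e rho (z.1, 0) <= potential e rho z.
Proof.
pose D := e `\` (e `&` [set z.1]).
have mN : measurable (e `&` [set z.1] : set T).
  by apply: measurableI => //; exact: measurable_set1.
have mD : measurable (D : set T) by exact: measurableD.
have N0 := equilibrium_atomless z.1.
have E w : potential e rho w = \int[rho]_(x in D) log_mod (w.1 - x, w.2).
  by rewrite /potential /Rintegral (negligible_integral mN me (log_mod_integrable w) N0).
have int w : rho.-integrable D (EFin \o fun x : T => log_mod (w.1 - x, w.2)).
  by apply: (integrableS me mD _ (log_mod_integrable w)); exact: subDsetl.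
rewrite !E; apply: (le_Rintegral mD (int (z.1, 0)) (int z)).
move=> x [ex nx] /=.
have zx : z.1 != x by apply: contra_notN nx => /eqP ->.
have m0 : 0 < modulus (z.1 - x, 0 : R).
  by apply: lt_le_trans (modulus_ge_fst _) => /=; rewrite normr_gt0 subr_eq0.
have le : modulus (z.1 - x, 0 : R) <= modulus (z.1 - x, z.2).
  by rewrite /modulus ler_wsqrtr//= lerD2l expr0n/= sqr_ge0.
by rewrite !log_modE ler_ln ?posrE// (lt_le_trans m0).
Qed.

Lemma potential_conj z : potential e rho (z.1, - z.2) = potential e rho z.
Proof. by apply: eq_Rintegral => x _; rewrite /log_mod/= sqrrN. Qed.

Lemma potential_le_ln z (B : R) : (forall x, e x -> `|x| <= B) -> 0 <= B ->
  B < modulus z -> potential e rho z <= ln (modulus z + B).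
Proof.
move=> eB B0 Bz.
have ci : rho.-integrable e (EFin \o (fun=> ln (modulus z + B))).
  by have := finite_measure_integrable_cst rho (ln (modulus z + B)) me.
have : \int[rho]_(x in e) (ln (modulus z + B)) = ln (modulus z + B).
  by rewrite Rintegral_cst// [X in fine X]rho_e mulr1.
move=> <-; apply: le_Rintegral => //; first exact: log_mod_integrable.
move=> x ex; rewrite log_modE.
have xB := eB _ ex; have mx := modulus_sub_ge z x.
have m0 : 0 < modulus (z.1 - x, z.2) by lra.
rewrite ler_ln ?posrE//; last by lra.
by rewrite (le_trans (modulus_sub _ _))// lerD2l.
Qed.

(** The bound on the five-point difference of the logarithm depends on the distance to the pole
    only, so it holds uniformly over the set and survives the average. *)
Lemma potential_flat z (d : R) : 0 < d ->
  (forall x, e x -> d ^+ 2 <= (z.1 - x) ^+ 2 + z.2 ^+ 2) ->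
  flat_at (potential e rho) z.
Proof.
move=> d0 ed.
have five r : rho.-integrable e
      (EFin \o fun x : T => five_point (fun y => log_mod (y.1 - x, y.2)) z r) /\
    five_point (potential e rho) z r =
    \int[rho]_(x in e) five_point (fun y => log_mod (y.1 - x, y.2)) z r.
  have int w : rho.-integrable e (EFin \o fun x : T => log_mod (w.1 - x, w.2)).
    exact: log_mod_integrable.
  have intD (f g : T -> R) : rho.-integrable e (EFin \o f) ->
    rho.-integrable e (EFin \o g) -> rho.-integrable e (EFin \o (fun x => f x + g x)).
    by move=> hf hg; have := integrableD me hf hg.
  have i1 := int (z.1 + r, z.2); have i2 := int (z.1 - r, z.2).
  have i3 := int (z.1, z.2 + r); have i4 := int (z.1, z.2 - r).
  have i12 := intD _ _ i1 i2; have i123 := intD _ _ i12 i3.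
  have i1234 := intD _ _ i123 i4.
  have i5 : rho.-integrable e (EFin \o fun x : T => 4 * log_mod (z.1 - x, z.2)).
    by have := integrableZl me 4 (int z).
  split; first by have := integrableB me i1234 i5.
  rewrite /five_point /potential.
  rewrite (RintegralB me i1234 i5) (RintegralZl 4 me (int z)).
  by rewrite (RintegralD me i123 i4) (RintegralD me i12 i3) (RintegralD me i1 i2).
move=> eps e0.
near=> r.
have r0 : 0 < r by near: r; exact: nbhs_right_gt.
have rd : r <= d / 2.
  by near: r; apply: nbhs_right_le; rewrite divr_gt0.
have r1 : r <= 1 by near: r; apply: nbhs_right_le.
have re : r <= eps * d ^+ 4 / 3.
  by near: r; apply: nbhs_right_le; rewrite divr_gt0// mulr_gt0// exprn_gt0.
have [fi ->] := five r.
have d40 : 0 < d ^+ 4 by rewrite exprn_gt0.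
pose c := 3 * r ^+ 4 / d ^+ 4.
have ci : rho.-integrable e (EFin \o (fun=> c)).
  by have := finite_measure_integrable_cst rho c me.
apply: (@le_trans _ _ c); last first.
  rewrite /c ler_pdivrMr//.
  have -> : 3 * r ^+ 4 = 3 * r ^+ 2 * r ^+ 2 by ring.
  have -> : eps * r ^+ 2 * d ^+ 4 = eps * d ^+ 4 * r ^+ 2 by ring.
  apply: ler_wpM2r; first exact: sqr_ge0.
  have : r ^+ 2 <= r by rewrite expr2 -[leRHS]mulr1 ler_wpM2l// ltW.
  by move: re; rewrite ler_pdivlMr//; lra.
rewrite (le_trans (le_normr_Rintegral me fi))//.
have <- : \int[rho]_(x in e) c = c by rewrite Rintegral_cst// [X in fine X]rho_e mulr1.
apply: le_Rintegral => //; first by have := integrable_norm fi.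
move=> x ex.
have := @five_point_log_mod _ (x, 0) z d r d0; rewrite /five_point/= !subr0; apply.
  exact: ed.
by rewrite rd ltW.
Unshelve. all: by end_near. Qed.

Lemma potential_continuous z (d : R) : 0 < d ->
  (forall x, e x -> d ^+ 2 <= (z.1 - x) ^+ 2 + z.2 ^+ 2) ->
  {for z, continuous (potential e rho)}.
Proof.
move=> d0 ed; have [B B1 eB] := compact_norm_bound ce.
pose C := 2 * (`|z.1| + B + `|z.2| + 1).
have n1 := normr_ge0 z.1; have n2 := normr_ge0 z.2.
have C0 : 0 < C by rewrite /C; lra.
have d20 : 0 < d ^+ 2 by rewrite exprn_gt0.
have dd0 : 0 < d / 2 by rewrite divr_gt0.
apply/cvgrPdist_le => eps e0.
pose eta := Num.min 1 (Num.min (3 * d ^+ 2 / 4 / C) (eps * (d / 2) ^+ 2 / C)).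
have eta0 : 0 < eta.
  by rewrite !lt_min ltr01 !divr_gt0// mulr_gt0// exprn_gt0.
have near_y : \forall y \near z, ball z eta y by exact: nbhsx_ballx.
apply: filterS near_y => y [+ +]; rewrite /ball/= => /ltW y1 /ltW y2.
have eta1 : eta <= 1 by rewrite ge_min lexx.
have etaC1 : eta * C <= 3 * d ^+ 2 / 4.
  by rewrite -ler_pdivlMr// !ge_min lexx orbT.
have etaC2 : eta * C <= eps * (d / 2) ^+ 2.
  by rewrite -ler_pdivlMr// !ge_min lexx !orbT.
have ds x : e x -> `|(z.1 - x) ^+ 2 + z.2 ^+ 2 - ((y.1 - x) ^+ 2 + y.2 ^+ 2)| <= eta * C.
  move=> ex; have xB := eB _ ex.
  have -> : (z.1 - x) ^+ 2 + z.2 ^+ 2 - ((y.1 - x) ^+ 2 + y.2 ^+ 2) =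
    (z.1 - y.1) * (2 * (z.1 - x) - (z.1 - y.1)) +
    (z.2 - y.2) * (2 * z.2 - (z.2 - y.2)) by ring.
  rewrite (le_trans (ler_normD _ _))// !normrM.
  have a1 : `|2 * (z.1 - x) - (z.1 - y.1)| <= 2 * (`|z.1| + B) + 1.
    rewrite (le_trans (ler_normB _ _))// lerD//; last lra.
    by rewrite normrM ger0_norm// ler_wpM2l// (le_trans (ler_normB _ _))// lerD2l.
  have a2 : `|2 * z.2 - (z.2 - y.2)| <= 2 * `|z.2| + 1.
    rewrite (le_trans (ler_normB _ _))// lerD//; last lra.
    by rewrite normrM ger0_norm.
  have b1 := ler_pM (normr_ge0 _) (normr_ge0 _) y1 a1.
  have b2 := ler_pM (normr_ge0 _) (normr_ge0 _) y2 a2.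
  by apply: (le_trans (lerD b1 b2)); rewrite -mulrDr ler_wpM2l ?(ltW eta0)// /C; lra.
have iz := log_mod_integrable z; have iy := log_mod_integrable y.
rewrite /potential -RintegralB//.
have iB : rho.-integrable e
    (EFin \o fun x : T => log_mod (z.1 - x, z.2) - log_mod (y.1 - x, y.2)).
  by have := integrableB me iz iy.
rewrite (le_trans (le_normr_Rintegral me iB))//.
have <- : \int[rho]_(x in e) eps = eps by rewrite Rintegral_cst// [X in fine X]rho_e mulr1.
apply: le_Rintegral => //; first by have := integrable_norm iB.
  by have := finite_measure_integrable_cst rho eps me.
move=> x ex; have dsx := ds _ ex; have edx := ed _ ex.
have dd : (d / 2) ^+ 2 = d ^+ 2 / 4 by field.
apply: (le_trans (@log_mod_lipschitz _ _ _ (d / 2) dd0 _ _)) => /=.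
- by rewrite dd; lra.
- by move: dsx; rewrite ler_norml dd => /andP[? ?]; lra.
- by rewrite ler_pdivrMr ?exprn_gt0//; exact: le_trans etaC2.
Qed.

End LogPotential.

(** * From Leja points to measures of small energy *)

Section TruncatedKernel.
Context {R : realType}.
Implicit Types (x y d : R).

(** Truncation at scale [d] makes the kernel finite on the diagonal and Lipschitz with constant
    [1 / d], so it can be summed over all pairs of points and followed through limits. *)
Definition cut_kernel d x y : R := - ln (Num.max `|x - y| d).

Lemma cut_kernelC d x y : cut_kernel d x y = cut_kernel d y x.
Proof. by rewrite /cut_kernel distrC. Qed.

Lemma cut_kernel_diag d x : 0 < d -> cut_kernel d x x = - ln d.
Proof. by move=> d0; rewrite /cut_kernel subrr normr0 max_r// ltW. Qed.

Lemma cut_kernel_le d x y : x != y -> cut_kernel d x y <= - ln `|x - y|.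
Proof.
move=> xy; have n0 : 0 < `|x - y| by rewrite normr_gt0 subr_eq0.
by rewrite lerN2 ler_ln ?posrE ?lt_max ?n0// le_max lexx.
Qed.

Lemma ln_lipschitz d x y : 0 < d -> d <= x -> d <= y ->
  `|ln x - ln y| <= `|x - y| / d.
Proof.
wlog xy : x y / y <= x.
  move=> H d0 dx dy; have [yx|/ltW xy] := leP y x; first exact: H.
  by rewrite distrC (distrC x); exact: H.
move=> d0 dx dy; have x0 := lt_le_trans d0 dx; have y0 := lt_le_trans d0 dy.
rewrite !ger0_norm ?subr_ge0// ?ler_ln ?posrE//.
rewrite -ln_div ?posrE// (le_trans (ln_le_subr1 _)) ?divr_gt0//.
have -> : x / y - 1 = (x - y) / y by field; rewrite gt_eqF.
by rewrite ler_wpM2l ?subr_ge0// lef_pV2 ?posrE.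
Qed.

Lemma max_lipschitz d x y : `|Num.max x d - Num.max y d| <= `|x - y|.
Proof.
wlog xy : x y / y <= x.
  move=> H; have [yx|/ltW xy] := leP y x; first exact: H.
  by rewrite distrC (distrC x); exact: H.
rewrite (ger0_norm (x := x - y)) ?subr_ge0//.
by case: (leP x d) => h1; case: (leP y d) => h2; rewrite ger0_norm; lra.
Qed.

Lemma cut_kernel_lipschitz d x y x' y' : 0 < d ->
  `|cut_kernel d x y - cut_kernel d x' y'| <= (`|x - x'| + `|y - y'|) / d.
Proof.
move=> d0; rewrite /cut_kernel -opprD normrN.
rewrite (le_trans (ln_lipschitz d0 _ _)) ?le_max ?lexx ?orbT//.
rewrite ler_pM2r ?invr_gt0// (le_trans (max_lipschitz _ _ _))//.
rewrite (le_trans (ler_dist_dist _ _))//.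
have -> : x - y - (x' - y') = (x - x') - (y - y') by ring.
exact: ler_normB.
Qed.

Lemma ln_prod (I : Type) (s : seq I) (P : pred I) (F : I -> R) :
  (forall i, P i -> 0 < F i) ->
  ln (\prod_(i <- s | P i) F i) = \sum_(i <- s | P i) ln (F i).
Proof.
move=> F0; suff [] : 0 < \prod_(i <- s | P i) F i /\
    ln (\prod_(i <- s | P i) F i) = \sum_(i <- s | P i) ln (F i) by [].
elim/big_rec2 : _ => [|i y1 y2 /F0 Fi [y20 IH]]; first by rewrite ln1.
by rewrite mulr_gt0// lnM ?posrE// IH.
Qed.

Lemma leja_sequence (e : set R) (gam : R) :
  (forall s : seq R, (forall x, x \in s -> e x) -> exists y, e y /\
     expR (- gam * (size s)%:R) <= \prod_(x <- s) `|y - x|) ->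
  exists a : nat -> R, (forall n, e (a n)) /\
    forall n, expR (- gam * n%:R) <= \prod_(i < n) `|a n - a i|.
Proof.
move=> H.
have /choice[f hf] : forall s : seq R, exists y, (forall x, x \in s -> e x) ->
    e y /\ expR (- gam * (size s)%:R) <= \prod_(x <- s) `|y - x|.
  move=> s; have [/H[y hy]|n] := pselect (forall x, x \in s -> e x).
    by exists y.
  by exists 0 => /n.
pose L := fix L n := if n is m.+1 then rcons (L m) (f (L m)) else [::].
pose a n := f (L n).
have LE n : L n = [seq a i | i <- iota 0 n].
  elim: n => [//|n IH]; rewrite -[in RHS]addn1 iotaD map_cat/= -IH add0n.
  by rewrite cats1.
have Le n x : x \in L n -> e x.
  elim: n x => [//|n IH] x /=; rewrite mem_rcons inE => /predU1P[->|/IH//].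
  by have [] := hf _ IH.
exists a; split=> n; first by have [] := hf _ (Le n).
have [_] := hf _ (Le n); rewrite -/(a n) LE size_map size_iota big_map.
by rewrite -[X in iota 0 X]subn0 big_mkord.
Qed.

(** Each pair is counted in the row of its later point, where the product bound applies, and then
    doubled by symmetry; the diagonal adds [- ln d] per point. *)
Lemma leja_energy (a : nat -> R) (gam d : R) (n : nat) : 0 < d ->
  (forall n, expR (- gam * n%:R) <= \prod_(i < n) `|a n - a i|) ->
  \sum_(i < n) \sum_(j < n) cut_kernel d (a i) (a j) <=
    gam * n%:R ^+ 2 + n%:R * (`|gam| + `|ln d|).
Proof.
move=> d0 H.
have row m : \sum_(i < m) cut_kernel d (a m) (a i) <= gam * m%:R.
  have pos : 0 < \prod_(i < m) `|a m - a i| by apply: lt_le_trans (H m); exact: expR_gt0.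
  have ne (i : 'I_m) : a m != a i.
    apply: contraTneq pos => E; rewrite (bigD1 i)//= E subrr normr0 mul0r ltxx//.
  apply: (@le_trans _ _ (\sum_(i < m) - ln `|a m - a i|)).
    by apply: ler_sum => i _; exact: cut_kernel_le.
  rewrite sumrN lerNl -mulNr -(expRK (- gam * m%:R)).
  rewrite -ln_prod; last by move=> i _; rewrite normr_gt0 subr_eq0.
  by rewrite ler_ln ?posrE ?expR_gt0.
suff : \sum_(i < n) \sum_(j < n) cut_kernel d (a i) (a j) <=
    gam * (n%:R ^+ 2 - n%:R) + n%:R * - ln d.
  move/le_trans; apply; have := ler_norm (- ln d); have := ler_norm (- gam).
  rewrite !normrN => h1 h2; rewrite mulrBr -addrA lerD2l -mulNr -mulrC -mulrDr.
  by rewrite ler_wpM2l// lerD.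
elim: n => [|n IH]; first by rewrite !big_ord0 expr0n/= subrr mulr0 mul0r addr0.
rewrite big_ord_recr/=.
under eq_bigr do rewrite big_ord_recr/=.
rewrite big_split/= big_ord_recr/= cut_kernel_diag//.
under [X in _ + X + _ <= _]eq_bigr do rewrite cut_kernelC.
have := row n; rewrite -natr1; move: IH.
set S := \sum_(i < n) \sum_(j < n) _; set r := \sum_(i < n) _.
by move=> h1 h2; nra.
Qed.

Lemma sum_blocks (F : nat -> R) (p M : nat) :
  \sum_(k < p * M) F k = \sum_(i < p) \sum_(r < M) F (i * M + r)%N.
Proof.
elim: p => [|p IH]; first by rewrite mul0n !big_ord0.
by rewrite big_ord_recr/= -IH mulSnr big_split_ord.
Qed.

(** Each block of [M] consecutive points is represented by its first one. Monotonicity makes the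
    displacements telescope, so that they add up to at most [2 B M]; the Lipschitz bound turns this
    into the error term. *)
Lemma sampled_energy (b : nat -> R) (B d : R) (p M : nat) : 0 < d ->
  {homo b : k l / (k <= l)%N >-> k <= l} -> (forall k, `|b k| <= B) ->
  M%:R ^+ 2 * \sum_(i < p) \sum_(j < p) cut_kernel d (b (i * M)%N) (b (j * M)%N) <=
  \sum_(k < p * M) \sum_(l < p * M) cut_kernel d (b k) (b l) +
    4 * B * p%:R * M%:R ^+ 2 / d.
Proof.
move=> d0 bnd bB.
have M0 : 0 <= M%:R :> R by [].
have cst m (x : R) : \sum_(r < m) x = m%:R * x.
  by rewrite sumr_const card_ord mulr_natl.
have step : \sum_(i < p) (b (i.+1 * M)%N - b (i * M)%N) <= 2 * B.
  have -> : \sum_(i < p) (b (i.+1 * M)%N - b (i * M)%N) = b (p * M)%N - b 0%N.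
    elim: p => [|p IH]; first by rewrite big_ord0 mul0n subrr.
    by rewrite big_ord_recr/= IH; ring.
  have := bB (p * M)%N; have := bB 0%N; rewrite !ler_norml => /andP[? ?] /andP[? ?]; lra.
pose er := \sum_(i < p) \sum_(r < M) (b (i * M + r)%N - b (i * M)%N).
have erB : er <= M%:R * (2 * B).
  apply: (@le_trans _ _ (\sum_(i < p) M%:R * (b (i.+1 * M)%N - b (i * M)%N))).
    apply: ler_sum => i _; rewrite mulr_natl -[X in _ *+ X]card_ord -sumr_const.
    apply: ler_sum => r _; rewrite lerD2r bnd// mulSnr leq_add2l ltnW//.
  by rewrite -mulr_sumr ler_wpM2l.
have low : M%:R ^+ 2 * \sum_(i < p) \sum_(j < p) cut_kernel d (b (i * M)%N) (b (j * M)%N)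
   - \sum_(k < p * M) \sum_(l < p * M) cut_kernel d (b k) (b l) <=
   2 * (p%:R * M%:R * er) / d.
  pose G i j r t := (b (i * M + r)%N - b (i * M)%N + (b (j * M + t)%N - b (j * M)%N)) / d.
  apply: (@le_trans _ _ (\sum_(i < p) \sum_(r < M) \sum_(j < p) \sum_(t < M) G i j r t)).
    rewrite (sum_blocks (fun k => \sum_(l < p * M) cut_kernel d (b k) (b l))).
    have -> : M%:R ^+ 2 * \sum_(i < p) \sum_(j < p) cut_kernel d (b (i * M)%N) (b (j * M)%N) =
       \sum_(i < p) \sum_(r < M) \sum_(j < p) \sum_(t < M) cut_kernel d (b (i * M)%N) (b (j * M)%N).
      rewrite expr2 -mulrA mulr_sumr mulr_sumr; apply: eq_bigr => i _.
      rewrite cst; congr (_ * _).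
      by rewrite mulr_sumr; apply: eq_bigr => j _; rewrite cst.
    rewrite -sumrB; apply: ler_sum => i _; rewrite -sumrB; apply: ler_sum => r _.
    rewrite (sum_blocks (fun l => cut_kernel d (b (i * M + r)%N) (b l))).
    rewrite -sumrB; apply: ler_sum => j _; rewrite -sumrB; apply: ler_sum => t _.
    rewrite (le_trans (ler_norm _))// (le_trans (cut_kernel_lipschitz _ _ _ _ d0))//.
    rewrite /G ler_pM2r ?invr_gt0//.
    by rewrite !ler0_norm ?opprB// subr_le0 bnd// leq_addr.
  have -> : \sum_(i < p) \sum_(r < M) \sum_(j < p) \sum_(t < M) G i j r t =
     2 * (p%:R * M%:R * er) / d.
    pose f i r := b (i * M + r)%N - b (i * M)%N.
    transitivity (\sum_(i < p) \sum_(r < M) (p%:R * M%:R * f i r + er) / d).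
      apply: eq_bigr => i _; apply: eq_bigr => r _.
      transitivity (\sum_(j < p) (M%:R * f i r + \sum_(t < M) f j t) / d).
        apply: eq_bigr => j _; rewrite -mulr_suml; congr (_ / _).
        by rewrite big_split/= cst.
      by rewrite -mulr_suml big_split/= cst mulrA.
    transitivity (\sum_(i < p) (p%:R * M%:R * \sum_(r < M) f i r + M%:R * er) / d).
      apply: eq_bigr => i _; rewrite -mulr_suml; congr (_ / _).
      by rewrite big_split/= cst -mulr_sumr.
    rewrite -mulr_suml; congr (_ / _); rewrite big_split/= cst -mulr_sumr.
    by rewrite -/er; ring.
  by [].
rewrite -lerBlDl; apply: (le_trans low); rewrite ler_pM2r ?invr_gt0//.
have -> : 4 * B * p%:R * M%:R ^+ 2 = 2 * (p%:R * M%:R * (M%:R * (2 * B))) by ring.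
by rewrite ler_wpM2l// ler_wpM2l// mulr_ge0.
Qed.

Lemma sorted_stage (e : set R) (a : nat -> R) (B gam : R) (n : nat) :
  (forall k, e (a k)) -> (forall x, e x -> `|x| <= B) ->
  (forall n, expR (- gam * n%:R) <= \prod_(i < n) `|a n - a i|) ->
  exists b : nat -> R, [/\ forall k, (k < n)%N -> e (b k),
    {homo b : k l / (k <= l)%N >-> k <= l}, forall k, `|b k| <= B &
    forall d, 0 < d -> \sum_(k < n) \sum_(l < n) cut_kernel d (b k) (b l) <=
      gam * n%:R ^+ 2 + n%:R * (`|gam| + `|ln d|)].
Proof.
move=> ea eB lej; pose s := sort <=%R (mkseq a n).
have ss : size s = n by rewrite size_sort size_mkseq.
have es x : x \in s -> e x by rewrite mem_sort => /mapP[k _ ->].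
have B0 : 0 <= B by apply: le_trans (eB _ (ea 0%N)).
have sorteds : sorted <=%R s by apply: sort_sorted; exact: le_total.
(* The default value [B] keeps the sequence nondecreasing and bounded beyond the sorted list. *)
exists (fun k => nth B s k); split.
- by move=> k kn; apply/es/mem_nth; rewrite ss.
- move=> k l kl; have [ln|nl] := ltnP l n.
    by apply: (sorted_leq_nth le_trans lexx) => //; rewrite inE ss// (leq_ltn_trans kl).
  rewrite [leRHS]nth_default ?ss//; have [kn|nk] := ltnP k n.
    by rewrite (le_trans (ler_norm _))// eB//; apply/es/mem_nth; rewrite ss.
  by rewrite nth_default ?ss.
- move=> k; have [kn|nk] := ltnP k n.
    by apply/eB/es/mem_nth; rewrite ss.
  by rewrite nth_default ?ss// ger0_norm.
move=> d d0; apply: le_trans (leja_energy n d0 lej).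
have E (F : R -> R) : \sum_(k < n) F (nth B s k) = \sum_(k < n) F (a k).
  rewrite -[in LHS]ss -(big_mkord xpredT (fun k => F (nth B s k))) -(big_nth B xpredT F).
  rewrite (perm_big _ (permEl (perm_sort _ _))) big_map.
  by rewrite -[X in iota 0 X]subn0 big_mkord.
rewrite (E (fun x => \sum_(l < n) cut_kernel d x (nth B s l))).
by apply/le_of_eq/eq_bigr => k _; rewrite E.
Qed.

End TruncatedKernel.

(** * A limit of sorted Leja points along an ultrafilter *)

Section DyadicLimit.
Context {R : realType}.

Lemma fmap_ultrafilter (S T : Type) (f : S -> T) (U : set_system S) :
  UltraFilter U -> UltraFilter (f @ U).
Proof.
move=> UU; split; first exact: fmap_proper_filter.
move=> G GG UG; rewrite predeqE => A; split; last exact: UG.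
move=> GA; have [//|UC] := in_ultra_setVsetC (f @^-1` A) UU.
have : G (A `&` ~` A) by apply: filterI => //; apply: UG.
by rewrite setICr => /filter_not_empty.
Qed.

(** Stage [N] sorts [2 ^ N] Leja points, and [r m i N] is the first point of the block of index [i]
    among [2 ^ m] equal blocks. The same ultrafilter is used for all [m] and [i], so relations
    between different levels persist in the limit. *)
Lemma dyadic_limit (e : set R) (B gam : R) (a : nat -> R) : compact e ->
  (forall k, e (a k)) -> (forall x, e x -> `|x| <= B) ->
  (forall n, expR (- gam * n%:R) <= \prod_(i < n) `|a n - a i|) ->
  exists q : nat -> nat -> R, [/\
    forall m i, (i < 2 ^ m)%N -> e (q m i),
    forall m i, (i < 2 ^ m)%N -> q m.+1 i.*2 = q m i,
    forall m i, (i < 2 ^ m)%N -> q m.+1 i.*2 <= q m.+1 i.*2.+1 &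
    forall m d, 0 < d ->
      \sum_(i < 2 ^ m) \sum_(j < 2 ^ m) cut_kernel d (q m i) (q m j) <=
      gam * (2 ^ m)%:R ^+ 2 + 4 * B * (2 ^ m)%:R / d].
Proof.
move=> ce ea eB lej.
have [U [UU oU]] := @ultraFilterLemma nat \oo _.
have PU : ProperFilter U := @ultra_proper _ _ UU.
have /choice[b hb] := fun N => sorted_stage (2 ^ N) ea eB lej.
pose r m i N := b N (i * 2 ^ (N - m))%N.
have rle m i N : (i < 2 ^ m)%N -> (m <= N)%N -> (i * 2 ^ (N - m) < 2 ^ N)%N.
  by move=> im mN; rewrite -{2}(subnKC mN) expnD ltn_pmul2r// expn_gt0.
have re m i N : (i < 2 ^ m)%N -> (m <= N)%N -> e (r m i N).
  by move=> im mN; case: (hb N) => h _ _ _; apply: h; exact: rle.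
have nearU m : \forall N \near U, (m <= N)%N.
  by apply: oU; exact: nbhs_infty_ge.
have /choice[q hq] : forall mi : nat * nat, exists x, (mi.2 < 2 ^ mi.1)%N ->
    e x /\ r mi.1 mi.2 @ U --> x.
  case=> m i /=; have [im|_] := ltnP i (2 ^ m); last by exists 0.
  move: ce; rewrite compact_ultra => /(_ (r m i @ U) (fmap_ultrafilter _ UU)) [].
    by apply: filterS (nearU m) => N; exact: re.
  by move=> x [ex rx]; exists x.
exists (fun m i => q (m, i)); split.
- by move=> m i im; case: (hq (m, i) im).
- move=> m i im.
  have im2 : (i.*2 < 2 ^ m.+1)%N by rewrite expnS mul2n ltn_double.
  have [_ /= c1] := hq (m, i) im; have [_ /= c2] := hq (m.+1, i.*2) im2.
  have E : {near U, r m i =1 r m.+1 i.*2}.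
    apply: (filterS _ (nearU m.+1)) => N mN; rewrite /r; congr (b N _).
    by rewrite -muln2 -mulnA -expnS subnSK.
  have c1' : r m.+1 i.*2 @ U --> q (m, i).
    by apply: cvg_trans c1; exact: near_eq_cvg.
  exact: (cvg_unique _ c2 c1').
- move=> m i im.
  have im2 : (i.*2 < 2 ^ m.+1)%N by rewrite expnS mul2n ltn_double.
  have im3 : (i.*2.+1 < 2 ^ m.+1)%N by rewrite expnS mul2n ltn_Sdouble.
  have [_ /= c1] := hq (m.+1, i.*2) im2; have [_ /= c2] := hq (m.+1, i.*2.+1) im3.
  apply: (ler_cvg_to c1 c2); apply: filterE => N.
  by case: (hb N) => _ h _ _; apply: h; rewrite leq_mul2r leqnSn orbT.
- move=> m d d0.
  have cq (i : 'I_(2 ^ m)) : r m i @ U --> q (m, val i) by case: (hq (m, val i) (ltn_ord i)).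
  have cc (i j : 'I_(2 ^ m)) : cut_kernel d (r m i N) (r m j N) @[N --> U] -->
      cut_kernel d (q (m, val i)) (q (m, val j)).
    apply/cvgrPdist_le => eps e0.
    have ed : 0 < eps * d / 2 by rewrite divr_gt0// mulr_gt0.
    move: (cq i) (cq j) => /cvgrPdist_le/(_ _ ed) hi /cvgrPdist_le/(_ _ ed) hj.
    apply: (filterS _ (filterI hi hj)) => N [h1 h2].
    rewrite (le_trans (cut_kernel_lipschitz _ _ _ _ d0))// ler_pdivrMr//.
    by rewrite (le_trans (lerD h1 h2))// -splitr.
  have cs : \sum_(i < 2 ^ m) \sum_(j < 2 ^ m) cut_kernel d (r m i N) (r m j N) @[N --> U] -->
     \sum_(i < 2 ^ m) \sum_(j < 2 ^ m) cut_kernel d (q (m, val i)) (q (m, val j)).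
    apply: cvg_big => [|i _]; first exact: add_continuous.
    apply: cvg_big => [|j _]; [exact: add_continuous|exact: cc].
  pose c := `|gam| + `|ln d|.
  apply/ler_addgt0Pr => eps e0; apply: (cvgr_to_le cs).
  (* Once [2 ^ N] exceeds [K], the part of the Leja energy that is linear in the number of points
     contributes at most [eps] after division by [M ^ 2]. *)
  pose K := (2 ^ m)%:R * (2 ^ m)%:R * c / eps.
  have nK : \forall N \near U, K <= (2 ^ N)%:R.
    apply: oU; near=> N; apply: (@le_trans _ _ N%:R); last by rewrite ler_nat ltnW// ltn_expl.
    by near: N; exact: nbhs_infty_ger.
  apply: (filterS _ (filterI nK (nearU m))) => N [KN mN].
  have [_ bn bB /(_ _ d0)] := hb N.
  have := sampled_energy (2 ^ m) (2 ^ (N - m)) d0 bn bB.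
  rewrite -expnD subnKC//; set S := \sum_(i < 2 ^ m) _; set S' := \sum_(k < 2 ^ N) _.
  have EN : (2 ^ N)%:R = (2 ^ m)%:R * (2 ^ (N - m))%:R :> R.
    by rewrite -natrM -expnD subnKC.
  rewrite EN in KN *.
  have p0 : 0 < (2 ^ m)%:R :> R by rewrite ltr0n expn_gt0.
  have M0 : 0 < (2 ^ (N - m))%:R :> R by rewrite ltr0n expn_gt0.
  move: KN p0 M0; rewrite /K -/c; set p := (2 ^ m)%:R; set M := (2 ^ (N - m))%:R.
  move=> KN p0 M0 h1 h2.
  have M20 : 0 < M ^+ 2 by rewrite exprn_gt0.
  rewrite -(ler_pM2l M20) (le_trans h1)//.
  apply: (@le_trans _ _ (gam * (p * M) ^+ 2 + p * M * c + 4 * B * p * M ^+ 2 / d)).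
    by rewrite lerD2r.
  have h3 : p * c <= eps * M.
    move: KN; rewrite ler_pdivrMr// -!mulrA ler_pM2l//.
    by rewrite (mulrC M eps).
  have -> : M ^+ 2 * (gam * p ^+ 2 + 4 * B * p / d + eps) =
     gam * (p * M) ^+ 2 + eps * M * M + 4 * B * p * M ^+ 2 / d by ring.
  rewrite lerD2r lerD2l (_ : p * M * c = p * c * M); last by ring.
  by rewrite ler_wpM2r// ltW.
Unshelve. all: by end_near. Qed.

End DyadicLimit.

(** * Lebesgue measure on [0, 1) and dyadic step functions *)

Section UnitInterval.
Context {R : realType}.
Local Notation T := (measurableTypeR R).

Definition unit_interval : set T := `[0, 1[%classic.

Lemma measurable_unit_interval : measurable unit_interval.
Proof. exact: measurable_itv. Qed.

Definition unit_measure := mrestr (@lebesgue_measure R) measurable_unit_interval.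

HB.instance Definition _ := Measure.on unit_measure.

Let unit_measureT : unit_measure setT = 1%E.
Proof.
rewrite /unit_measure /mrestr setTI lebesgue_measure_itv/= lte_fin ltr01.
by rewrite oppr0 adde0.
Qed.

HB.instance Definition _ :=
  Measure_isProbability.Build _ _ _ unit_measure unit_measureT.

Lemma unit_measure_full : unit_measure unit_interval = 1%E.
Proof. by rewrite -unit_measureT /unit_measure /mrestr setTI setIid. Qed.

Definition dyadic (m i : nat) : set T :=
  `[i%:R / (2 ^ m)%:R, i.+1%:R / (2 ^ m)%:R[%classic.

Lemma measurable_dyadic m i : measurable (dyadic m i).
Proof. exact: measurable_itv. Qed.

Definition dyadic_step (m : nat) (f : nat -> R) (t : T) : R :=
  \sum_(i < 2 ^ m) f i * \1_(dyadic m i) t.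

Lemma measurable_dyadic_step m f : measurable_fun [set: T] (dyadic_step m f).
Proof.
apply: measurable_sum => i; apply: measurable_funM => //.
by apply: measurable_indic; exact: measurable_dyadic.
Qed.

Lemma dyadicP m i (t : T) : dyadic m i t <->
  i%:R <= (t : R) * (2 ^ m)%:R < i.+1%:R.
Proof.
have p0 : 0 < (2 ^ m)%:R :> R by rewrite ltr0n expn_gt0.
by rewrite /dyadic/= in_itv/= ler_pdivrMr// ltr_pdivlMr.
Qed.

Lemma dyadic_stepE m (t : T) : unit_interval t ->
  exists i : nat, [/\ (i < 2 ^ m)%N, dyadic m i t &
    forall f, dyadic_step m f t = f i].
Proof.
rewrite /unit_interval/= in_itv/= => /andP[t0 t1].
have p0 : 0 < (2 ^ m)%:R :> R by rewrite ltr0n expn_gt0.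
have tp0 : 0 <= (t : R) * (2 ^ m)%:R by rewrite mulr_ge0// ltW.
pose i := Num.truncn ((t : R) * (2 ^ m)%:R).
have ti : dyadic m i t by apply/dyadicP; exact: truncn_itv.
have im : (i < 2 ^ m)%N.
  by rewrite truncn_lt_nat// -[ltRHS]mul1r ltr_pM2r.
exists i; split => // f; rewrite /dyadic_step (bigD1 (Ordinal im))//= big1 ?addr0.
  by rewrite indicE mem_set// mulr1.
move=> j ji; rewrite indicE memNset ?mulr0// => /dyadicP/truncn_def E.
by move: ji; rewrite -val_eqE/= -E eqxx.
Qed.

Lemma dyadic_sub m i : (i < 2 ^ m)%N -> dyadic m i `<=` unit_interval.
Proof.
move=> im t /dyadicP/andP[h1 h2]; rewrite /unit_interval/= in_itv/=.
have p0 : 0 < (2 ^ m)%:R :> R by rewrite ltr0n expn_gt0.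
have : i.+1%:R <= (2 ^ m)%:R :> R by rewrite ler_nat.
move=> h3; apply/andP; split.
  by rewrite -(pmulr_lge0 _ p0) (le_trans _ h1).
by rewrite -(ltr_pM2r p0) mul1r (lt_le_trans h2).
Qed.

Lemma unit_measure_dyadic m i : (i < 2 ^ m)%N ->
  unit_measure (dyadic m i `&` unit_interval) = ((2 ^ m)%:R^-1)%:E.
Proof.
move=> im; rewrite /unit_measure /mrestr (setIidl (dyadic_sub im)).
rewrite (setIidl (dyadic_sub im)) lebesgue_measure_itv/= lte_fin.
have p0 : 0 < (2 ^ m)%:R :> R by rewrite ltr0n expn_gt0.
rewrite ltr_pM2r ?invr_gt0// ltr_nat ltnSn -EFinB -mulrBl.
by rewrite -natr1 addrC addKr mul1r.
Qed.

Lemma integral_dyadic_step m f : (forall i, (i < 2 ^ m)%N -> 0 <= f i) ->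
  (\int[unit_measure]_(t in unit_interval) (dyadic_step m f t)%:E =
   ((2 ^ m)%:R^-1 * \sum_(i < 2 ^ m) f i)%:E)%E.
Proof.
move=> f0; have mD := measurable_unit_interval.
rewrite /dyadic_step; under eq_integral do rewrite -sumEFin.
rewrite ge0_integral_sum//; last 2 first.
- move=> i; apply/measurable_EFinP; apply: measurable_funM => //.
  by apply: measurable_indic; exact: measurable_dyadic.
- by move=> i t _; rewrite lee_fin mulr_ge0// f0.
rewrite mulr_sumr -sumEFin; apply: eq_bigr => i _.
under eq_integral do rewrite EFinM.
rewrite ge0_integralZl_EFin ?f0//; last first.
  apply/measurable_EFinP; apply: measurable_indic; exact: measurable_dyadic.
rewrite integral_indic//; last exact: measurable_dyadic.
by rewrite [X in (_ * X)%E = _]unit_measure_dyadic// -EFinM mulrC.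
Qed.

End UnitInterval.

(** * A measure of small energy from Leja points *)

Section WeakLimit.
Context {R : realType}.
Local Notation T := (measurableTypeR R).

Lemma cvg_cut_kernel (L x y : R) (u v d : R^nat) : `|x - y| <= expR L ->
  u @ \oo --> x -> v @ \oo --> y -> d @ \oo --> 0 ->
  (\forall n \near \oo, 0 < d n) ->
  (L + cut_kernel (d n) (u n) (v n))%:E @[n --> \oo] --> log_kernel L (x, y).
Proof.
move=> xyL ux vy d0 d_gt0.
have w : Num.max `|u n - v n| (d n) @[n --> \oo] --> `|x - y|.
  have -> : `|x - y| = Num.max `|x - y| 0 by rewrite max_l.
  have c : `|u n - v n| @[n --> \oo] --> `|x - y| by apply: cvg_norm; exact: cvgB.
  apply/cvgrPdist_le => eps e0.
  move: c d0 => /cvgrPdist_le/(_ _ e0) c /cvgrPdist_le/(_ _ e0) d0.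
  apply: (filterS _ (filterI c d0)) => n [].
  rewrite !ler_norml => /andP[? ?] /andP[? ?].
  by case: (leP `|x - y| 0) => ?; case: (leP `|u n - v n| (d n)) => ?; apply/andP; split; lra.
have [xy|xy] := eqVneq x y.
  rewrite xy log_kernel_diag; apply/cvgeyPge => A.
  rewrite xy subrr normr0 in w.
  have : \forall n \near \oo, Num.max `|u n - v n| (d n) < expR (L - A).
    by apply: (cvgr_lt 0) => //; exact: expR_gt0.
  have := d_gt0; apply: filterS2 => n dn wn; rewrite lee_fin /cut_kernel.
  have w0 : 0 < Num.max `|u n - v n| (d n) by rewrite lt_max dn orbT.
  suff : ln (Num.max `|u n - v n| (d n)) <= L - A by lra.
  by rewrite -(expRK (L - A)) ler_ln ?posrE ?expR_gt0// ltW.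
have xy0 : 0 < `|x - y| by rewrite normr_gt0 subr_eq0.
rewrite log_kernel_pos// max_r; last first.
  by rewrite subr_ge0 -(expRK L) ler_ln ?posrE// expR_gt0.
apply: cvg_EFin; first exact: nearW.
apply: cvgD; first exact: cvg_cst.
by apply: cvgN; apply: continuous_cvg w; exact: continuous_ln.
Qed.

Lemma limn_einf_le (u : (\bar R)^nat) (c : R) :
  (forall eps : R, 0 < eps -> \forall n \near \oo, (u n <= (c + eps)%:E)%E) ->
  (limn_einf u <= c%:E)%E.
Proof.
move=> h; rewrite limn_einf_lim; apply: lime_le; first exact: is_cvg_einfs.
apply: nearW => n; apply/lee_addgt0Pr => eps e0; rewrite -EFinD.
have [N _ hN] := h _ e0.
apply: (@le_trans _ _ (u (maxn n N))); last by apply: hN; exact: leq_maxr.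
by apply: ereal_inf_lbound; exists (maxn n N) => //=; exact: leq_maxl.
Qed.

(* Sort the first [2 ^ m] Leja points and view them as a step function on
   [[0, 1[]; push Lebesgue measure forward by a limit of these functions. *)
Lemma energy_of_points (e : set R) (gam : R) : compact e -> e !=set0 ->
  (forall s : seq R, (forall x, x \in s -> e x) -> exists y, e y /\
     expR (- gam * (size s)%:R) <= \prod_(x <- s) `|y - x|) ->
  exists2 mu : probability T R, mu e = 1%E & (log_energy e mu <= gam%:E)%E.
Proof.
move=> ce [x0 ex0] H.
have [a [ea lej]] := leja_sequence H.
have [B B1 eB] := compact_norm_bound ce.
have [q [qe qq qle qen]] := dyadic_limit ce ea eB lej.
pose P : probability T R := @unit_measure R.
pose D : set T := @unit_interval R.
have mD : measurable D := @measurable_unit_interval R.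
have PD : P D = 1%E := @unit_measure_full R.
pose Qs (m : nat) (t : T) : R := dyadic_step m (q m) t.
(* Refining a dyadic interval keeps the value on its left half and can only raise it on its right
   half, so the step functions increase to a pointwise limit. *)
have Qnd t : D t -> nondecreasing_seq (Qs ^~ t).
  move=> Dt; apply/nondecreasing_seqP => m.
  have [i [im ti fi]] := dyadic_stepE m Dt.
  have [j [jm tj fj]] := dyadic_stepE m.+1 Dt.
  rewrite /Qs fi fj -qq//.
  have /dyadicP/andP[i1 i2] := ti; have /dyadicP/andP[j1 j2] := tj.
  have E : (2 ^ m.+1)%:R = 2 * (2 ^ m)%:R :> R by rewrite expnS natrM.
  have : (i.*2 <= j < i.*2.+2)%N.
    rewrite -!(ltr_nat R) -ltnS -(ltr_nat R); apply/andP; split.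
      rewrite (le_lt_trans _ j2)// E -mul2n natrM; nra.
    rewrite (le_lt_trans j1)// E -doubleS -mul2n natrM; nra.
  rewrite leq_eqVlt ltnS => /andP[/predU1P[->//|ij] ji].
  have -> : j = i.*2.+1 by apply/eqP; rewrite eqn_leq ji ij.
  exact: qle.
have Qe m t : D t -> e (Qs m t).
  by move=> Dt; have [i [im _ fi]] := dyadic_stepE m Dt; rewrite /Qs fi; exact: qe.
have Qout m t : ~ D t -> Qs m t = 0.
  move=> nDt; rewrite /Qs /dyadic_step big1// => i _.
  by rewrite indicE memNset ?mulr0// => /(dyadic_sub (ltn_ord i)).
pose X (t : T) : R := limn (Qs ^~ t).
have cX t : Qs ^~ t @ \oo --> X t.
  suff : cvgn (Qs ^~ t) by [].
  have [Dt|nDt] := pselect (D t).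
    apply: nondecreasing_is_cvgn; first exact: Qnd.
    by exists B => _ [m _ <-]; rewrite (le_trans (ler_norm _))// eB//; exact: Qe.
  rewrite (_ : Qs ^~ t = fun=> 0); first exact: is_cvg_cst.
  by apply/funext => m; exact: Qout.
have mQ m : measurable_fun [set: T] (Qs m) by exact: measurable_dyadic_step.
have mX : measurable_fun [set: T] X.
  by apply: (@measurable_fun_cvg _ _ _ _ Qs) => // t _; exact: cX.
have Xe t : D t -> e (X t).
  move=> Dt; apply: (closed_cvg e _ _ _ (cX t)).
    by apply: compact_closed => //; exact: Rhausdorff.
  by apply: nearW => m; exact: Qe.
have mX' : measurable_fun [set: T] (X : T -> T) by exact: mX.
have mX2 := mX'.
have me : measurable (e : set T) by exact: compact_measurable.
have mXe : measurable (X @^-1` e : set T) by rewrite -[_ @^-1` _]setTI; exact: mX.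
pose X' : {mfun T >-> T} := HB.pack (X : T -> T) (isMeasurableFun.Build _ _ T T X mX').
pose mu : probability T R := distribution P X'.
have mue : mu e = 1%E.
  apply/eqP; rewrite eq_le probability_le1//=.
  by rewrite -PD; apply: le_measure; rewrite ?inE.
exists mu => //.
pose L := 2 * B.
have BL : 2 * B <= expR L by rewrite (le_trans _ (expR_ge1Dx _))// lerDr.
have B0 : 0 <= B by lra.
rewrite (log_energyE me mue eB BL) leeBlDr//.
have fullP (f : T -> \bar R) : measurable_fun [set: T] f ->
    (forall x, (0 <= f x)%E) -> (\int[P]_x f x = \int[P]_(x in D) f x)%E.
  by move=> mf f0; rewrite (ge0_integral_full mD PD).
have push (f : T -> \bar R) : measurable_fun [set: T] f ->
    (forall x, (0 <= f x)%E) -> (\int[mu]_x f x = \int[P]_(x in D) f (X x))%E.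
  move=> mf f0; rewrite -fullP//; last exact: measurableT_comp.
  by rewrite [LHS](ge0_integral_pushforward mX').
rewrite push; last 2 first.
- exact: measurable_log_pot.
- by move=> x; exact: log_pot_ge0.
have potE x : log_pot L mu x = (\int[P]_(t in D) log_kernel L (x, X t))%E.
  rewrite /log_pot push//; first exact: measurable_log_kernel_r.
  by move=> y; exact: log_kernel_ge0.
have mLP : measurable_fun [set: T] (fun s : T => log_pot L mu (X s)).
  by apply: (measurableT_comp _ mX2); exact: measurable_log_pot.
clearbody mu; clear X'.
under eq_integral do rewrite potE.
(* Level [2 m] is paired with the truncation [2 ^ - m]: the error [4 B 2 ^ (2 m) / d] of
   [dyadic_limit], divided by the number [2 ^ (4 m)] of pairs, becomes [4 B 2 ^ - m] and tends to
   0. *)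
pose dd (m : nat) : R := ((2 ^ m)%:R)^-1.
have dd0 m : 0 < dd m by rewrite invr_gt0 ltr0n expn_gt0.
have dd1 m : dd m <= 1 by rewrite invf_le1 ?ltr0n ?expn_gt0// ler1n expn_gt0.
have eL x y : e x -> e y -> `|x - y| <= expR L.
  move=> ex ey; rewrite (le_trans _ BL)// (le_trans (ler_normB _ _))//.
  by have := eB _ ex; have := eB _ ey; lra.
have K0 m x y : e x -> e y -> 0 <= L + cut_kernel (dd m) x y.
  move=> ex ey; rewrite /cut_kernel subr_ge0.
  have w0 : 0 < Num.max `|x - y| (dd m) by rewrite lt_max dd0 orbT.
  rewrite -[leRHS](expRK L) ler_ln ?posrE ?expR_gt0// ge_max eL//=.
  by rewrite (le_trans (dd1 m))// (le_trans _ BL)//; lra.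
have mcut m x : measurable_fun [set: T] (fun t : T => L + cut_kernel (dd m) x (Qs m.*2 t)).
  have m1 : measurable_fun [set: T] (fun t : T => x - Qs m.*2 t).
    by apply: measurable_funB => //; exact: mQ.
  have m2 : measurable_fun [set: T] (fun t : T => Num.max `|x - Qs m.*2 t| (dd m)).
    by apply: measurable_maxr => //; apply: measurableT_comp m1.
  rewrite /cut_kernel; apply: measurable_funB => //.
  exact: (measurableT_comp (@measurable_ln R) m2).
pose g m x : R := (2 ^ m.*2)%:R^-1 * \sum_(j < 2 ^ m.*2) (L + cut_kernel (dd m) x (q m.*2 j)).
have innerE m x : e x -> (\int[P]_(t in D) (L + cut_kernel (dd m) x (Qs m.*2 t))%:E = (g m x)%:E)%E.
  move=> ex; rewrite /g -(@integral_dyadic_step _ _ (fun j => L + cut_kernel (dd m) x (q m.*2 j))).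
    apply: eq_integral => t; rewrite inE => Dt.
    have [i [_ _ fi]] := dyadic_stepE m.*2 Dt.
    by rewrite fi /Qs fi.
  by move=> j jm; apply: K0 => //; exact: qe.
have outerE m : (\int[P]_(s in D) (g m (Qs m.*2 s))%:E =
   ((2 ^ m.*2)%:R^-1 * \sum_(i < 2 ^ m.*2) g m (q m.*2 i))%:E)%E.
  rewrite -(@integral_dyadic_step _ _ (fun i => g m (q m.*2 i))).
    apply: eq_integral => t; rewrite inE => Dt.
    have [i [_ _ fi]] := dyadic_stepE m.*2 Dt.
    by rewrite fi /Qs fi.
  move=> i im; rewrite /g mulr_ge0 ?invr_ge0//; apply: sumr_ge0 => j _.
  by apply: K0; exact: qe.
have mm2 : m.*2 @[m --> \oo] --> \oo.
  apply/cvgnyPge => A; exists A => // m /= Am.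
  by rewrite -addnn (leq_trans Am)// leq_addr.
have cX2 t : Qs m.*2 t @[m --> \oo] --> X t by exact: (cvg_comp _ _ mm2 (cX t)).
have cdd : dd @ \oo --> 0.
  apply/cvgrPdist_lt => eps e0.
  apply: (filterS _ (near_infty_natSinv_lt (PosNum e0))) => m /=.
  apply: le_lt_trans; rewrite sub0r normrN gtr0_norm// /dd.
  by rewrite lef_pV2 ?posrE ?ltr0n ?expn_gt0// ler_nat ltn_expl.
have kernel_lim s t : D s -> D t ->
   limn_einf (fun m => (L + cut_kernel (dd m) (Qs m.*2 s) (Qs m.*2 t))%:E) =
   log_kernel L (X s, X t).
  move=> Ds Dt.
  have h := cvg_cut_kernel (eL _ _ (Xe _ Ds) (Xe _ Dt)) (cX2 s) (cX2 t) cdd.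
  by have [-> _] := cvg_limn_einf_sup (h (nearW _ dd0)).
(* Fatou's lemma is used here for the inner integral and again below for the outer one; the
   truncated kernels converge pointwise to the full kernel. *)
have inner s : D s -> (\int[P]_(t in D) log_kernel L (X s, X t) <=
    limn_einf (fun m => (g m (Qs m.*2 s))%:E))%E.
  move=> Ds.
  rewrite (_ : (fun m => (g m (Qs m.*2 s))%:E) = (fun m =>
     \int[P]_(t in D) (L + cut_kernel (dd m) (Qs m.*2 s) (Qs m.*2 t))%:E)%E); last first.
    by apply/funext => m; rewrite innerE//; exact: Qe.
  rewrite (eq_integral (fun t => limn_einf (fun m =>
      (L + cut_kernel (dd m) (Qs m.*2 s) (Qs m.*2 t))%:E))); last first.
    by move=> t; rewrite inE => Dt; rewrite kernel_lim.
  apply: fatou => //.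
    by move=> m; apply/measurable_EFinP; exact: measurable_funTS (mcut m _).
  by move=> m t Dt; rewrite lee_fin; apply: K0; exact: Qe.
have mg m : measurable_fun [set: T] (fun s : T => g m (Qs m.*2 s)).
  apply: measurable_funM => //; apply: measurable_sum => j.
  by under eq_fun do rewrite cut_kernelC; exact: mcut.
have mid : (\int[P]_(s in D) \int[P]_(t in D) log_kernel L (X s, X t) <=
    \int[P]_(s in D) limn_einf (fun m => (g m (Qs m.*2 s))%:E))%E.
  apply: ge0_le_integral => //.
  - by move=> s _; apply: integral_ge0 => t _; exact: log_kernel_ge0.
  - under eq_fun do rewrite -potE.
    exact: measurable_funTS mLP.
  - apply: measurable_funTS; rewrite /limn_einf.
    apply: measurableT_comp => //; apply: measurable_fun_limn_esup => m.
    by apply: measurableT_comp => //; apply/measurable_EFinP; exact: mg.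
apply: (le_trans mid).
apply: (@le_trans _ _ (limn_einf (fun m => \int[P]_(s in D) (g m (Qs m.*2 s))%:E)%E)).
  apply: fatou => //.
    by move=> m; apply/measurable_EFinP; exact: measurable_funTS (mg m).
  move=> m t Dt; rewrite lee_fin /g mulr_ge0 ?invr_ge0//; apply: sumr_ge0 => j _.
  by apply: K0; [exact: Qe|exact: qe].
rewrite -EFinD; apply: limn_einf_le => eps e0.
have e1 : 0 < eps / (4 * B) by rewrite divr_gt0// mulr_gt0//; lra.
move: cdd => /cvgrPdist_lt/(_ _ e1) cdd.
apply: (filterS _ cdd) => m; rewrite sub0r normrN gtr0_norm// => ddm.
rewrite outerE lee_fin.
have := qen m.*2 (dd m) (dd0 m).
set p := (2 ^ m.*2)%:R; set S := \sum_(i < _) \sum_(j < _) _ => hS.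
have p0 : 0 < p by rewrite ltr0n expn_gt0.
have -> : p^-1 * \sum_(i < 2 ^ m.*2) g m (q m.*2 i) = L + S / p ^+ 2.
  rewrite /g -mulr_sumr -/p.
  have -> : \sum_(i < 2 ^ m.*2) \sum_(j < 2 ^ m.*2)
      (L + cut_kernel (dd m) (q m.*2 i) (q m.*2 j)) = p * (p * L) + S.
    under eq_bigr do rewrite big_split/=.
    rewrite big_split/= -/S; congr (_ + _).
    have cst (N : nat) (x : R) : \sum_(i < N) x = N%:R * x.
      by rewrite sumr_const card_ord mulr_natl.
    rewrite (eq_bigr (fun=> p * L)) => [|i _]; exact: cst.
  by field; rewrite gt_eqF.
have p2 : p = (dd m)^-1 * (dd m)^-1.
  by rewrite /dd invrK -natrM -expnD addnn.
have : S / p ^+ 2 <= gam + 4 * B * dd m.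
  rewrite ler_pdivrMr ?exprn_gt0//; apply: (le_trans hS); apply/le_of_eq.
  by rewrite p2; field; rewrite gt_eqF.
have : 4 * B * dd m <= eps by move: ddm; rewrite ltr_pdivlMr; lra.
lra.
Unshelve. all: by end_near. Qed.

End WeakLimit.

(** * The Green function as a potential *)

Section LogModLocal.
Context {R : realType}.
Local Notation plane := (R * R)%type.
Implicit Types (z p : plane).

Definition log_dist p z : R := log_mod (z.1 - p.1, z.2 - p.2).

Lemma sqr_dist_gt0 p z : z != p -> 0 < (z.1 - p.1) ^+ 2 + (z.2 - p.2) ^+ 2.
Proof.
move=> zp; rewrite lt_neqAle addr_ge0 ?sqr_ge0// andbT eq_sym.
by rewrite paddr_eq0 ?sqr_ge0// !expf_eq0/= !subr_eq0 -xpair_eqE -!surjective_pairing.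
Qed.

Lemma log_dist_flat p z : z != p -> flat_at (log_dist p) z.
Proof.
move=> zp eps e0; have s0 := sqr_dist_gt0 zp.
set s := _ + _ in s0; pose d := Num.sqrt s.
have d0 : 0 < d by rewrite sqrtr_gt0.
have ds : d ^+ 2 = s by rewrite sqr_sqrtr// ltW.
near=> r.
have r0 : 0 < r by near: r; exact: nbhs_right_gt.
have rd : r <= d / 2 by near: r; apply: nbhs_right_le; rewrite divr_gt0.
have r1 : r <= 1 by near: r; apply: nbhs_right_le.
have re : r <= eps * d ^+ 4 / 3.
  by near: r; apply: nbhs_right_le; rewrite divr_gt0// mulr_gt0// exprn_gt0.
have d40 : 0 < d ^+ 4 by rewrite exprn_gt0.
have := @five_point_log_mod _ p z d r d0.
rewrite ds lexx (ltW r0) rd => /(_ isT isT) /le_trans; apply.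
rewrite ler_pdivrMr//.
have -> : 3 * r ^+ 4 = 3 * r ^+ 2 * r ^+ 2 by ring.
have -> : eps * r ^+ 2 * d ^+ 4 = eps * d ^+ 4 * r ^+ 2 by ring.
apply: ler_wpM2r; first exact: sqr_ge0.
have : r ^+ 2 <= r by rewrite expr2 -[leRHS]mulr1 ler_wpM2l// ltW.
by move: re; rewrite ler_pdivlMr//; lra.
Unshelve. all: by end_near. Qed.

Lemma continuous_sqr_dist p : continuous
  (fun z : plane => (z.1 - p.1) ^+ 2 + (z.2 - p.2) ^+ 2).
Proof.
move=> z; have c1 : (y.1 - p.1 : R) @[y --> z] --> (z.1 - p.1 : R).
  by apply: cvgB; [exact: cvg_fst|exact: cvg_cst].
have c2 : (y.2 - p.2 : R) @[y --> z] --> (z.2 - p.2 : R).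
  by apply: cvgB; [exact: cvg_snd|exact: cvg_cst].
by apply: cvgD; rewrite !expr2; apply: cvgM.
Qed.

Lemma log_dist_continuous p z : z != p -> {for z, continuous (log_dist p)}.
Proof.
move=> zp; apply: cvgM; last exact: cvg_cst.
apply: continuous_cvg; last exact: continuous_sqr_dist.
by apply: continuous_ln; exact: sqr_dist_gt0.
Qed.

Lemma modulus_dist_continuous p :
  continuous (fun z : plane => modulus (z.1 - p.1, z.2 - p.2)).
Proof.
move=> z; have h := @continuous_sqr_dist p z.
exact: (continuous_comp h (@sqrt_continuous R _)).
Qed.

Lemma modulus_gt0 z : z != (0, 0) -> 0 < modulus z.
Proof.
move=> z0; have := @sqr_dist_gt0 (0, 0) z z0; rewrite /= !subr0.
by rewrite /modulus sqrtr_gt0.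
Qed.

Lemma modulusD z p : modulus (z.1 + p.1, z.2 + p.2) <= modulus z + modulus p.
Proof.
have m0 := modulus_ge0 z; have p0 := modulus_ge0 p.
apply: ler_sqr_inv; rewrite ?addr_ge0// sqr_modulus [leRHS]sqrrD !sqr_modulus/=.
suff : z.1 * p.1 + z.2 * p.2 <= modulus z * modulus p by lra.
apply: ler_sqr_inv; rewrite ?mulr_ge0// exprMn !sqr_modulus -subr_ge0.
have -> : (z.1 ^+ 2 + z.2 ^+ 2) * (p.1 ^+ 2 + p.2 ^+ 2) - (z.1 * p.1 + z.2 * p.2) ^+ 2 =
  (z.1 * p.2 - z.2 * p.1) ^+ 2 by ring.
exact: sqr_ge0.
Qed.

Lemma modulusB z p : modulus (z.1 - p.1, z.2 - p.2) <= modulus z + modulus p.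
Proof.
have -> : modulus p = modulus (- p.1, - p.2) by rewrite /modulus/= !sqrrN.
exact: (modulusD z (- p.1, - p.2)).
Qed.

Lemma modulusB_ge z p : modulus z - modulus p <= modulus (z.1 - p.1, z.2 - p.2).
Proof.
rewrite lerBlDr; have := modulusD (z.1 - p.1, z.2 - p.2) p.
by rewrite /= !subrK -surjective_pairing.
Qed.

(** Near [z0] the function [v] stays above half of [v z0], and on the annulus [h - log_dist z0] is
    at most a constant; [eta] is the quotient of the two. *)
Lemma local_barrier (v h : plane -> R) z0 : {for z0, continuous v} ->
  {for z0, continuous h} -> 0 < v z0 -> forall r0, 0 < r0 ->
  exists r eta : R, [/\ 0 < r, r <= r0, 0 < eta & forall z,
    r < modulus (z.1 - z0.1, z.2 - z0.2) < 2 * r ->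
    eta * (h z - log_dist z0 z) <= v z].
Proof.
move=> cv ch v0 r0 r00.
have nv : \forall z \near z0, v z0 / 2 < v z.
  by apply: (cvgr_gt (v z0) cv); rewrite gtr_pMr// invf_lt1// ltr1n.
have nh : \forall z \near z0, h z < h z0 + 1 by apply: (cvgr_lt (h z0) ch); rewrite ltrDl.
have [d /= d0 dP] := (nbhs_ballP _ _).1 (filterI nv nh).
pose r := Num.min r0 (d / 2).
have r_gt0 : 0 < r by rewrite lt_min r00 divr_gt0.
pose C := `|h z0 + 1 - ln r| + 1.
have C0 : 0 < C by rewrite ltr_wpDl.
exists r, (v z0 / 2 / C); split => //.
- by rewrite ge_min lexx.
- by rewrite !divr_gt0.
move=> z /andP[z1 z2].
have rd : 2 * r <= d.
  have : r <= d / 2 by rewrite ge_min lexx orbT.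
  lra.
have [hv hh] : v z0 / 2 < v z /\ h z < h z0 + 1.
  apply: dP; split; rewrite /ball/= distrC.
    exact: le_lt_trans (modulus_ge_fst (z.1 - z0.1, z.2 - z0.2)) (lt_le_trans z2 rd).
  exact: le_lt_trans (modulus_ge_snd (z.1 - z0.1, z.2 - z0.2)) (lt_le_trans z2 rd).
apply: (@le_trans _ _ (v z0 / 2)); last exact: ltW.
rewrite mulrAC ler_pdivrMr// ler_pM2l ?divr_gt0//.
have : ln r <= log_dist z0 z.
  by rewrite /log_dist log_modE ler_ln ?posrE// ?(lt_trans r_gt0 z1)// ltW.
have := ler_norm (h z0 + 1 - ln r); rewrite /C; lra.
Qed.

Lemma ln_ratio_le (a b m : R) : 0 <= a -> 0 <= b -> b < m ->
  ln (m + a) - ln (m - b) <= (a + b) / (m - b).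
Proof.
move=> a0 b0 bm; have mb : 0 < m - b by rewrite subr_gt0.
have ma : 0 < m + a by lra.
rewrite -ln_div ?posrE// (le_trans (ln_le_subr1 _)) ?divr_gt0//.
by apply/le_of_eq; field; rewrite gt_eqF.
Qed.

End LogModLocal.

(** * Comparison of the Green function with the potential *)

Section GreenFunction.
Context {R : realType}.
Local Notation plane := (R * R)%type.
Local Notation T := (measurableTypeR R).
Implicit Types (z p : plane) (g : plane -> R) (e : set R).

Lemma modulus_unbounded (M : R) z : (M < `|z.1|) || (M < `|z.2|) -> M < modulus z.
Proof.
by case/orP => h; apply: (lt_le_trans h); [exact: modulus_ge_fst|exact: modulus_ge_snd].
Qed.

(** Supplies the condition at infinity in [maximum_principle]: a negative multiple of the logarithm
    absorbs every constant. *)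
Lemma sublog_at_infinity (D : set plane) (F : plane -> R) (A c r : R) : 0 < c ->
  (forall z, D z -> r < modulus z -> F z <= A - c * ln (modulus z)) ->
  forall eps : R, 0 < eps -> exists M : R, forall z, D z ->
    (M < `|z.1|) || (M < `|z.2|) -> F z <= eps.
Proof.
move=> c0 FA eps e0; exists (Num.max r (expR (A / c))) => z Dz /modulus_unbounded.
rewrite gt_max => /andP[rz Az]; have mz : 0 < modulus z by rewrite (lt_trans _ Az)// expR_gt0.
apply: (le_trans (FA _ Dz rz)); apply: (le_trans _ (ltW e0)).
rewrite subr_le0 -ler_pdivrMl// mulrC -[leLHS]expRK ler_ln ?posrE ?expR_gt0//.
exact: ltW.
Qed.

Lemma on_real_axisP e z : on_real_axis e z <-> e z.1 /\ z.2 = 0.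
Proof.
split=> [[x ex <-]//|[ez z2]]; exists z.1 => //.
by rewrite -z2 -surjective_pairing.
Qed.

Lemma closed_on_real_axis e : compact e -> closed (on_real_axis e).
Proof.
move=> ce; apply: compact_closed; first exact: norm_hausdorff.
apply: continuous_compact => //; apply: continuous_subspaceT => x.
exact: (cvg_pair (@cvg_id _ (nbhs x)) (@cvg_cst _ (0 : R) _ (nbhs x) _)).
Qed.

Lemma open_off_axis e : compact e -> open (~` on_real_axis e).
Proof. by move=> ce; apply/closed_openC; exact: closed_on_real_axis. Qed.

Lemma off_axis_upper e z : 0 < z.2 -> ~ on_real_axis e z.
Proof. by move=> z0 /on_real_axisP[_ z20]; rewrite z20 ltxx in z0. Qed.

Lemma off_axis_dist e z : compact e -> ~ on_real_axis e z ->
  exists2 d : R, 0 < d & forall x, e x -> d ^+ 2 <= (z.1 - x) ^+ 2 + z.2 ^+ 2.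
Proof.
move=> ce Dz; have [d /= d0 dP] := (nbhs_ballP _ _).1 (open_off_axis ce Dz).
exists d => // x ex; rewrite leNgt; apply/negP => lt_d.
apply: (dP (x, 0)); last by exists x.
have aux (a : R) : a ^+ 2 < d ^+ 2 -> `|a| < d.
  by move=> ad; rewrite ltNge; apply/negP => /(lerXn2r 2); rewrite !nnegrE !normr_ge0 (ltW d0)// => /(_ isT isT); rewrite real_normK ?num_real// leNgt ad.
split; rewrite /ball/=; apply: aux.
  by apply: (le_lt_trans _ lt_d); rewrite lerDl sqr_ge0.
by apply: (le_lt_trans _ lt_d); rewrite subr0 lerDr sqr_ge0.
Qed.

(** The properties of the Green function of a regular set on which the comparisons rest. Stated
    through [flat_at], they pass to the reflected function without computing derivatives. *)
Definition green_like e g : Prop :=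
  [/\ forall z, ~ on_real_axis e z -> {for z, continuous g},
      forall z, ~ on_real_axis e z -> flat_at g z,
      exists M r, forall z, r < modulus z -> `|g z - ln (modulus z)| <= M &
      forall x, e x -> forall eps : R, 0 < eps ->
        \forall y \near (x, 0 : R), ~ on_real_axis e y -> `|g y| <= eps].

Lemma green_like_conj e g : green_like e g ->
  green_like e (fun z => g (z.1, - z.2)).
Proof.
move=> [gc gf [M [r gM]] g0].
have E z : ~ on_real_axis e z -> ~ on_real_axis e (z.1, - z.2).
  move=> Dz /on_real_axisP/= [ez z2]; apply: Dz; apply/on_real_axisP; split=> //.
  by rewrite -[LHS]opprK z2 oppr0.
have cc z : ((y.1, - y.2) : plane) @[y --> z] --> ((z.1, - z.2) : plane).
  have c2 : (- y.2 : R) @[y --> z] --> (- z.2 : R) by apply: cvgN; exact: cvg_snd.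
  exact: (cvg_pair (@cvg_fst _ _ (nbhs z.1) (nbhs z.2) _) c2).
split.
- by move=> z Dz; apply: (cvg_comp _ _ (cc z)); exact: (gc _ (E _ Dz)).
- move=> z Dz eps e0; apply: filterS (gf _ (E _ Dz) eps e0) => s.
  rewrite /five_point/=.
  have -> : - (z.2 + s) = - z.2 - s by ring.
  have -> : - (z.2 - s) = - z.2 + s by ring.
  move=> h; apply: (le_trans _ h); apply/le_of_eq; congr (`|_|); ring.
- exists M, r => z rz.
  have -> : modulus z = modulus (z.1, - z.2) by rewrite /modulus/= sqrrN.
  by apply: gM; rewrite /modulus/= sqrrN.
- move=> x ex eps e0; have h := g0 _ ex eps e0.
  have c0 := cc (x, 0); rewrite /= oppr0 in c0.
  have : \forall y \near (x, 0 : R), ~ on_real_axis e (y.1, - y.2) -> `|g (y.1, - y.2)| <= eps.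
    exact: c0 h.
  by apply: filterS => y hy /E/hy.
Qed.

Section Comparison.
Context (e : set R) (rho : probability T R) (g : plane -> R).
Context (ce : compact e) (rho_eq : is_equilibrium_measure e rho).
Context (gg : green_like e g).
Local Notation D := (~` on_real_axis e).
Local Notation U := (potential e rho).
Local Notation I := (robin e rho).

Lemma green_like_lower : exists M r : R, forall z, r < modulus z ->
  ln (modulus z) <= g z + M.
Proof.
have [_ _ [M [r gM]] _] := gg; exists M, r => z /gM.
by rewrite ler_norml => /andP[]; lra.
Qed.

Lemma green_like_boundary z : ~ D z -> forall eps : R, 0 < eps ->
  \forall y \near z, D y -> `|g y| <= eps.
Proof.
have [_ _ _ g0] := gg; move=> /contrapT/on_real_axisP[ez z2] eps e0.
by have := g0 _ ez eps e0; rewrite -z2 -surjective_pairing.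
Qed.

Lemma green_like_ge0 z : D z -> 0 <= g z.
Proof.
have [gc gf _ g0] := gg; have [M [r gM]] := green_like_lower.
move=> Dz; rewrite -oppr_le0 -mulN1r.
apply: (@maximum_principle _ D (fun z => -1 * g z)) Dz.
- exact: open_off_axis.
- by move=> y Dy; apply: cvgMr; exact: gc.
- by move=> y Dy; exact: flat_atZ (gf _ Dy).
- move=> y Dy eps e0; have := green_like_boundary Dy e0; apply: (@filterS _ (nbhs y) _) => t + Dt => /(_ Dt).
  by apply: le_trans; rewrite mulN1r -normrN ler_norm.
- apply: (@sublog_at_infinity _ _ M 1 r) => // y _ /gM; lra.
Qed.

Lemma potential_ge_ln z (B : R) : (forall x, e x -> `|x| <= B) ->
  B < modulus z -> ln (modulus z - B) <= U z.
Proof.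
move=> eB Bz; have me := compact_measurable ce.
have [re _ _] := rho_eq.
have ci : rho.-integrable e (EFin \o (fun=> ln (modulus z - B))).
  by have := finite_measure_integrable_cst rho (ln (modulus z - B)) me.
have : \int[rho]_(x in e) (ln (modulus z - B)) = ln (modulus z - B).
  by rewrite Rintegral_cst// [X in fine X]re mulr1.
move=> <-; apply: le_Rintegral => //; first exact: log_mod_integrable.
move=> x ex; rewrite log_modE.
have xB := eB _ ex; have mx := modulus_sub_ge z x.
by rewrite ler_ln ?posrE//; lra.
Qed.

Lemma off_axis_potential z : D z -> {for z, continuous U} /\ flat_at U z.
Proof.
move=> Dz; have [d d0 dP] := off_axis_dist ce Dz.
split; first exact: (potential_continuous ce rho_eq d0 dP).
exact: (potential_flat ce rho_eq d0 dP).
Qed.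

Lemma ln_sub_ge (B m : R) : 0 < B -> 2 * B < m -> ln m - ln 2 <= ln (m - B).
Proof.
move=> B0 Bm; rewrite -ln_div ?posrE//; last by lra.
by rewrite ler_ln ?posrE ?divr_gt0//; lra.
Qed.

(** Only boundedness of [g - U] is known at infinity, so [g] is first multiplied by [1 - eps], which
    sends the difference to [-oo] there. Near the set [g] is small and Frostman's bound controls
    [- U]. *)
Lemma green_le_potential z : D z -> g z <= U z + I.
Proof.
have [gc gf [M [r gM]] g0] := gg.
have [B B1 eB] := compact_norm_bound ce.
move=> Dz; apply/ler_addgt0Pr => eps0 e00.
pose eps := eps0 / (`|g z| + 1).
have e0 : 0 < eps by rewrite divr_gt0// ltr_wpDl.
suff : (1 - eps) * g z + - 1 * U z - I <= 0.
  have : eps * g z <= eps0.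
    rewrite /eps mulrAC ler_pdivrMr ?ltr_wpDl// ler_pM2l//.
    by have := ler_norm (g z); lra.
  lra.
apply: (@maximum_principle _ D (fun z => (1 - eps) * g z + - 1 * U z - I)) Dz.
- exact: open_off_axis.
- move=> y Dy; have [Uc _] := off_axis_potential Dy.
  apply: cvgB; last exact: cvg_cst.
  by apply: cvgD; apply: cvgMr; [exact: gc|exact: Uc].
- move=> y Dy; have [_ Uf] := off_axis_potential Dy.
  have := flat_atD (flat_atD (flat_atZ (1 - eps) (gf _ Dy)) (flat_atZ (-1) Uf))
    (flat_at_cst (- I) y).
  exact.
- move=> y Dy d d0; have := green_like_boundary Dy d0; apply: (@filterS _ (nbhs y) _) => t + Dt => /(_ Dt) gt.
  have := potential_ge ce rho_eq t; have t0 := green_like_ge0 Dt.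
  have : 0 <= eps * g t by rewrite mulr_ge0// ltW.
  by have := ler_norm (g t); lra.
- pose A := (1 + eps) * `|M| + ln 2 + `|I|.
  apply: (@sublog_at_infinity _ _ A eps (Num.max r (2 * B))) => // y Dy.
  rewrite gt_max => /andP[/gM + By]; rewrite ler_norml => /andP[m1 m2].
  have U1 : ln (modulus y - B) <= U y by apply: potential_ge_ln => //; lra.
  have U2 : ln (modulus y) - ln 2 <= ln (modulus y - B) by apply: ln_sub_ge => //; lra.
  have := ler_norm M; have := ler_norm (- I); rewrite normrN.
  have h : - (eps * g y) <= eps * `|M| - eps * ln (modulus y).
    rewrite -mulrN -mulrBr ler_pM2l//; have := ler_norm M; lra.
  rewrite /A; move: h U1 U2 m1 m2; rewrite !mulrDl !mul1r; lra.
Qed.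

End Comparison.
End GreenFunction.

(** * The Bernstein-Walsh inequality and the defect at infinity *)

Section GreenPotential.
Context {R : realType}.
Local Notation plane := (R * R)%type.
Local Notation T := (measurableTypeR R).
Implicit Types (z p : plane).

Lemma flat_at_sum (s : seq R) (F : R -> plane -> R) z :
  (forall x, x \in s -> flat_at (F x) z) ->
  flat_at (fun y => \sum_(x <- s) F x y) z.
Proof.
elim: s => [|x s IH] Fz.
  under [X in flat_at X]eq_fun do rewrite big_nil.
  exact: flat_at_cst.
under [X in flat_at X]eq_fun do rewrite big_cons.
apply: flat_atD; first by apply: Fz; rewrite mem_head.
by apply: IH => y ys; apply: Fz; rewrite in_cons ys orbT.
Qed.

Lemma continuous_sum (s : seq R) (F : R -> plane -> R) z :
  (forall x, x \in s -> {for z, continuous (F x)}) ->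
  {for z, continuous (fun y => \sum_(x <- s) F x y)}.
Proof.
elim: s => [|x s IH] Fz.
  have -> : (fun y => \sum_(x <- [::]) F x y) = (fun=> 0) by apply/funext => y; rewrite big_nil.
  exact: cvg_cst.
have -> : (fun y => \sum_(x <- x :: s) F x y) = (fun y => F x y + \sum_(x <- s) F x y).
  by apply/funext => y; rewrite big_cons.
apply: cvgD; first by apply: Fz; rewrite mem_head.
by apply: IH => y ys; apply: Fz; rewrite in_cons ys orbT.
Qed.

Lemma continuous_prod (s : seq R) (F : R -> plane -> R) z :
  (forall x, x \in s -> {for z, continuous (F x)}) ->
  {for z, continuous (fun y => \prod_(x <- s) F x y)}.
Proof.
elim: s => [|x s IH] Fz.
  have -> : (fun y => \prod_(x <- [::]) F x y) = (fun=> 1) by apply/funext => y; rewrite big_nil.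
  exact: cvg_cst.
have -> : (fun y => \prod_(x <- x :: s) F x y) = (fun y => F x y * \prod_(x <- s) F x y).
  by apply/funext => y; rewrite big_cons.
apply: cvgM; first by apply: Fz; rewrite mem_head.
by apply: IH => y ys; apply: Fz; rewrite in_cons ys orbT.
Qed.

Section Comparison.
Context (e : set R) (rho : probability T R) (g : plane -> R).
Context (ce : compact e) (rho_eq : is_equilibrium_measure e rho).
Context (gg : green_like e g).
Local Notation D := (~` on_real_axis e).
Local Notation U := (potential e rho).
Local Notation I := (robin e rho).

Lemma log_dist_le p z : p != z -> 0 < modulus z + modulus p ->
  log_dist p z <= ln (modulus z + modulus p).
Proof.
move=> pz zp; rewrite /log_dist log_modE ler_ln ?posrE ?modulusB//.
by apply: modulus_gt0; rewrite xpair_eqE !subr_eq0 -xpair_eqE -!surjective_pairing eq_sym.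
Qed.

Lemma log_dist_ge p z : modulus p < modulus z ->
  ln (modulus z - modulus p) <= log_dist p z.
Proof.
move=> pz; have h := modulusB_ge z p.
by rewrite /log_dist log_modE ler_ln ?posrE//; lra.
Qed.

Lemma modulus_real (x : R) : modulus (x, 0 : R) = `|x|.
Proof. by rewrite /modulus/= expr0n addr0 sqrtr_sqr. Qed.

Lemma off_axis_neq x z : D z -> e x -> z != (x, 0).
Proof. by move=> Dz ex; apply/eqP => zx; apply: Dz; rewrite zx; exists x. Qed.

Lemma ln_add_le (B m : R) : 0 < B -> 2 * B < m -> ln (m + B) <= ln m + ln 2.
Proof. by move=> B0 Bm; rewrite -lnM ?posrE; [rewrite ler_ln ?posrE; lra|lra|lra]. Qed.

(** The maximum principle is applied to the log-modulus of the monic polynomial with roots [s],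
    minus [(n + eps) g], which tends to [-oo] at infinity. As the roots lie on the set, it is the
    product and not its logarithm that is continuous there; the strict bound persists near each
    point of the set. *)
Lemma bernstein_walsh (s : seq R) (L : R) :
  (forall x, x \in s -> e x) ->
  (forall y, e y -> \prod_(x <- s) `|y - x| < expR (- L)) ->
  forall z, D z -> \sum_(x <- s) log_dist (x, 0) z + L <= (size s)%:R * g z.
Proof.
have [gc gf _ g0] := gg; have [M [r gM]] := green_like_lower gg.
have [B B1 eB] := compact_norm_bound ce.
have B0 : 0 < B by lra.
move=> se sL z Dz; set n : R := (size s)%:R; apply/ler_addgt0Pr => eps0 e00.
pose eps := eps0 / (`|g z| + 1).
have e0 : 0 < eps by rewrite divr_gt0// ltr_wpDl.
have n0 : 0 <= n by exact: ler0n.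
suff : \sum_(x <- s) log_dist (x, 0) z + - (n + eps) * g z + L <= 0.
  have : eps * g z <= eps0.
    rewrite /eps mulrAC ler_pdivrMr ?ltr_wpDl// ler_pM2l//.
    by have := ler_norm (g z); lra.
  lra.
apply: (@maximum_principle _ D
  (fun z => \sum_(x <- s) log_dist (x, 0) z + - (n + eps) * g z + L)) Dz.
- exact: open_off_axis.
- move=> y Dy; apply: cvgD; last exact: cvg_cst.
  apply: cvgD; last by apply: cvgMr; exact: gc.
  apply: continuous_sum => x xs; apply: log_dist_continuous.
  by apply: off_axis_neq => //; exact: se.
- move=> y Dy; apply: flat_atD; last exact: flat_at_cst.
  apply: flat_atD; last by apply: flat_atZ; exact: gf.
  apply: flat_at_sum => x xs; apply: log_dist_flat.
  by apply: off_axis_neq => //; exact: se.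
- move=> y /contrapT/on_real_axisP[ey y2] d d0.
  have pc : {for y, continuous (fun y : plane => \prod_(x <- s) modulus (y.1 - x, y.2 - 0))}.
    by apply: continuous_prod => x xs; exact: (@modulus_dist_continuous _ (x, 0)).
  have yL : \prod_(x <- s) modulus (y.1 - x, y.2 - 0) < expR (- L).
    rewrite y2 subr0 (eq_bigr (fun x => `|y.1 - x|)) ?sL// => x _.
    exact: modulus_real.
  have nL : \forall t \near y, \prod_(x <- s) modulus (t.1 - x, t.2 - 0) < expR (- L) by exact: (cvgr_lt _ pc _ yL).
  move: nL; apply: (@filterS _ (nbhs y) _) => t tL Dt.
  have gt := green_like_ge0 ce gg Dt.
  have m0 x : x \in s -> 0 < modulus (t.1 - x, t.2 - 0).
    move=> xs; apply: modulus_gt0; rewrite xpair_eqE !subr_eq0 -xpair_eqE -surjective_pairing.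
    by apply: off_axis_neq => //; exact: se.
  have p0 : 0 < \prod_(x <- s) modulus (t.1 - x, t.2 - 0).
    by rewrite big_seq_cond prodr_gt0// => x; rewrite andbT; exact: m0.
  have : ln (\prod_(x <- s) modulus (t.1 - x, t.2 - 0)) < - L.
    by rewrite -[ltRHS]expRK ltr_ln ?posrE ?expR_gt0.
  have -> : ln (\prod_(x <- s) modulus (t.1 - x, t.2 - 0)) =
      \sum_(x <- s) log_dist (x, 0) t.
    clear -m0; elim: s m0 => [|x s IH] m0; first by rewrite !big_nil ln1.
    have mp : 0 < \prod_(x <- s) modulus (t.1 - x, t.2 - 0).
      rewrite big_seq_cond prodr_gt0// => y; rewrite andbT => ys; apply: m0.
      by rewrite in_cons ys orbT.
    rewrite !big_cons lnM ?posrE ?m0 ?mem_head// IH /log_dist ?log_modE//.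
    by move=> y ys; rewrite m0// in_cons ys orbT.
  have : 0 <= (n + eps) * g t by rewrite mulr_ge0//; lra.
  lra.
- pose A := n * ln 2 + (n + eps) * M + L.
  apply: (@sublog_at_infinity _ _ _ A eps (Num.max r (2 * B))) => // y Dy.
  rewrite gt_max => /andP[/gM gy By].
  have : \sum_(x <- s) log_dist (x, 0) y <= n * (ln (modulus y) + ln 2).
    have -> : n * (ln (modulus y) + ln 2) = \sum_(x <- s) (ln (modulus y) + ln 2).
      by rewrite big_const_seq iter_addr_0 count_predT mulr_natl.
    rewrite big_seq_cond [leRHS]big_seq_cond; apply: ler_sum => x; rewrite andbT => /se ex.
    have xB := eB _ ex.
    have mx : modulus (x, 0 : R) <= B by rewrite modulus_real.
    have mx0 := modulus_ge0 (x, 0 : R).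
    apply: (@le_trans _ _ (ln (modulus y + B))); last by apply: ln_add_le.
    apply: (@le_trans _ _ (ln (modulus y + modulus (x, 0 : R)))).
      by apply: log_dist_le; [rewrite eq_sym; exact: off_axis_neq|lra].
    by rewrite ler_ln ?posrE; lra.
  have : (n + eps) * ln (modulus y) <= (n + eps) * (g y + M).
    by rewrite ler_wpM2l//; lra.
  rewrite /A; lra.
Qed.

(* If [I] were larger, [energy_of_points] would fail for some finite set of
   points, against [bernstein_walsh]. *)
Lemma robin_le_green z (B : R) : (forall x, e x -> `|x| <= B) -> 0 < B ->
  D z -> B < modulus z -> I <= g z - ln (modulus z - B).
Proof.
move=> eB B0 Dz Bz; apply/ler_addgt0Pr => eta eta0.
set gam := (X in X <= _) in |- *; rewrite {}/gam.
pose gam := g z - ln (modulus z - B) + eta.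
have e0 : e !=set0.
  apply/set0P/eqP => e0; have [re _ _] := rho_eq.
  by move: re; rewrite e0 measure0 => -[/eqP]; rewrite eq_sym oner_eq0.
have [|mu mu1] := @energy_of_points _ e gam ce e0; last first.
  by move=> muE; rewrite -lee_fin; apply: le_trans muE; exact: robin_min.
move=> s se; apply: contrapT => no.
have sL y : e y -> \prod_(x <- s) `|y - x| < expR (- (gam * (size s)%:R)).
  move=> ey; rewrite ltNge; apply/negP => h; apply: no; exists y; split=> //.
  by rewrite mulNr.
have h := bernstein_walsh se sL Dz.
have n0 : (0 < size s)%N.
  rewrite lt0n; apply/eqP => s0; have [y ey] := e0; have := sL y ey.
  by rewrite (size0nil s0) big_nil/= mulr0 oppr0 expR0 ltxx.
have : (size s)%:R * ln (modulus z - B) <= \sum_(x <- s) log_dist (x, 0) z.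
  have -> : (size s)%:R * ln (modulus z - B) = \sum_(x <- s) ln (modulus z - B).
    by rewrite big_const_seq iter_addr_0 count_predT mulr_natl.
  rewrite big_seq_cond [leRHS]big_seq_cond; apply: ler_sum => x; rewrite andbT => /se ex.
  have xB := eB _ ex.
  have mx : modulus (x, 0 : R) <= B by rewrite modulus_real.
  apply: (le_trans _ (log_dist_ge _)); last by lra.
  by rewrite ler_ln ?posrE; lra.
have : 0 < (size s)%:R * eta by rewrite mulr_gt0// ltr0n.
move: h; rewrite /gam; lra.
Qed.

Definition green_defect z := U z + I - g z.

Lemma green_defect_ge0 z : D z -> 0 <= green_defect z.
Proof. by move=> Dz; rewrite subr_ge0; exact: green_le_potential. Qed.

Lemma green_defect_le z (B : R) : (forall x, e x -> `|x| <= B) -> 0 < B ->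
  D z -> B < modulus z -> green_defect z <= 2 * B / (modulus z - B).
Proof.
move=> eB B0 Dz Bz.
have := robin_le_green eB B0 Dz Bz.
have := potential_le_ln ce rho_eq eB (ltW B0) Bz.
have := ln_ratio_le (ltW B0) (ltW B0) Bz.
rewrite /green_defect; lra.
Qed.

Lemma green_defect_continuous z : D z -> {for z, continuous green_defect}.
Proof.
move=> Dz; have [Uc _] := off_axis_potential ce rho_eq Dz; have [gc _ _ _] := gg.
apply: cvgB; last exact: gc.
by apply: cvgD; [exact: Uc|exact: cvg_cst].
Qed.

Lemma green_defect_flat z : D z -> flat_at green_defect z.
Proof.
move=> Dz; have [_ Uf] := off_axis_potential ce rho_eq Dz; have [_ gf _ _] := gg.
rewrite /green_defect; under [X in flat_at X]eq_fun do rewrite -[X in _ + X]mulN1r.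
apply: flat_atD; last exact: flat_atZ (gf _ Dz).
exact: flat_atD Uf (flat_at_cst _ _).
Qed.

End Comparison.
End GreenPotential.

(** * Barriers, and vanishing of the defect far from the set *)

Section GreenIdentity.
Context {R : realType}.
Local Notation plane := (R * R)%type.
Local Notation T := (measurableTypeR R).
Implicit Types (z p : plane).

Section Comparison.
Context (e : set R) (rho : probability T R) (g : plane -> R).
Context (ce : compact e) (rho_eq : is_equilibrium_measure e rho).
Context (gg : green_like e g).
Local Notation D := (~` on_real_axis e).
Local Notation U := (potential e rho).
Local Notation I := (robin e rho).
Local Notation v := (green_defect e rho g).

(* Compare the defect with [h - log_dist z0] outside a small disc around [z0]. *)
Lemma defect_barrier (A : set plane) (h : plane -> R) z0 (C r1 : R) :
  open A -> A `<=` D -> A z0 -> 0 < v z0 ->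
  (forall z, A z -> {for z, continuous h}) -> (forall z, A z -> flat_at h z) ->
  (forall z, ~ A z -> forall eps : R, 0 < eps ->
     \forall y \near z, A y -> h y - log_dist z0 y <= eps) ->
  (forall z, A z -> r1 < modulus z -> h z - log_dist z0 z <= C) ->
  exists r eta : R, [/\ 0 < r, 0 < eta & forall z, A z ->
    r < modulus (z.1 - z0.1, z.2 - z0.2) -> eta * (h z - log_dist z0 z) <= v z].
Proof.
move=> oA AD Az0 v0 hc hf hb hi; have [gc gf _ _] := gg.
have [M [r2 gM]] := green_like_lower gg.
have [r [eta [r0 _ eta0 loc]]] := local_barrier
  (green_defect_continuous ce rho_eq gg (AD _ Az0)) (hc _ Az0) v0 ltr01.
exists r, eta; split=> // z Az rz; apply/ler_addgt0Pr => eps0 e00.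
pose eps := eps0 / (`|g z| + 1).
have e0 : 0 < eps by rewrite divr_gt0// ltr_wpDl.
(* The term [eps * g] outweighs the constant [C] at infinity; it is discarded at the end, because
   [eps * g z] is at most [eps0] at the given point. *)
pose F z : R := eta * (h z + -1 * log_dist z0 z) + -1 * v z + - eps * g z.
suff : F z <= 0.
  have : eps * g z <= eps0.
    rewrite /eps mulrAC ler_pdivrMr ?ltr_wpDl// ler_pM2l//.
    by have := ler_norm (g z); lra.
  rewrite /F; lra.
pose A' : set plane := A `&`
  (fun z : plane => modulus (z.1 - z0.1, z.2 - z0.2)) @^-1` [set x | x > r].
have neq y : A' y -> y != z0.
  move=> [_ /= ry]; apply/eqP => yz; move: ry; rewrite yz !subrr.
  by rewrite modulus_real normr0 ltNge ltW.
apply: (@maximum_principle _ A' F) => //.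
- apply: openI => //; apply: open_comp; last exact: open_gt.
  by move=> y _; exact: modulus_dist_continuous.
- move=> y A'y; have [Ay _] := A'y.
  apply: cvgD; last by apply: cvgMr; exact: gc (AD _ Ay).
  apply: cvgD; last by apply: cvgMr; exact: green_defect_continuous (AD _ Ay).
  apply: cvgMr; apply: cvgD; first exact: hc.
  by apply: cvgMr; apply: log_dist_continuous; exact: neq.
- move=> y A'y; have [Ay _] := A'y.
  apply: flat_atD; last by apply: flat_atZ; exact: gf (AD _ Ay).
  apply: flat_atD; last by apply: flat_atZ; exact: green_defect_flat (AD _ Ay).
  apply: flat_atZ; apply: flat_atD; first exact: hf.
  by apply: flat_atZ; apply: log_dist_flat; exact: neq.
- move=> y nA' d d0.
  have fin t : D t -> eta * (h t - log_dist z0 t) <= v t + d -> F t <= d.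
    move=> Dt; have := green_like_ge0 ce gg Dt => g0.
    have : 0 <= eps * g t by rewrite mulr_ge0// ltW.
    rewrite /F; lra.
  have [Ay|nA] := pselect (A y).
    (* A boundary point of [A'] inside [A] lies in the closed disc of radius [r], so nearby points
       of [A'] lie in the annulus where [loc] applies. *)
    have yr : modulus (y.1 - z0.1, y.2 - z0.2) < 2 * r.
      by rewrite ltNge; apply/negP => yr; apply: nA'; split=> //=; lra.
    have nr : \forall t \near y, modulus (t.1 - z0.1, t.2 - z0.2) < 2 * r.
      exact: (cvgr_lt _ (@modulus_dist_continuous _ z0 y) _ yr).
    move: nr; apply: (@filterS _ (nbhs y) _) => t tr [At rt].
    apply: fin (AD _ At) _; have := loc t; rewrite rt tr => /(_ isT); lra.
  have := hb _ nA (d / eta) (divr_gt0 d0 eta0).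
  apply: (@filterS _ (nbhs y) _) => t + [At _] => /(_ At).
  rewrite ler_pdivlMr// mulrC => ht; apply: fin (AD _ At) _.
  by have := green_defect_ge0 ce rho_eq gg (AD _ At); lra.
- pose B := eta * `|C| + eps * M.
  apply: (@sublog_at_infinity _ _ _ B eps (Num.max r1 r2)) => // y [Ay _].
  rewrite gt_max => /andP[/(hi _ Ay) hy /gM gy].
  have := green_defect_ge0 ce rho_eq gg (AD _ Ay) => vy.
  have : eta * (h y - log_dist z0 y) <= eta * `|C|.
    by rewrite ler_pM2l// (le_trans hy)// ler_norm.
  have : eps * ln (modulus y) <= eps * (g y + M) by rewrite ler_pM2l.
  rewrite /F /B; lra.
Qed.

(* The barrier [g - log_dist z0 + ln d] has the positive limit [ln d + I] at
   infinity, whereas the defect tends to 0. *)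
Lemma green_defect_far z0 (d : R) : expR (- I) < d ->
  (forall x, e x -> d <= modulus (z0.1 - x, z0.2)) -> v z0 = 0.
Proof.
move=> Id dP; have d0 : 0 < d by rewrite (lt_trans _ Id)// expR_gt0.
have Dz0 : D z0.
  move=> /on_real_axisP[/dP]; move=> + z2; rewrite z2 subrr modulus_real normr0.
  by rewrite leNgt d0.
have [gc gf [M [r2 gM]] _] := gg.
have [B B1 eB] := compact_norm_bound ce; have B0 : 0 < B by lra.
apply/eqP; rewrite eq_le green_defect_ge0// andbT leNgt; apply/negP => v0.
have m0 := modulus_ge0 z0.
pose B' := B + modulus z0; have B'0 : 0 < B' by rewrite /B'; lra.
have [] := @defect_barrier D (fun z => g z + ln d) z0
  (M + ln d + ln 2) (Num.max r2 (2 * B')) (open_off_axis ce) _ Dz0 v0.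
- by [].
- by move=> z Dz; apply: cvgD; [exact: gc|exact: cvg_cst].
- by move=> z Dz; apply: flat_atD; [exact: gf|exact: flat_at_cst].
- move=> z nDz eps e0.
  have [ez z2] := (on_real_axisP _ _).1 (contrapT nDz).
  have zz0 : z != z0 by apply/eqP => zz0; rewrite zz0 in nDz.
  have lz : ln d <= log_dist z0 z.
    rewrite /log_dist log_modE ler_ln ?posrE//.
      have -> : modulus (z.1 - z0.1, z.2 - z0.2) = modulus (z0.1 - z.1, z0.2).
        by rewrite /modulus/= z2 sub0r sqrrN -[in LHS](opprB z0.1) sqrrN.
      exact: dP.
    by apply: modulus_gt0; rewrite xpair_eqE !subr_eq0 -xpair_eqE -!surjective_pairing.
  have lz' : ln d - eps / 2 < log_dist z0 z by lra.
  have n1 : \forall y \near z, ln d - eps / 2 < log_dist z0 y.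
    exact: (cvgr_gt _ (log_dist_continuous zz0) _ lz').
  have e20 : 0 < eps / 2 by rewrite divr_gt0.
  have n2 := green_like_boundary gg nDz e20.
  apply: (@filterS _ (nbhs z) _ _ _ _ (filterI n1 n2)) => y [y1 y2] Dy.
  by have := y2 Dy; have := ler_norm (g y); lra.
- move=> z Dz; rewrite gt_max => /andP[/gM]; rewrite ler_norml => /andP[h1 h2] zB.
  have : ln (modulus z - modulus z0) <= log_dist z0 z.
    by apply: log_dist_ge; rewrite /B' in zB; lra.
  have : ln (modulus z) - ln 2 <= ln (modulus z - B') by apply: ln_sub_ge.
  have : ln (modulus z - B') <= ln (modulus z - modulus z0).
    by rewrite ler_ln ?posrE /B'; rewrite /B' in zB; lra.
  lra.
move=> r [eta [r0 eta0 HF]].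
pose a := ln d + I.
have a0 : 0 < a.
  have : ln (expR (- I)) < ln d by rewrite ltr_ln ?posrE ?expR_gt0.
  by rewrite expRK /a; lra.
pose K := 2 * B + eta * 2 * B'.
have K0 : 0 < K by rewrite /K addr_gt0// ?mulr_gt0.
(* Far enough along the axis that the limit [eta * a] of the barrier outweighs both its own error
   and the bound on the defect, each a constant over [m - B]. *)
pose m := B' + r + 2 * K / (eta * a).
have k0 : 0 < 2 * K / (eta * a) by rewrite divr_gt0 ?mulr_gt0.
have mz : modulus (m, 0 : R) = m by rewrite modulus_real gtr0_norm// /m; lra.
have Dm : D (m, 0).
  by move=> /on_real_axisP[/eB/= + _]; rewrite gtr0_norm /m /B' in B'0 *; lra.
have mB : B < modulus (m, 0 : R) by rewrite mz /m /B' in B'0 *; lra.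
have mr : r < modulus ((m, 0 : R).1 - z0.1, (m, 0 : R).2 - z0.2).
  by have := modulusB_ge (m, 0) z0; rewrite mz /m /B'; lra.
have H1 := HF _ Dm mr.
have H2 := green_defect_le ce rho_eq gg eB B0 Dm mB.
have H3 := robin_le_green ce rho_eq gg eB B0 Dm mB.
have H4 : log_dist z0 (m, 0) <= ln (m + modulus z0).
  rewrite -[X in X + _]mz; apply: log_dist_le; last by rewrite mz /m; lra.
  apply/eqP => zm; move: mr; rewrite zm !subrr modulus_real normr0; lra.
rewrite mz in H2 H3.
have H5 : ln (m + modulus z0) - ln (m - B) <= B' / (m - B).
  have -> : B' = modulus z0 + B by rewrite /B' addrC.
  by apply: ln_ratio_le => //; rewrite ?(ltW B0)// -mz.
have mB' : 0 < m - B by rewrite -mz subr_gt0.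
have : eta * (a - B' / (m - B)) <= 2 * B / (m - B).
  apply: (le_trans _ H2); apply: (le_trans _ H1).
  by rewrite ler_pM2l// /a; lra.
rewrite ler_pdivlMr// -mulrA mulrBl divfK ?gt_eqF// mulrBr leNgt => /negP; apply.
have : 2 * K < eta * a * (m - B).
  rewrite -ltr_pdivrMl ?mulr_gt0// mulrC /m /B'; lra.
rewrite /K mulrA; nra.
Qed.

End Comparison.
End GreenIdentity.

(** * The Green function equals the potential plus Robin's constant *)

Section GreenConclusion.
Context {R : realType}.
Local Notation plane := (R * R)%type.
Local Notation T := (measurableTypeR R).
Implicit Types (z p : plane).

Lemma near_upper z (P : plane -> Prop) : (\forall y \near z, P y) ->
  exists2 t : R, 0 < t & P (z.1, z.2 + t).
Proof.
move=> /nbhs_ballP[d /= d0 dP]; have d2 : 0 < d / 2 by rewrite divr_gt0.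
exists (d / 2) => //; apply: dP; split; rewrite /ball/=.
  by rewrite subrr normr0.
by rewrite opprD addNKr normrN gtr0_norm// ltr_pdivrMr// ltr_pMr// ltr1n.
Qed.

(** A subset of the axis has no interior point in the plane. Each of its points is thus in the outer
    boundary, where regularity gives the boundary value 0. *)
Lemma is_green_green_like (e : set R) (g : plane -> R) :
  dirichlet_regular (on_real_axis e) -> is_green (on_real_axis e) g ->
  compact e -> green_like e g.
Proof.
move=> reg [gh _ [M [r gM]] g0] ce.
have oD := open_off_axis ce; split.
- by move=> z Dz; exact: harmonic_continuous oD gh _ Dz.
- by move=> z Dz; exact: harmonic_flat oD gh _ Dz.
- by exists M, r.
- move=> x ex eps e0.
  have ob : outer_boundary (on_real_axis e) (x, 0).
    split; first by exists x.
    move=> B /near_upper[t t0 Bt]; exists (x, 0 + t); split=> //.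
    by apply: off_axis_upper; rewrite /= add0r.
  have := cvgr_norm_le _ (g0 _ ob (reg _ ob)); rewrite normr0 => /(_ _ _ e0).
  by rewrite near_withinE; apply.
Qed.

Section Upper.
Context (e : set R) (rho : probability T R) (g : plane -> R).
Context (ce : compact e) (rho_eq : is_equilibrium_measure e rho).
Context (gg : green_like e g).

(* The barrier is the Green function with pole [z0] of the half plane bounded by
   the bisector of [z0] and its projection on the axis; it is positive high above
   the axis, where the defect vanishes. *)
Lemma green_defect_upper z0 : 0 < z0.2 -> green_defect e rho g z0 = 0.
Proof.
move=> y0; have Dz0 := @off_axis_upper _ e _ y0.
apply/eqP; rewrite eq_le green_defect_ge0// andbT leNgt; apply/negP => v0.
pose p : plane := (z0.1, 0).
pose A : set plane := snd @^-1` [set t : R | t > z0.2 / 2].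
have p0 := modulus_ge0 p; have m0 := modulus_ge0 z0.
have Ap z : A z -> z != p.
  move=> Az; apply/eqP => zp; move: Az; rewrite zp /A/=; lra.
have dist z : z.2 = z0.2 / 2 -> log_dist p z = log_dist z0 z.
  move=> z2; rewrite /log_dist /log_mod z2/=.
  have -> : z0.2 / 2 - z0.2 = - (z0.2 / 2 - 0) by lra.
  by rewrite sqrrN.
have [] := @defect_barrier _ e rho g ce rho_eq gg A (log_dist p) z0
  (modulus p + modulus z0) (modulus z0 + 1) _ _ _ v0.
- by apply: open_comp; [move=> y _; exact: cvg_snd|exact: open_gt].
- by move=> y Ay; apply: off_axis_upper; rewrite (lt_trans _ Ay)// divr_gt0.
- by rewrite /A/=; lra.
- by move=> y Ay; apply: log_dist_continuous; exact: Ap.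
- by move=> y Ay; apply: log_dist_flat; exact: Ap.
- move=> z nAz eps e0; have : z.2 <= z0.2 / 2 by rewrite leNgt; apply/negP.
  rewrite le_eqVlt => /orP[/eqP z2|z2]; last first.
    have : \forall y \near z, y.2 < z0.2 / 2 by exact: (cvgr_lt _ (@cvg_snd _ _ (nbhs z.1) (nbhs z.2) _) _ z2).
    apply: (@filterS _ (nbhs z) _) => y yz Ay; move: Ay; rewrite /A/=; lra.
  have zz0 : z != z0 by apply/eqP => zE; rewrite zE in z2; lra.
  have zp : z != p by apply/eqP => zE; rewrite zE /= in z2; lra.
  have cF : {for z, continuous (fun y => log_dist p y - log_dist z0 y)}.
    by apply: cvgB; exact: log_dist_continuous.
  have F0 : log_dist p z - log_dist z0 z < eps by rewrite dist// subrr.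
  have : \forall y \near z, log_dist p y - log_dist z0 y < eps.
    exact: (cvgr_lt _ cF _ F0).
  by apply: (@filterS _ (nbhs z) _) => y /ltW.
- move=> z Az zm.
  have h1 : log_dist p z <= ln (modulus z + modulus p).
    by apply: log_dist_le; [rewrite eq_sym; exact: Ap|lra].
  have h2 : ln (modulus z - modulus z0) <= log_dist z0 z by apply: log_dist_ge; lra.
  have h3 := ln_ratio_le p0 m0 (lt_trans (ltr_pwDr ltr01 (lexx _)) zm).
  apply: (@le_trans _ _ ((modulus p + modulus z0) / (modulus z - modulus z0))).
    lra.
  by rewrite ler_pdivrMr ?ler_peMr//; lra.
move=> r [eta [r0 eta0 HF]].
(* At this height the distance to the set exceeds [expR (- I)], so the defect vanishes, while the
   point is outside the disc around [z0] and the barrier is positive. *)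
pose Y := z0.2 + r + expR (- robin e rho) + 1.
have I0 : 0 < expR (- robin e rho) by rewrite expR_gt0.
have Y0 : 0 < Y by rewrite /Y; lra.
have vert t : 0 < t -> modulus (0 : R, t) = t.
  by move=> t0; rewrite /modulus/= expr0n add0r sqrtr_sqr gtr0_norm.
have AY : A (z0.1, Y) by rewrite /A/= /Y; lra.
have YY : 0 < Y - z0.2 by rewrite /Y; lra.
have rY : r < modulus ((z0.1, Y).1 - z0.1, (z0.1, Y).2 - z0.2).
  by rewrite /= subrr vert// /Y; lra.
have := HF _ AY rY.
rewrite (@green_defect_far _ e rho g ce rho_eq gg (z0.1, Y) Y); last 2 first.
- by rewrite /Y; lra.
- move=> x _; have := modulus_ge_snd (z0.1 - x, Y).
  by rewrite /= gtr0_norm.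
rewrite pmulr_rle0// /log_dist !log_modE /= subrr subr0 !vert// leNgt => /negP; apply.
by rewrite subr_gt0 ltr_ln ?posrE//; lra.
Qed.

End Upper.

Section Conclusion.
Context (e : set R) (rho : probability T R) (g : plane -> R).
Context (ce : compact e) (rho_eq : is_equilibrium_measure e rho).
Context (gg : green_like e g).

(** Below the axis the identity follows by reflection; on the axis off the set it follows by
    continuity from above. *)
Lemma green_eq_potential z : ~ on_real_axis e z ->
  g z = potential e rho z + robin e rho.
Proof.
move=> Dz; apply/esym/eqP; rewrite -subr_eq0; change (green_defect e rho g z == 0).
case: (ltgtP z.2 0) => z2.
- have := @green_defect_upper e rho _ ce rho_eq (green_like_conj gg) (z.1, - z.2).
  rewrite oppr_gt0 => /(_ z2); rewrite /green_defect potential_conj//= opprK.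
  by rewrite -surjective_pairing => /eqP.
- by apply/eqP; exact: green_defect_upper.
rewrite eq_le green_defect_ge0// andbT leNgt; apply/negP => v0.
have : \forall y \near z, 0 < green_defect e rho g y.
  exact: (cvgr_gt _ (green_defect_continuous ce rho_eq gg Dz) _ v0).
move=> /near_upper[t t0]; rewrite green_defect_upper ?ltxx//=.
by rewrite z2 add0r.
Qed.

(** On the vertical line through [x] the potential is smallest on the axis, and above the axis it
    equals [g - I], where [g] tends to 0. *)
Lemma potential_on_set x : e x -> potential e rho (x, 0) = - robin e rho.
Proof.
move=> ex; apply/eqP; rewrite eq_le potential_ge// andbT.
have [_ _ _ g0] := gg; apply/ler_addgt0Pr => eps e0.
have [t t0] := near_upper (g0 _ ex _ e0).
have Dt : ~ on_real_axis e (x, 0 + t) by apply: off_axis_upper; rewrite /= add0r.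
move=> /(_ Dt); rewrite green_eq_potential//= => ht.
have := potential_fst_le ce rho_eq (x, 0 + t).
by rewrite /=; have := ler_norm (potential e rho (x, 0 + t) + robin e rho); lra.
Qed.

End Conclusion.
End GreenConclusion.

(** * Alternation *)

Section ExtremalNodes.
Context {R : realType} (n : nat).
Implicit Types (x : 'I_n.+1 -> R) (q : {poly R}) (e : set R).

Definition nodal x k : R := \prod_(i < n.+1 | i != k) `|x k - x i|.
(* The inverse of the minimum of [max |P / q|] over the nodes [x], for [P] monic
   of degree [n]. *)
Definition node_cost q x : R := \sum_(k < n.+1) q.[x k] / nodal x k.

Lemma nodal_ge0 x k : 0 <= nodal x k.
Proof. by apply: prodr_ge0. Qed.

Lemma nodal_gt0 x k : injective x -> 0 < nodal x k.
Proof.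
by move=> xi; apply: prodr_gt0 => i ik; rewrite normr_gt0 subr_eq0 (inj_eq xi) eq_sym.
Qed.

Lemma nodal_continuous k : continuous (fun v : 'rV[R]_n.+1 => nodal (v ord0) k).
Proof.
have h i : i != k -> continuous (fun v : 'rV[R]_n.+1 => `|v ord0 k - v ord0 i|).
  have c j : continuous (fun v : 'rV[R]_n.+1 => v ord0 j) by exact: coord_continuous.
  by move=> _ v; exact: cvg_norm (cvgB (c k v) (c i v)).
have hm : continuous (fun z : R * R => z.1 * z.2) by exact: mul_continuous.
exact: (@continuous_big R _ *%R 1 (fun i => i != k) hm _ _ _ h).
Qed.

(** Injective tuples do not form a compact set. Those that cost at most [c] satisfy [q.[v k] <= c *
    nodal v k] for all [k]; this condition is closed, and it keeps the nodes apart since [q] is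
    positive on the set. *)
Lemma optimal_nodes e q x0 : compact e -> (forall y : R, e y -> 0 < q.[y]) ->
  (forall i, e (x0 i)) -> injective x0 ->
  exists x, [/\ forall i, e (x i), injective x & forall y,
    (forall i, e (y i)) -> injective y -> node_cost q x <= node_cost q y].
Proof.
move=> ce q0 ex0 x0i; pose c := node_cost q x0.
have costge y k : (forall i, e (y i)) -> injective y -> q.[y k] / nodal y k <= node_cost q y.
  move=> ey yi; rewrite /node_cost (bigD1 k)//= lerDl sumr_ge0// => i _.
  by rewrite divr_ge0 ?nodal_ge0// ltW// q0.
have c0 : 0 <= c.
  by apply: sumr_ge0 => i _; rewrite divr_ge0 ?nodal_ge0// ltW// q0.
have qc k : continuous (fun v : 'rV[R]_n.+1 => q.[v ord0 k]).
  move=> v; apply: (@continuous_comp _ _ _ (fun v : 'rV[R]_n.+1 => v ord0 k)).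
    exact: coord_continuous.
  exact: continuous_horner.
pose A : set 'rV[R]_n.+1 := [set v | forall i, e (v ord0 i)].
pose B k : set 'rV[R]_n.+1 :=
  (fun v : 'rV[R]_n.+1 => c * nodal (v ord0) k - q.[v ord0 k]) @^-1` [set t | 0 <= t].
pose K := A `&` \bigcap_(k in setT) B k.
have cK : compact K.
  apply: compact_closedI; first exact: (rV_compact (fun=> ce)).
  apply: closed_bigI => k _; apply: closed_comp => [v _|]; last exact: closed_ge.
  have hn : {for v, continuous (fun u : 'rV[R]_n.+1 => c * nodal (u ord0) k)}.
    exact: (continuousM (@cst_continuous _ _ c v) (@nodal_continuous k v)).
  exact: (continuousB hn (qc k v)).
have inK y : (forall i, e (y i)) -> injective y -> node_cost q y <= c ->
    K (\row_i y i).
  move=> ey yi yc; split=> [i|k _]; first by rewrite mxE.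
  rewrite /B/= mxE; have -> : (\row_i y i) ord0 = y by apply/funext => i; rewrite mxE.
  by rewrite subr_ge0 -ler_pdivrMr ?nodal_gt0// (le_trans (costge _ _ _ _)).
have Kpos v k : K v -> 0 < nodal (v ord0) k.
  move=> [Av /(_ k I)]; rewrite /B/= subr_ge0 => h.
  rewrite lt_neqAle nodal_ge0 andbT eq_sym; apply/eqP => z.
  by move: h; rewrite z mulr0 leNgt q0.
have Kinj v : K v -> injective (v ord0).
  move=> Kv i j vij; apply/eqP; apply: contraT => ij.
  have := Kpos _ j Kv; rewrite /nodal (bigD1 i)//= vij subrr normr0 mul0r.
  by rewrite ltxx.
have cf : {within K, continuous (fun v : 'rV[R]_n.+1 => node_cost q (v ord0))}.
  apply: continuous_in_subspaceT => v /set_mem Kv.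
  have hp : continuous (fun z : R * R => z.1 + z.2) by exact: add_continuous.
  apply: (@cvg_big R _ +%R 0 predT hp _ (nbhs v)) => k _; apply: cvgM.
    exact: qc.
  by apply: cvgV; [rewrite gt_eqF// Kpos|exact: nodal_continuous].
have K0 : K !=set0 by exists (\row_i x0 i); apply: inK.
have [v /set_mem Kv vmin] := compact_EVT_min K0 cK cf.
have rowE y : (\row_i y i) ord0 = y by apply/funext => i; rewrite mxE.
exists (v ord0); split; [by case: Kv|exact: Kinj|move=> y ey yi].
have vc : node_cost q (v ord0) <= c.
  by have := vmin (\row_i x0 i) (mem_set (inK _ ex0 x0i (lexx _))); rewrite rowE.
have [yc|/ltW cy] := leP (node_cost q y) c; last exact: (le_trans vc).
by have := vmin (\row_i y i) (mem_set (inK _ ey yi yc)); rewrite rowE.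
Qed.

Section Exchange.
Context (e : set R) (q : {poly R}) (x : 'I_n.+1 -> R).
Context (q0 : forall y, e y -> 0 < q.[y]) (ex : forall i, e (x i)).
Context (xi : injective x).
Context (xmin : forall y, (forall i, e (y i)) -> injective y ->
  node_cost q x <= node_cost q y).

Local Notation A := (fun j => q.[x j] / nodal x j).

(* Minimality against the nodes where [x k] is replaced with [y]; the hypothesis
   on [k] holds when [x k] is the nearest node on either side of [y]. *)
Lemma exchange y k : e y -> (forall i, y != x i) ->
  (forall j, 1 - `|x j - x k| / `|x j - y| = (y - x k) / (y - x j)) ->
  (y - x k) * \sum_j A j / (y - x j) <=
    q.[y] * `|y - x k| / \prod_j `|y - x j|.
Proof.
move=> ey yx kP; pose x' i := if i == k then y else x i.
have x'i : injective x'.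
  move=> i j; rewrite /x'; case: eqP => [->|_]; case: eqP => [->|_]//.
  - by move=> h; have := yx j; rewrite h eqxx.
  - by move=> h; have := yx i; rewrite h eqxx.
  - exact: xi.
have ex' i : e (x' i) by rewrite /x'; case: eqP.
have := xmin ex' x'i; rewrite {2}/node_cost (bigD1 k)//=.
have -> : nodal x' k = (\prod_j `|y - x j|) / `|y - x k|.
  rewrite (bigD1 k)//= mulrAC mulfV ?mul1r; last by rewrite normr_eq0 subr_eq0 yx.
  by rewrite /nodal /x' eqxx; apply: eq_bigr => i /negPf ->.
have -> : \sum_(i < n.+1 | i != k) q.[x' i] / nodal x' i =
    \sum_(i < n.+1) A i * (`|x i - x k| / `|x i - y|).
  rewrite [RHS](bigD1 k)//= subrr normr0 mul0r mulr0 add0r.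
  apply: eq_bigr => i ik; rewrite {1}/x' (negPf ik) -mulrA; congr (_ * _).
  have xik : `|x i - x k| != 0 by rewrite normr_eq0 subr_eq0 (inj_eq xi).
  have xiy : `|x i - y| != 0 by rewrite normr_eq0 subr_eq0 eq_sym yx.
  rewrite /nodal [in LHS](bigD1 k) 1?eq_sym//= [in RHS](bigD1 k) 1?eq_sym//=.
  rewrite !invfM [RHS]mulrACA mulVf// mul1r [RHS]mulrC.
  congr (_^-1 * _^-1); first by rewrite /x' (negPf ik) eqxx.
  by apply: eq_bigr => j /andP[_ /negPf jk]; rewrite /x' jk (negPf ik).
have -> : x' k = y by rewrite /x' eqxx.
rewrite invf_div mulrA -lerBlDr; apply: le_trans; apply/le_of_eq.
rewrite /node_cost -sumrB mulr_sumr; apply: eq_bigr => j _.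
transitivity (A j * (1 - `|x j - x k| / `|x j - y|)); first by rewrite kP; ring.
by rewrite mulrBr mulr1.
Qed.

(** The nearest node on the right of [y] bounds the sum from below and the nearest one on the left
    bounds it from above. When there is no node on the side in question, the sign of the sum is
    enough. *)
Lemma exchange_le y : e y -> (forall i, y != x i) ->
  (\prod_j `|y - x j|) * `|\sum_j A j / (y - x j)| <= q.[y].
Proof.
move=> ey yx; set w := \prod_j _; set S := \sum_j _.
have w0 : 0 < w by apply: prodr_gt0 => i _; rewrite normr_gt0 subr_eq0.
have Apos j : 0 < A j by rewrite divr_gt0 ?nodal_gt0// q0.
have A0 j : 0 <= A j by rewrite ltW.
have qy := q0 ey.
have side j : y - x j != 0 by rewrite subr_eq0 yx.
rewrite -[w](gtr0_norm w0) -normrM ler_norml; apply/andP; split.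
- have [/existsP[j jy]|/existsPn none] := boolP [exists j, y < x j]; last first.
    rewrite (@le_trans _ _ 0) ?oppr_le0 ?(ltW qy)// mulr_ge0 ?(ltW w0)// sumr_ge0// => j _.
    by rewrite divr_ge0// subr_ge0 leNgt none.
  pose k := [arg min_(k < j | y < x k) x k]%O.
  have [yk kmin] : y < x k /\ forall i, y < x i -> x k <= x i.
    by rewrite /k; case: arg_minP.
  have := @exchange y k ey yx; rewrite -/w -/S => /(_ _)/=.
  have kP j' : 1 - `|x j' - x k| / `|x j' - y| = (y - x k) / (y - x j').
    have yj := side j'; have yj2 : x j' - y != 0 by rewrite -opprB oppr_eq0.
    case: (ltgtP y (x j')) => h; last by rewrite h subrr eqxx in yj.
    - have hk := kmin _ h; rewrite !ger0_norm ?subr_ge0 ?(ltW h)//.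
      by field; rewrite yj yj2.
    - have hk : x j' <= x k by rewrite ltW// (lt_trans h).
      rewrite !ler0_norm ?subr_le0 ?(ltW h)//.
      by field; rewrite yj yj2.
  move=> /(_ kP); rewrite ltr0_norm ?subr_lt0// ler_pdivlMr//.
  have yk0 : 0 < x k - y by rewrite subr_gt0.
  have -> : (y - x k) * S * w = (x k - y) * - (w * S) by ring.
  by rewrite opprB [leRHS]mulrC ler_pM2l// lerNl.
- have [/existsP[j jy]|/existsPn none] := boolP [exists j, x j < y]; last first.
    rewrite (@le_trans _ _ 0) ?(ltW qy)// mulr_ge0_le0 ?(ltW w0)// sumr_le0// => j _.
    by rewrite mulr_ge0_le0// invr_le0 subr_le0 leNgt none.
  pose k := [arg max_(k > j | x k < y) x k]%O.
  have [yk kmax] : x k < y /\ forall i, x i < y -> x i <= x k.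
    by rewrite /k; case: arg_maxP.
  have := @exchange y k ey yx; rewrite -/w -/S => /(_ _)/=.
  have kP j' : 1 - `|x j' - x k| / `|x j' - y| = (y - x k) / (y - x j').
    have yj := side j'; have yj2 : x j' - y != 0 by rewrite -opprB oppr_eq0.
    case: (ltgtP y (x j')) => h; last by rewrite h subrr eqxx in yj.
    - have hk : x k <= x j' by rewrite ltW// (lt_trans yk).
      rewrite !ger0_norm ?subr_ge0 ?(ltW h)//.
      by field; rewrite yj yj2.
    - have hk := kmax _ h; rewrite !ler0_norm ?subr_le0 ?(ltW h)//.
      by field; rewrite yj yj2.
  move=> /(_ kP); rewrite gtr0_norm ?subr_gt0// mulrAC [leRHS]mulrC ler_pM2l ?subr_gt0//.
  by rewrite ler_pdivlMr// mulrC.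
Qed.

End Exchange.
End ExtremalNodes.

(** * Extremal polynomials and their zeros *)

Section Alternation.
Context {R : realType}.
Implicit Types (q P Q : {poly R}) (e : set R) (s : seq R).

(** [P] interpolates [t q], with the signs of the Lagrange denominators, at the optimal nodes; its
    leading coefficient is [t * node_cost q x = 1]. Elsewhere [P.[y]] is [t] times the node
    polynomial times the sum of [exchange_le], so optimality of the nodes carries the bound over to
    the whole set. *)
Lemma extremal_polynomial (n : nat) e q (x0 : 'I_n.+1 -> R) :
  compact e -> (forall y : R, e y -> 0 < q.[y]) ->
  (forall i, e (x0 i)) -> injective x0 ->
  exists P t (x : 'I_n.+1 -> R), [/\ P \is monic, size P = n.+1, 0 < t &
    forall y, e y -> `|P.[y]| <= t * q.[y]] /\
    [/\ forall i, e (x i), injective x & forall k,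
      P.[x k] = t * q.[x k] * Num.sg (\prod_(i < n.+1 | i != k) (x k - x i))].
Proof.
move=> ce q0 ex0 x0i; have [x [ex xi xmin]] := optimal_nodes ce q0 ex0 x0i.
pose A j := q.[x j] / nodal x j.
have A0 j : 0 < A j by rewrite divr_gt0 ?nodal_gt0// q0.
have c0 : 0 < node_cost q x.
  rewrite /node_cost (bigD1 ord0)//= ltr_pwDl//; first exact: A0.
  by apply: sumr_ge0 => j _; exact: ltW (A0 j).
pose t := (node_cost q x)^-1; have t0 : 0 < t by rewrite invr_gt0.
pose N j : {poly R} := \prod_(i < n.+1 | i != j) ('X - (x i)%:P).
have Nm j : N j \is monic by exact: monic_prod_XsubC.
have Ns j : size (N j) = n.+1.
  rewrite /N -big_filter size_prod_XsubC -[size _]count_predT count_filter/=.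
  rewrite (@eq_count _ _ (predC1 j)) //.
  have := count_predC (pred1 j) (index_enum 'I_n.+1).
  rewrite (count_uniq_mem _ (index_enum_uniq _)) mem_index_enum add1n.
  by rewrite [size _](_ : _ = n.+1) => [[->]//|]; rewrite -[RHS]card_ord cardT enumT.
pose P := t *: \sum_j A j *: N j.
have Psz : (size P <= n.+1)%N.
  rewrite (leq_trans (size_scale_leq _ _))// (leq_trans (size_sum _ _ _))//.
  by apply/bigmax_leqP => j _; rewrite (leq_trans (size_scale_leq _ _))// Ns.
have Pn : P`_n = 1.
  rewrite coefZ coef_sum (eq_bigr A) => [|j _].
    by rewrite /t mulVf// gt_eqF.
  rewrite coefZ; have /monicP := Nm j; rewrite lead_coefE Ns/= => ->.
  by rewrite mulr1.
have Ps : size P = n.+1.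
  apply/eqP; rewrite eqn_leq Psz/= ltnNge; apply/negP => /leq_sizeP/(_ _ (leqnn n)).
  by rewrite Pn => /eqP; rewrite oner_eq0.
have Ny y j : (N j).[y] = \prod_(i < n.+1 | i != j) (y - x i).
  by rewrite horner_prod; apply: eq_bigr => i _; rewrite hornerXsubC.
have Py y : P.[y] = t * \sum_j A j * (N j).[y].
  by rewrite hornerZ horner_sum; congr (_ * _); apply: eq_bigr => j _; rewrite hornerZ.
have Pk k : P.[x k] = t * q.[x k] * Num.sg (\prod_(i < n.+1 | i != k) (x k - x i)).
  rewrite Py (bigD1 k)//= big1 ?addr0 => [|j jk]; last first.
    by rewrite Ny (bigD1 k) 1?eq_sym//= subrr mul0r mulr0.
  rewrite Ny -mulrA; congr (_ * _); set p := (X in _ * X).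
  rewrite {1}/A; have -> : nodal x k = `|p| by rewrite /p normr_prod.
  have p0 : `|p| != 0.
    by have := nodal_gt0 k xi; rewrite /nodal -normr_prod => /gt_eqF ->.
  by rewrite [X in _ * X](numEsg p) mulrCA divfK// mulrC.
exists P, t, x; split; split=> //.
- by rewrite monicE lead_coefE Ps Pn.
- move=> y ey.
  have [/existsP[k /eqP ->]|/existsPn none] := boolP [exists k, y == x k].
    have qk : 0 < t * q.[x k] by rewrite mulr_gt0// q0.
    rewrite Pk normrM (gtr0_norm qk) normr_sg.
    by rewrite ler_piMr ?(ltW qk)//; case: (_ != 0).
  rewrite Py normrM gtr0_norm// ler_pM2l//.
  apply: le_trans (exchange_le q0 ex xi xmin ey none).
  rewrite -[\prod_j `|_|]normr_prod -normrM mulr_sumr; apply/le_of_eq; congr (`|_|).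
  apply: eq_bigr => j _; rewrite Ny [in RHS](bigD1 j)//=.
  have yj : y - x j != 0 by rewrite subr_eq0.
  by rewrite /A; field; rewrite yj gt_eqF// nodal_gt0.
Qed.

Lemma alternating_polynomial (n : nat) e q (x0 : 'I_n.+1 -> R) :
  compact e -> (forall y : R, e y -> 0 < q.[y]) ->
  (forall i, e (x0 i)) -> injective x0 ->
  exists P t s, [/\ P \is monic, size P = n.+1, 0 < t &
    forall y, e y -> `|P.[y]| <= t * q.[y]] /\
    [/\ size s = n.+1, forall i j, (i < j < n.+1)%N -> s`_i < s`_j,
      forall k, (k < n.+1)%N -> e s`_k /\ `|P.[s`_k]| = t * q.[s`_k] &
      forall k, (k < n)%N -> P.[s`_k] * P.[s`_k.+1] < 0].
Proof.
move=> ce q0 ex0 x0i.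
have [P [t [x [[Pm Ps t0 Pe] [ex xi Pk]]]]] := extremal_polynomial ce q0 ex0 x0i.
pose s := sort <=%R (codom x).
have ss : size s = n.+1 by rewrite size_sort size_codom card_ord.
have su : uniq s by rewrite sort_uniq; apply/injectiveP.
have slt i j : (i < j < n.+1)%N -> s`_i < s`_j.
  move=> /andP[ij jn].
  have lt : sorted <%R s by rewrite lt_sorted_uniq_le su sort_le_sorted.
  have := lt_sorted_ltn_nth 0 lt; rewrite /= => -> //; rewrite !inE ss//.
  exact: ltn_trans jn.
have smem k : (k < n.+1)%N -> exists i, s`_k = x i.
  move=> kn; have : s`_k \in s by rewrite mem_nth// ss.
  by rewrite mem_sort => /mapP[i _]; exists i.
have xmem i : exists2 k, (k < n.+1)%N & x i = s`_k.
  have : x i \in s by rewrite mem_sort codom_f.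
  by move=> /(nthP 0)[k]; rewrite ss => kn <-; exists k.
exists P, t, s; split; split=> //.
- move=> k /smem[i ->]; split; first exact: ex.
  have p0 : \prod_(l < n.+1 | l != i) (x i - x l) != 0.
    by apply/prodf_neq0 => l li; rewrite subr_eq0 (inj_eq xi) eq_sym.
  rewrite Pk !normrM normr_sg p0 mulr1 !gtr0_norm//; exact: q0.
- move=> k kn; have [i si] := smem k (ltnW kn); have [j sj] := smem k.+1 kn.
  have lt_ij : x i < x j by rewrite -si -sj slt// ltnSn.
  have ij : i != j by apply/eqP => ij; rewrite ij ltxx in lt_ij.
  rewrite si sj !Pk (bigD1 j) 1?eq_sym//= [in X in _ * X](bigD1 i)//=.
  set p1 := \prod_(_ < _ | _) _; set p2 := \prod_(_ < _ | _) _.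
  (* Every other node lies on the same side of both neighbours, so the factors pair up into positive
     products; only the mutual factors [x i - x j] and [x j - x i] differ in sign. *)
  have p12 : 0 < p1 * p2.
    have -> : p2 = \prod_(l < n.+1 | (l != i) && (l != j)) (x j - x l).
      by apply: eq_bigl => l; rewrite andbC.
    rewrite /p1 -big_split/=; apply: prodr_gt0 => l /andP[li lj].
    have [m mn xl] := xmem l; rewrite xl -si -sj.
    have mk : m != k by apply: contraNneq li => mk; rewrite -(inj_eq xi) xl mk si.
    have mk1 : m != k.+1 by apply: contraNneq lj => mk1; rewrite -(inj_eq xi) xl mk1 sj.
    case: (ltngtP m k) => h; last by rewrite h eqxx in mk.
      by rewrite mulr_gt0// subr_gt0 slt// ?h ?(ltn_trans h) ?(ltnW kn)//= ltnS ltnW.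
    have h' : (k.+1 < m)%N by rewrite ltn_neqAle eq_sym mk1.
    by rewrite nmulr_rgt0 subr_lt0 slt// ?h ?h'.
  have -> : t * q.[x i] * Num.sg ((x i - x j) * p1) *
     (t * q.[x j] * Num.sg ((x j - x i) * p2)) =
     (t * q.[x i]) * (t * q.[x j]) * Num.sg (- (x j - x i) ^+ 2 * (p1 * p2)).
    rewrite mulrACA -sgrM; congr (_ * Num.sg _); ring.
  rewrite pmulr_rlt0 ?mulr_gt0 ?q0// sgr_lt0 pmulr_llt0//.
  by rewrite oppr_lt0 exprn_gt0// subr_gt0.
Qed.

Lemma interlacing_roots (n : nat) Q (s : nat -> R) : Q \is monic -> size Q = n.+1 ->
  (forall i j, (i < j < n.+1)%N -> s i < s j) ->
  (forall k, (k < n)%N -> Q.[s k] * Q.[s k.+1] < 0) ->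
  exists2 y : nat -> R, Q = \prod_(k < n) ('X - (y k)%:P) &
    forall k, (k < n)%N -> s k < y k < s k.+1.
Proof.
move=> Qm Qs sl sQ.
have /choice[y yP] k : exists y, (k < n)%N -> s k < y < s k.+1 /\ root Q y.
  have [kn|_] := ltnP k n; last by exists 0.
  have [|y yI yr] := poly_ivtoo _ (sQ _ kn); first by rewrite ltW// sl// ltnSn.
  by exists y => _; split=> //; move: yI; rewrite in_itv.
exists y => [|k /yP[]//].
have mono i j : (i < j < n)%N -> y i < y j.
  move=> /andP[ij jn]; have [/andP[_ h1] _] := yP _ (ltn_trans ij jn).
  have [/andP[h2 _] _] := yP _ jn; apply: (lt_trans h1); apply: (le_lt_trans _ h2).
  move: ij; rewrite leq_eqVlt => /orP[/eqP <-//|ij].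
  by rewrite ltW// sl// ij ltnS ltnW.
have yu : uniq (mkseq y n).
  apply/mkseq_uniqP => i j; rewrite !inE => iN jN yij.
  case: (ltngtP i j) => // h.
    by have := mono i j; rewrite h jN yij ltxx => /(_ isT).
  by have := mono j i; rewrite h iN yij ltxx => /(_ isT).
rewrite [LHS](@all_roots_prod_XsubC _ _ (mkseq y n)).
- by rewrite (monicP Qm) scale1r big_map -[n in iota _ n]subn0 big_mkord.
- by rewrite Qs size_mkseq.
- by apply/allP => z /mapP[k]; rewrite mem_iota add0n => /andP[_ /yP[_]] + ->.
- by rewrite uniq_rootsE.
Qed.

End Alternation.

(** * Critical points and gaps *)

Section GapSum.
Context {R : realType}.
Local Notation plane := (R * R)%type.
Local Notation T := (measurableTypeR R).

Lemma slice_extremum (V : normedModType R) (f : V -> R) (z v : V) (r : R) : 0 < r ->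
  (forall t, `|t| < r -> derivable f (t *: v + z) v) ->
  (forall t, `|t| < r -> f (t *: v + z) <= f z) \/
  (forall t, `|t| < r -> f z <= f (t *: v + z)) -> 'D_v f z = 0.
Proof.
move=> r0 df ext; have z0 : z = 0 *: v + z by rewrite scale0r add0r.
pose s t := f (t *: v + z).
have itv t : t \in `](- r), r[%R -> `|t| < r by rewrite in_itv/= ltr_norml.
have ds t : t \in `](- r), r[%R -> derivable s t 1.
  by move=> /itv/df/is_derive_slice[].
have I0 : 0 \in `](- r), r[%R by rewrite in_itv/= oppr_lt0 r0.
have rr : - r <= r by lra.
have d0 : is_derive (0 : R) 1 s ('D_v f z).
  rewrite [X in 'D_v f X]z0; apply: is_derive_slice; apply: df.
  by rewrite normr0.
have -> : 'D_v f z = 'D_1 s 0 by rewrite derive_val.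
suff [_ ->] : is_derive (0 : R) 1 s 0 by [].
case: ext => h.
  by apply: (derive1_at_max rr ds I0) => t /itv/h; rewrite /s -z0.
by apply: (derive1_at_min rr ds I0) => t /itv/h; rewrite /s -z0.
Qed.

Context (e : set R) (rho : probability T R) (g : plane -> R).
Context (ce : compact e) (rho_eq : is_equilibrium_measure e rho).
Context (gh : Defs.harmonic (~` on_real_axis e) g) (gg : green_like e g).
Local Notation U := (potential e rho).
Local Notation I := (robin e rho).

(** The continuous extension of [g] from the axis off the set to the whole axis, with value 0 on the
    set. *)
Definition axis_green (x : R) : R := U (x, 0) + I.
Local Notation G := axis_green.

Lemma axis_green_on x : e x -> G x = 0.
Proof. by move=> ex; rewrite /axis_green (potential_on_set ce rho_eq gg ex) addNr. Qed.

Lemma off_axisE x : ~ e x -> ~ on_real_axis e (x, 0).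
Proof. by move=> ex /on_real_axisP[]. Qed.

Lemma axis_green_off x : ~ e x -> G x = g (x, 0).
Proof. by move=> /off_axisE ex; rewrite (green_eq_potential ce rho_eq gg ex). Qed.

Lemma axis_embedding_continuous : continuous (fun x : R => ((x, 0) : plane)).
Proof.
move=> x; exact: (cvg_pair (@cvg_id _ (nbhs x)) (@cvg_cst _ (0 : R) _ (nbhs x) _)).
Qed.

Lemma axis_green_continuous : continuous G.
Proof.
move=> x; have [ex|nex] := pselect (e x); last first.
  have [Uc _] := off_axis_potential ce rho_eq (off_axisE nex).
  apply: cvgD; last exact: cvg_cst.
  exact: (continuous_comp (@axis_embedding_continuous x) Uc).
apply/cvgrPdist_le => eps e0; have [_ _ _ g0] := gg.
have := axis_embedding_continuous (g0 _ ex _ e0).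
rewrite /fmap/=; apply: (@filterS _ (nbhs x) _) => y /= hy.
rewrite axis_green_on// sub0r normrN.
have [ey|ney] := pselect (e y); first by rewrite axis_green_on// normr0 ltW.
by rewrite axis_green_off//; apply: hy; exact: off_axisE.
Qed.

(** A positive maximum is attained off the set. There the horizontal derivative vanishes by
    maximality, and the vertical one because the potential is smallest on the axis along each
    vertical line. The interval may contain several gaps and further points of the set. *)
Lemma gap_maximum a b : a <= b -> e a -> e b -> exists2 c : R,
  (forall y, a <= y <= b -> G y <= G c) &
  0 < G c -> [/\ a < c, c < b, critical_points (on_real_axis e) g (c, 0) &
    g (c, 0) = G c].
Proof.
move=> ab ea eb.
have [c cI cmax] := EVT_max ab (continuous_subspaceT axis_green_continuous).
exists c => [y yab|Gc]; first by apply: cmax; rewrite in_itv.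
have nec : ~ e c by move=> ec; move: Gc; rewrite axis_green_on// ltxx.
have neq x : e x -> x != c by move=> ex; apply/eqP => xc; rewrite xc in ex.
move: (cI); rewrite in_itv/= => /andP[ac cb].
have {}ac : a < c by rewrite lt_neqAle neq.
have {}cb : c < b by rewrite lt_neqAle cb andbT eq_sym neq.
have dg z v : ~ on_real_axis e z -> derivable g z v by case/gh => /(_ v v)[].
have oD := open_off_axis ce; have Dc := off_axisE nec.
split=> //; last by rewrite axis_green_off.
split=> //.
- have [d /= d0 dP] := (nbhs_ballP _ _).1 (oD _ Dc).
  pose r := Num.min d (Num.min (c - a) (b - c)).
  have r0 : 0 < r by rewrite !lt_min d0 !subr_gt0 ac cb.
  have E t : t *: (1, 0) + (c, 0) = (c + t, 0) :> plane.
    by rewrite shift_fst.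
  have Dt t : `|t| < r -> ~ on_real_axis e (c + t, 0).
    move=> tr; apply: dP; split; rewrite /ball/=; last by rewrite subrr normr0.
    by rewrite opprD addNKr normrN (lt_le_trans tr)// ge_min lexx.
  apply: (slice_extremum r0) => [t tr|].
    by rewrite E; apply: dg; exact: Dt.
  left=> t tr; rewrite E.
  have net : ~ e (c + t) by move=> et; apply: (Dt _ tr); exists (c + t).
  rewrite -!axis_green_off//; apply: cmax; rewrite in_itv/=.
  move: tr; rewrite !lt_min => /and3P[_ h1 h2].
  have := ler_norm t; have := ler_norm (- t); rewrite normrN; lra.
- have E t : t *: (0, 1) + (c, 0) = (c, 0 + t) :> plane by rewrite shift_snd.
  have Dt t : ~ on_real_axis e (c, 0 + t) by move=> /on_real_axisP[].
  apply: (slice_extremum ltr01) => [t _|].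
    by rewrite E; apply: dg; exact: Dt.
  right=> t _; rewrite E !(green_eq_potential ce rho_eq gg)// lerD2r.
  exact: (potential_fst_le ce rho_eq (c, 0 + t)).
Qed.

(** The maxima of [axis_green] over the intervals between consecutive [s k] dominate its values at
    the [y k]. The positive ones occur at distinct critical points, since the open intervals are
    disjoint; the others contribute at most 0. *)
Lemma gap_sum (n : nat) (s y : nat -> R) (PW : R) :
  (\esum_(z in critical_points (on_real_axis e) g) (g z)%:E <= PW%:E)%E ->
  (forall i j, (i < j < n.+1)%N -> s i < s j) ->
  (forall k, (k < n.+1)%N -> e (s k)) ->
  (forall k, (k < n)%N -> s k < y k < s k.+1) ->
  \sum_(k < n) U (y k, 0) <= PW - n%:R * I.
Proof.
move=> PWg sl se sy.
suff : \sum_(k < n) G (y k) <= PW.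
  by rewrite big_split/= sumr_const card_ord -mulr_natl; lra.
have /choice[c cP] k : exists c, (k < n)%N -> G (y k) <= G c /\
    (0 < G c -> [/\ s k < c, c < s k.+1,
      critical_points (on_real_axis e) g (c, 0) & g (c, 0) = G c]).
  have [kn|_] := ltnP k n; last by exists 0.
  have [|c cm cc] := @gap_maximum (s k) (s k.+1) _ (se k (leqW kn)) (se k.+1 kn).
    by rewrite ltW// sl// ltnSn.
  by exists c => _; split=> //; apply: cm; have /andP[/ltW -> /ltW ->] := sy _ kn.
pose r := [seq k <- iota 0 n | 0 < G (c k)].
have rP k : k \in r -> (k < n)%N /\ 0 < G (c k).
  by rewrite mem_filter mem_iota add0n => /andP[].
apply: (@le_trans _ _ (\sum_(k <- r) G (c k))).
  rewrite -(big_mkord predT (fun k => G (y k))) /index_iota subn0 /r big_filter.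
  rewrite [leRHS]big_mkcond/= big_seq_cond [leRHS]big_seq_cond; apply: ler_sum => k.
  rewrite andbT mem_iota add0n => /andP[_ kn]; have [yc _] := cP _ kn.
  case: ifPn => //; rewrite -leNgt; exact: le_trans.
have mono i j : i \in r -> j \in r -> (i < j)%N -> c i < c j.
  move=> /rP[iN iG] /rP[jN jG] ij.
  have [_ /(_ iG)[_ h1 _ _]] := cP _ iN; have [_ /(_ jG)[h2 _ _ _]] := cP _ jN.
  apply: (lt_trans h1); apply: (le_lt_trans _ h2).
  move: ij; rewrite leq_eqVlt => /orP[/eqP <-//|ij].
  by rewrite ltW// sl// ij ltnS ltnW.
pose X : seq plane := [seq (c k, 0) | k <- r].
have Xu : uniq X.
  rewrite map_inj_in_uniq ?filter_uniq ?iota_uniq// => i j ir jr [cij].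
  case: (ltngtP i j) => // h.
    by have := mono _ _ ir jr h; rewrite cij ltxx.
  by have := mono _ _ jr ir h; rewrite cij ltxx.
rewrite -lee_fin; apply: le_trans PWg; apply: esum_ge; exists [set` X].
  split; first exact: finite_seq.
  by move=> z /mapP[k /rP[kn kG] ->]; have [_ /(_ kG)[]] := cP _ kn.
rewrite -fsbig_seq// big_map -sumEFin big_seq_cond [leRHS]big_seq_cond.
apply: lee_sum => k; rewrite andbT => /rP[kn kG].
by have [_ /(_ kG)[_ _ _ ->]] := cP _ kn.
Qed.

End GapSum.

(** * Upper bounds for Widom factors *)

Section LevelChoice.
Context {R : realType}.
Local Notation T := (measurableTypeR R).

Definition layer (v : R) (k : nat) : set T := `]v - 2 ^- k, v + 2 ^- k[%classic.

Lemma layerP (v c : R) k : layer v k c <-> `|c - v| < 2 ^- k.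
Proof. by rewrite /layer/= in_itv/= -ltr_distl. Qed.

(** The sum counts the dyadic scales exceeding [|c - v|], each of which adds [ln 2 <= 1] to the
    logarithm. In this form the integral over [c] becomes a geometric series. *)
Lemma log_kernel_le_layers (v c : R) :
  (log_kernel 1 (c, v) <= 1 + \sum_(0 <= k <oo) (\1_(layer v k) c : R)%:E)%E.
Proof.
set S := (X in (_ <= _ + X)%E).
have f0 (k : nat) : (0 <= (\1_(layer v k) c : R)%:E :> \bar R)%E by rewrite lee_fin.
have SN N : (forall k, (k < N)%N -> `|c - v| < 2 ^- k) -> (N%:R%:E <= S)%E.
  move=> h; apply: (@le_trans _ _ (\sum_(0 <= k < N) (\1_(layer v k) c : R)%:E)%E).
    rewrite sumEFin lee_fin (eq_big_nat _ _ (F2 := fun=> 1)).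
      by rewrite big_const_nat iter_addr_0 subn0.
    by move=> k /andP[_ /h]; rewrite indicE => /layerP/mem_set ->.
  by apply: nneseries_lim_ge => k _ _.
have [cv|cv] := eqVneq c v.
  suff -> : S = +oo%E by rewrite leey.
  apply: eq_infty => t; apply: (@le_trans _ _ (Num.truncn `|t|).+1%:R%:E).
    by rewrite lee_fin (le_trans (ler_norm t))// ltW// truncnS_gt.
  by apply: SN => k _; rewrite cv subrr normr0 invr_gt0 exprn_gt0.
have c0 : 0 < `|c - v| by rewrite normr_gt0 subr_eq0.
rewrite log_kernel_pos//; set s := `|c - v| in c0 SN *.
have S0 : (0 <= S)%E by apply: nneseries_ge0 => k _ _; exact: f0.
rewrite EFin_max ge_max; apply/andP; split; first exact: adde_ge0.
rewrite EFinB leeD2l//.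
have [s1|s1] := leP 1 s.
  by apply: (le_trans _ S0); rewrite lee_fin oppr_le0 ln_ge0.
have ex : exists N, 2 ^- N <= s.
  exists (Num.truncn (s^-1)).+1; rewrite invf_ple ?posrE ?exprn_gt0//.
  have : s^-1 < (Num.truncn (s^-1)).+1%:R by exact: truncnS_gt.
  move=> /ltW/le_trans; apply; rewrite -natrX ler_nat.
  by rewrite ltnW// ltn_expl.
have [N hN Nmin] := ex_minnP ex.
have kN k : (k < N)%N -> s < 2 ^- k.
  by move=> kN; rewrite ltNge; apply/negP => /Nmin; rewrite leqNgt kN.
apply: (le_trans _ (SN N kN)); rewrite lee_fin.
have : ln (2 ^- N) <= ln s by rewrite ler_ln ?posrE// invr_gt0 exprn_gt0.
rewrite lnV ?posrE ?exprn_gt0// lnXn//.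
have : ln 2 <= 1 :> R by have := @ln_le_subr1 R 2; lra.
move=> l2 h; rewrite lerNl (le_trans _ h)// lerN2 -[ln 2 *+ N]mulr_natr ler_piMl//.
Qed.

Lemma measurable_layer v k : measurable (layer v k).
Proof. exact: measurable_itv. Qed.

(** The layer of index [k] has length [2 * 2 ^- k], so all layers together contribute at most 4. *)
Lemma average_log_kernel (v : R) :
  (\int[unit_measure]_c log_kernel 1 (c, v) <= 5%:E)%E.
Proof.
have mk : measurable_fun [set: T] (fun c : T => log_kernel 1 (c, v)).
  exact: (measurableT_comp (measurable_log_kernel 1) (pair2_measurable v)).
have ml k : measurable_fun [set: T] (fun c : T => (\1_(layer v k) c : R)%:E).
  by apply/measurable_EFinP; apply: measurable_indic; exact: measurable_layer.
have mS : measurable_fun [set: T] (fun c : T => \sum_(0 <= k <oo) (\1_(layer v k) c : R)%:E)%E.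
  have h0 k (c : T) : [set: T] c -> predT k -> (0 <= (\1_(layer v k) c : R)%:E :> \bar R)%E.
    by rewrite lee_fin.
  exact: (ge0_emeasurable_sum h0 (fun k _ => ml k)).
have S0 (c : T) : (0 <= \sum_(0 <= k <oo) (\1_(layer v k) c : R)%:E :> \bar R)%E.
  by apply: nneseries_ge0 => k _ _; rewrite lee_fin.
apply: (@le_trans _ _ (\int[unit_measure]_c (1 + \sum_(0 <= k <oo) (\1_(layer v k) c : R)%:E)))%E.
  apply: ge0_le_integral => //.
  - by move=> c _; exact: log_kernel_ge0.
  - by apply: emeasurable_funD.
  - by move=> c _; exact: log_kernel_le_layers.
rewrite ge0_integralD// integral_cst// mul1e [X in (X + _)%E]probability_setT.
have -> : (5%:E = 1 + 4%:E :> \bar R)%E by rewrite -EFinD; congr EFin; ring.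
rewrite leeD2l// integral_nneseries//.
have -> : (4%:E = limn (eseries (fun k => (4 / (2 ^ (k + 1))%:R : R)%:E)))%E.
  by apply/esym/cvg_lim => //; have := @cvg_geometric_eseries_half R 4 0; rewrite expr0 divr1.
apply: lee_nneseries => [k _ _|k _].
  by apply: integral_ge0 => c _; rewrite lee_fin.
rewrite integral_indic//; last exact: measurable_layer.
rewrite setIT /unit_measure /mrestr.
apply: (@le_trans _ _ (lebesgue_measure (layer v k))).
  apply: le_measure; rewrite ?inE//; last exact: measurable_layer.
  by apply: measurableI; [exact: measurable_layer|exact: measurable_unit_interval].
rewrite lebesgue_measure_itv/=; case: ifP => _; last first.
  by rewrite lee_fin divr_ge0.
rewrite -EFinB lee_fin addn1 expnS natrM -natrX; apply/le_of_eq.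
by field; rewrite natrX expf_neq0.
Qed.

(** By Tonelli's theorem the mean over [c] of the integrals against [rho] is at most [K], so they
    cannot all exceed [K + 1]. *)
Lemma level_choice (mu rho : probability T R) (D : set T) (K : R) (f : T -> R) :
  measurable D -> mu D = 1%E ->
  (forall v, \int[mu]_c log_kernel 1 (c, v) <= K%:E)%E ->
  measurable_fun [set: T] f ->
  exists2 c : R, D c & (\int[rho]_x log_kernel 1 (c, f x) <= (K + 1)%:E)%E.
Proof.
move=> mD D1 avg mf; apply: contrapT => no.
pose k (z : T * T) := log_kernel 1 (z.1, f z.2).
have mk : measurable_fun [set: T * T] k.
  apply: (measurableT_comp (measurable_log_kernel 1)).
  apply/measurable_fun_pairP; split; first exact: measurable_fst.
  exact: (measurableT_comp mf measurable_snd).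
have k0 z : (0 <= k z)%E by exact: log_kernel_ge0.
have mF := @measurable_fun_fubini_tonelli_F _ _ T T R rho k mk k0.
have F0 (c : T) : (0 <= fubini_F rho k c)%E by apply: integral_ge0 => x _; exact: k0.
have avgk (x : T) : (\int[mu]_c k (c, x) <= K%:E)%E.
  exact (avg (f x)).
have noc c : D c -> ((K + 1)%:E <= fubini_F rho k c)%E.
  by move=> Dc; rewrite leNgt; apply/negP => h; apply: no; exists c => //; exact: ltW.
have : (\int[mu]_c \int[rho]_x k (c, x) <= K%:E)%E.
  rewrite (@fubini_tonelli _ _ T T R mu rho k mk k0).
  apply: (@le_trans _ _ (\int[rho]_x (K%:E : \bar R)))%E.
    apply: ge0_le_integral => //.
    - by move=> x _; apply: integral_ge0.
    - exact: (@measurable_fun_fubini_tonelli_G _ _ T T R mu k mk k0).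
  by rewrite integral_cst ?mulr1// [X in (_ * X)%E]probability_setT mule1.
rewrite leNgt => /negP; apply.
rewrite -(ge0_integral_full mD D1 mF F0).
apply: (@lt_le_trans _ _ (\int[mu]_(c in D) ((K + 1)%:E : \bar R)))%E.
  by rewrite integral_cst// [X in (_ * X)%E]D1 mule1 lte_fin ltrDl.
apply: ge0_le_integral => //; last exact: measurable_funTS.
move=> c _; rewrite lee_fin addr_ge0// -lee_fin; apply: le_trans (avg 0).
by apply: integral_ge0 => x _; exact: log_kernel_ge0.
Qed.

End LevelChoice.

(** * Chebyshev-type upper bound with a polynomial weight *)

Section UpperBound.
Context {R : realType}.
Local Notation plane := (R * R)%type.
Local Notation T := (measurableTypeR R).

Context (e : set R) (rho : probability T R) (g : plane -> R).
Context (ce : compact e) (rho_eq : is_equilibrium_measure e rho).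
Context (gh : Defs.harmonic (~` on_real_axis e) g) (gg : green_like e g).
Local Notation U := (potential e rho).
Local Notation I := (robin e rho).

Let me : measurable (e : set T) := compact_measurable ce.

Lemma ln_poly_integrable (q : {poly R}) : (forall y, e y -> 0 < q.[y]) ->
  rho.-integrable e (EFin \o (fun x : T => ln q.[x])).
Proof.
move=> q0; apply: measurable_bounded_integrable => //.
- by rewrite (le_lt_trans (probability_le1 rho me))// ltry.
- apply: (@measurableT_comp _ _ _ _ _ _ (@ln R)); first exact: measurable_ln.
  apply: measurable_funTS; exact: continuous_measurable_fun (@continuous_horner _ q).
- have cl : {within e, continuous (fun x : R => ln q.[x])}.
    apply: continuous_in_subspaceT => x /set_mem ex.
    by apply: continuous_comp; [exact: continuous_horner|exact: continuous_ln (q0 _ ex)].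
  have := compact_bounded (continuous_compact cl ce).
  by case=> M [Mr MP]; exists M; split=> // N /MP h x /= ex; apply: h; exists x.
Qed.

Lemma log_mod_real (x : R) : log_mod (x, 0) = ln `|x|.
Proof. by rewrite log_modE modulus_real. Qed.

(** With [f = P / (t q)] and [Q = P - c t q], integrate [ln t + ln q = ln |Q| - ln |f - c|]. The
    first term on the right is a sum of potentials at the zeros of [Q], bounded by [gap_sum]; the
    second is bounded by the choice of [c]. The condition on [size q] keeps [Q] monic of degree
    [n]. *)
Lemma chebyshev_upper (n : nat) (q : {poly R}) (x0 : 'I_n.+1 -> R) (PW : R) :
  (\esum_(z in critical_points (on_real_axis e) g) (g z)%:E <= PW%:E)%E ->
  (forall y, e y -> 0 < q.[y]) -> (size q <= n)%N ->
  (forall i, e (x0 i)) -> injective x0 ->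
  exists P t, [/\ P \is monic, size P = n.+1, 0 < t,
    forall y, e y -> `|P.[y]| <= t * q.[y] &
    ln t <= 6 + PW - n%:R * I - \int[rho]_(x in e) ln q.[x]].
Proof.
move=> PWg q0 qn ex0 x0i; have [re _ _] := rho_eq.
have [P [t [s [[Pm Ps t0 Pe] [ss sl se sP]]]]] := alternating_polynomial ce q0 ex0 x0i.
exists P, t; split=> //.
(* This is [P / (t q)] on the set; writing the inverse as an exponential makes measurability on the
   whole line immediate. *)
pose f (x : T) : R := P.[x] * expR (- ln (t * q.[x])).
have mpoly (p : {poly R}) : measurable_fun [set: T] (fun x : T => p.[x]).
  exact: continuous_measurable_fun (@continuous_horner _ p).
have mf : measurable_fun [set: T] f.
  apply: measurable_funM; first exact: mpoly.
  apply: measurableT_comp; first exact: measurable_expR.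
  apply: measurable_funN; apply: measurableT_comp; first exact: measurable_ln.
  by apply: measurable_funM => //; exact: mpoly.
have fE x : e x -> P.[x] = t * q.[x] * f x.
  move=> ex; have tq : 0 < t * q.[x] by rewrite mulr_gt0// q0.
  by rewrite /f expRN lnK ?posrE// mulrCA divff ?mulr1// gt_eqF.
have [c c01 cK] := @level_choice R unit_measure rho _ 5 f
  (@measurable_unit_interval R) (@unit_measure_full R) (@average_log_kernel R) mf.
have {c01} [c0 c1] : 0 <= c /\ c < 1.
  by move: c01; rewrite /unit_interval/= in_itv/= => /andP.
pose Q := P + - (c * t) *: q.
have sq : (size (- (c * t) *: q) < size P)%N.
  by rewrite (leq_ltn_trans (size_scale_leq _ _))// Ps ltnS.
have Qs : size Q = n.+1 by rewrite size_polyDl.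
have Qm : Q \is monic by rewrite monicE lead_coefDl// -monicE.
have QE x : Q.[x] = P.[x] - c * t * q.[x] by rewrite hornerD hornerZ mulNr.
have sQ k : (k < n)%N -> Q.[s`_k] * Q.[s`_k.+1] < 0.
  move=> kn; have [e1 P1] := se k (leqW kn); have [e2 P2] := se k.+1 kn.
  have u1 : 0 < t * q.[s`_k] by rewrite mulr_gt0// q0.
  have u2 : 0 < t * q.[s`_k.+1] by rewrite mulr_gt0// q0.
  rewrite !QE -!mulrA; move: P1 P2 (sP _ kn).
  set a := P.[_]; set b := P.[_]; set u := t * _ in u1 *; set u' := t * _ in u2 *.
  (* At a node [|P|] equals [u = t q], and [0 <= c u < u]; subtracting [c u] therefore leaves the
     sign of [P] unchanged. *)
  have cu : c * u < u by rewrite gtr_pMl.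
  have cu' : c * u' < u' by rewrite gtr_pMl.
  have cu0 : 0 <= c * u by rewrite mulr_ge0// ltW.
  have cu'0 : 0 <= c * u' by rewrite mulr_ge0// ltW.
  case: (ltP 0 a) => a0.
    rewrite gtr0_norm// pmulr_rlt0// => Pa + b0; rewrite ltr0_norm// => Pb.
    by rewrite pmulr_rlt0; lra.
  rewrite ler0_norm// => Pa; case: (ltP 0 b) => b0.
    by rewrite gtr0_norm// => Pb _; rewrite nmulr_rlt0; lra.
  by rewrite ltNge mulr_le0.
have [y Qy sy] := interlacing_roots Qm Qs sl sQ.
have gap := gap_sum ce rho_eq gh gg PWg sl (fun k kn => (se k kn).1) sy.
pose a x : R := ln t + ln q.[x].
pose b x : R := \sum_(k < n) log_mod (y k - x, 0).
have ptw x : e x -> ((a x)%:E <= (b x)%:E + log_kernel 1 (c, f x))%E.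
  move=> ex; have qx := q0 _ ex; have tq : 0 < t * q.[x] by rewrite mulr_gt0.
  have [->|cf] := eqVneq c (f x); first by rewrite log_kernel_diag addey// leey.
  rewrite log_kernel_pos// -EFinD lee_fin.
  have Qx : Q.[x] = t * q.[x] * (f x - c) by rewrite QE fE//; ring.
  have cf0 : 0 < `|f x - c| by rewrite normr_gt0 subr_eq0 eq_sym.
  have Qx0 : Q.[x] != 0 by rewrite Qx mulf_neq0 ?(gt_eqF tq)// subr_eq0 eq_sym.
  have yx (k : 'I_n) : y k - x != 0.
    apply: contra_neq Qx0 => yx; rewrite Qy horner_prod (bigD1 k)//= hornerXsubC.
    by rewrite -opprB yx oppr0 mul0r.
  have -> : b x = ln `|Q.[x]|.
    rewrite Qy horner_prod normr_prod ln_prod => [|k _]; last first.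
      by rewrite hornerXsubC normr_gt0 -opprB oppr_eq0.
    by apply: eq_bigr => k _; rewrite log_mod_real hornerXsubC distrC.
  rewrite Qx normrM (gtr0_norm tq) !lnM ?posrE//.
  rewrite [`|c - _|]distrC.
  have : 1 - ln `|f x - c| <= Num.max 0 (1 - ln `|f x - c|) by rewrite le_max lexx orbT.
  rewrite /a; lra.
have ki : rho.-integrable e (fun x : T => log_kernel 1 (c, f x)).
  have mk : measurable_fun [set: T] (fun x : T => log_kernel 1 (c, f x)).
    exact: (measurableT_comp (measurable_log_kernel_r 1 c) mf).
  apply/integrableP; split; first exact: measurable_funTS.
  under eq_integral do rewrite gee0_abs ?log_kernel_ge0//.
  rewrite (ge0_integral_full me re mk) => [|x]; last exact: log_kernel_ge0.
  exact: le_lt_trans cK (ltry _).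
have kle : (\int[rho]_(x in e) log_kernel 1 (c, f x) <= 6%:E)%E.
  have mk : measurable_fun [set: T] (fun x : T => log_kernel 1 (c, f x)).
    exact: (measurableT_comp (measurable_log_kernel_r 1 c) mf).
  rewrite (ge0_integral_full me re mk) => [|x]; last exact: log_kernel_ge0.
  by apply: (le_trans cK); rewrite lee_fin; lra.
have ci : rho.-integrable e (EFin \o (fun=> ln t)).
  by have := finite_measure_integrable_cst rho (ln t) me.
have qi := ln_poly_integrable q0.
have yi (k : nat) : rho.-integrable e (EFin \o (fun x : T => log_mod (y k - x, 0))).
  exact: (log_mod_integrable ce rho_eq (y k, 0)).
have ai : rho.-integrable e (EFin \o a).
  by have := integrableD me ci qi.
have bi : rho.-integrable e (EFin \o b).
  have -> : EFin \o b = (fun x => \sum_(k < n) (log_mod (y k - x, 0))%R%:E)%E.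
    by apply/funext => x; rewrite /= sumEFin.
  by apply: integrable_sum => // k _; exact: yi.
have aE : \int[rho]_(x in e) a x = ln t + \int[rho]_(x in e) ln q.[x].
  rewrite /a RintegralD//; congr (_ + _).
  by rewrite Rintegral_cst// [X in fine X]re mulr1.
have bE : \int[rho]_(x in e) b x = \sum_(k < n) U (y k, 0).
  rewrite /Rintegral; under eq_integral do rewrite -sumEFin.
  rewrite integral_sum => [|//|k]; last exact: yi.
  rewrite -sum_fine => [|k _]; last exact: integrable_fin_num (yi k).
  by [].
have : (\int[rho]_(x in e) (a x)%:E <= \int[rho]_(x in e) (b x)%:E + 6%:E)%E.
  apply: (@le_trans _ _ (\int[rho]_(x in e) ((b x)%:E + log_kernel 1 (c, f x)))%E).
    apply: le_integral => //; first exact: integrableD.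
    by move=> x /set_mem; exact: ptw.
  by rewrite integralD// leeD2l.
rewrite -(fineK (integrable_fin_num me ai)) -(fineK (integrable_fin_num me bi)).
rewrite -EFinD lee_fin -/(Rintegral rho e a) -/(Rintegral rho e b) aE bE; lra.
Qed.

End UpperBound.

(** * Polynomial minorants of the inverse weight *)

Section Bernstein.
Context {R : realType}.

(* The [n]-th Bernstein polynomial of [f] is [bernstein n (fun k => f (k / n))];
   the recursion conditions on the first of [n] independent trials. *)
Fixpoint bernstein (n : nat) (phi : nat -> R) : {poly R} :=
  if n is m.+1 then
    'X * bernstein m (fun k => phi k.+1) + (1 - 'X) * bernstein m phi
  else (phi 0%N)%:P.

(** A quadratic majorant is stable under the recursion: conditioning on a trial shifts [c] by 0 or
    1, and the mean of [(k - c)^2] is the variance plus the square of the bias. *)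
Lemma bernstein_deviation (n : nat) (phi : nat -> R) (x a c al be : R) :
  0 <= x <= 1 -> (forall k, `|phi k - a| <= al * (k%:R - c) ^+ 2 + be) ->
  `|(bernstein n phi).[x] - a| <=
    al * (n%:R * (x * (1 - x)) + (n%:R * x - c) ^+ 2) + be.
Proof.
move=> /andP[x0 x1]; elim: n phi c => [|n IH] phi c phiP /=.
  by rewrite hornerC !mul0r add0r sub0r; have := phiP 0%N; rewrite sub0r.
have h1 : `|(bernstein n (fun k => phi k.+1)).[x] - a| <=
    al * (n%:R * (x * (1 - x)) + (n%:R * x - (c - 1)) ^+ 2) + be.
  apply: IH => k; have := phiP k.+1; rewrite -natr1.
  by have -> : k%:R + 1 - c = k%:R - (c - 1) by ring.
have h2 := IH phi c phiP.
rewrite hornerD !hornerM hornerD hornerN hornerX hornerC.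
set p := (bernstein n _).[x] in h1 *; set r := (bernstein n _).[x] in h2 *.
have -> : x * p + (1 - x) * r - a = x * (p - a) + (1 - x) * (r - a) by ring.
apply: (le_trans (ler_normD _ _)); rewrite !normrM (ger0_norm x0).
have y0 : 0 <= 1 - x by lra.
rewrite (ger0_norm y0).
apply: (le_trans (lerD (ler_wpM2l x0 h1) (ler_wpM2l y0 h2))).
by apply/le_of_eq; rewrite -natr1; ring.
Qed.

Lemma lipschitz_poly_approx (f : R -> R) (L B eps : R) : 0 < B -> 0 < eps ->
  (forall x y, `|f x - f y| <= L * `|x - y|) ->
  exists q : {poly R}, forall x, `|x| <= B -> `|q.[x] - f x| <= eps.
Proof.
move=> B0 e0 fL; have L0 : 0 <= L.
  have := le_trans (normr_ge0 _) (fL 1 0).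
  by rewrite subr0 normr1 mulr1.
(* A Lipschitz constant for [f] after rescaling [[- B, B]] to [[0, 1]], made positive by the added
   1. *)
pose K := 2 * B * (L + 1); have K0 : 0 < K by rewrite !mulr_gt0// ltr_wpDl.
have [n [n0 nK]] : exists n : nat, 0 < n%:R :> R /\ K ^+ 2 / eps ^+ 2 < n%:R.
  by exists (Num.truncn (K ^+ 2 / eps ^+ 2)).+1; rewrite truncnS_gt ltr0n.
pose psi (s : R) := f (2 * B * s - B).
have psiL s u : `|psi s - psi u| <= K * `|s - u|.
  apply: (le_trans (fL _ _)).
  have -> : 2 * B * s - B - (2 * B * u - B) = 2 * B * (s - u) by ring.
  rewrite normrM gtr0_norm ?mulr_gt0// mulrA ler_wpM2r//.
  by rewrite mulrC /K ler_pM2l ?mulr_gt0// lerDl.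
pose q := bernstein n (fun k => psi (k%:R / n%:R)) \Po ((2 * B)^-1 *: ('X + B%:P)).
exists q => x xB; rewrite horner_comp hornerZ hornerD hornerX hornerC.
set s := (2 * B)^-1 * (x + B).
have fs : f x = psi s.
  by rewrite /psi /s mulrA mulfV ?mul1r ?addrK// gt_eqF// mulr_gt0.
have s01 : 0 <= s <= 1.
  have /andP[h1 h2] : - B <= x <= B by rewrite -ler_norml.
  by rewrite /s mulrC ler_pdivrMr ?divr_ge0 ?mulr_gt0//; lra.
(* AM-GM: [K |d| <= K^2 d^2 / (2 eps) + eps / 2] *)
have := @bernstein_deviation n (fun k => psi (k%:R / n%:R)) s (psi s) (n%:R * s)
  (K ^+ 2 / (2 * eps * n%:R ^+ 2)) (eps / 2) s01.
rewrite fs => h; apply: (le_trans (h _)) => [k|].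
  apply: (le_trans (psiL _ _)); set d := `|_|.
  have -> : K ^+ 2 / (2 * eps * n%:R ^+ 2) * (k%:R - n%:R * s) ^+ 2 =
      K ^+ 2 * d ^+ 2 / (2 * eps).
    rewrite /d real_normK ?num_real//; field.
    by rewrite !gt_eqF//.
  have := sqr_ge0 (K * d - eps); rewrite sqrrB exprMn.
  have -> : K ^+ 2 * d ^+ 2 / (2 * eps) + eps / 2 =
     (K ^+ 2 * d ^+ 2 + eps ^+ 2) / (2 * eps) by field; rewrite gt_eqF.
  rewrite ler_pdivlMr ?mulr_gt0//; lra.
rewrite subrr expr0n addr0.
have ss : s * (1 - s) <= 1 by move: s01 => /andP[h1 h2]; nra.
have : K ^+ 2 / (2 * eps * n%:R ^+ 2) * (n%:R * (s * (1 - s))) <= eps / 2.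
  have -> : K ^+ 2 / (2 * eps * n%:R ^+ 2) * (n%:R * (s * (1 - s))) =
     K ^+ 2 / eps ^+ 2 / n%:R * (s * (1 - s)) * (eps / 2).
    by field; rewrite !gt_eqF.
  rewrite ler_piMl ?divr_ge0 ?(ltW e0)//.
  have a0 : 0 <= K ^+ 2 / eps ^+ 2 / n%:R by rewrite !divr_ge0 ?sqr_ge0// ltW.
  have a1 : K ^+ 2 / eps ^+ 2 / n%:R <= 1 by rewrite ler_pdivrMr// mul1r ltW.
  apply: (le_trans (ler_wpM2l a0 ss)); lra.
lra.
Qed.

End Bernstein.

(** * Semi-continuous weights and Lipschitz envelopes *)

Section Weight.
Context {R : realType}.
Local Notation T := (measurableTypeR R).
Implicit Types (e : set R) (w : R -> R).

Lemma usc_bounded e w : compact e -> usc_on e w ->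
  exists2 M : R, 1 <= M & forall x, e x -> w x <= M.
Proof.
move=> ce wu; have /compact_near_coveringP cov := ce.
have [|M [_ MP]] := cov R (+oo : set_system R) (fun M x => e x -> w x <= M) _.
- move=> x ex; have n1 : \forall y \near x, e y -> w y < w x + 1.
    by have := wu _ ex (w x + 1) (ltr_pwDr ltr01 (lexx _)); rewrite near_withinE.
  have n2 : \forall M \near +oo, w x + 1 <= M by apply: nbhs_pinfty_ge; exact: num_real.
  exists ([set y | e y -> w y < w x + 1], [set M | w x + 1 <= M]) => //=.
  move=> [y M] [/= h1 h2] ey; exact: ltW (lt_le_trans (h1 ey) h2).
exists (Num.max 1 (M + 1)); first by rewrite le_max lexx.
move=> x ex; apply: (MP _ _ x ex ex).
by rewrite lt_max ltrDl ltr01 orbT.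
Qed.

Lemma usc_measurable e w : measurable e -> usc_on e w ->
  measurable_fun (e : set T) (w : T -> R).
Proof.
move=> me wu mD; apply: (measurability _ (RGenInftyO.measurableE R)) => //.
move=> _ [_ [a ->] <-].
have -> : e `&` w @^-1` `]-oo, a[%classic =
    e `&` interior [set y | e y -> w y < a].
  apply/seteqP; split=> x [ex].
    rewrite /= in_itv/= => wx; split=> //.
    by have := wu _ ex _ wx; rewrite near_withinE.
  by move=> wx; split=> //; rewrite /= in_itv/=; exact: (interior_subset wx ex).
by apply: measurableI => //; apply: open_measurable; exact: open_interior.
Qed.

Lemma limn_einf_ge (u : (\bar R)^nat) (h : \bar R) :
  (forall a : R, (a%:E < h)%E -> \forall n \near \oo, (a%:E <= u n)%E) ->
  (h <= limn_einf u)%E.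
Proof.
move=> H; have C (a : R) : (a%:E < h)%E -> (a%:E <= limn_einf u)%E.
  move=> /H [N _ hN]; rewrite limn_einf_lim; apply: lime_ge; first exact: is_cvg_einfs.
  exists N => // n /= Nn; apply: le_ereal_inf_tmp => _ [m /= nm <-].
  by apply: hN; exact: leq_trans nm.
move: h C {H} => [r| |] C; last by rewrite leNye.
  apply/lee_addgt0Pr => eps eps0; rewrite -leeBlDr// -EFinB; apply: C.
  by rewrite lte_fin gtrBl.
by rewrite leye_eq; apply/eqP/eq_infty => t; apply: C; exact: ltry.
Qed.

Section Envelope.
Context (e : set R) (w : R -> R) (M : R).
Context (e0 : e !=set0) (w0 : forall x, e x -> 0 <= w x).
Context (M1 : 1 <= M) (wM : forall x, e x -> w x <= M) (wu : usc_on e w).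

(** The cap keeps the inverse finite at zeros of [w] and is released as [k] grows. *)
Definition capped_inverse (k : nat) (y : R) : R := (Num.max (w y) k.+1%:R^-1)^-1.

(* Lipschitz minorants of [1 / w] (Pasch-Hausdorff envelopes) *)
Definition envelope (k : nat) (x : R) : R :=
  inf [set capped_inverse k y + k.+1%:R * `|x - y| | y in e].

Let cap_gt0 k y : 0 < Num.max (w y) k.+1%:R^-1.
Proof. by rewrite lt_max invr_gt0 ltr0n orbT. Qed.

Lemma capped_inverse_ge k y : e y -> M^-1 <= capped_inverse k y.
Proof.
move=> ey; rewrite lef_pV2 ?posrE//; last by rewrite (lt_le_trans ltr01).
rewrite ge_max wM//= (le_trans _ M1)// invf_le1 ?ltr0n//.
by rewrite ler1n.
Qed.

Lemma envelope_ge k x c : (forall y, e y -> c <= capped_inverse k y + k.+1%:R * `|x - y|) ->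
  c <= envelope k x.
Proof.
move=> h; apply: lb_le_inf; first by have [y ey] := e0; exists (capped_inverse k y + k.+1%:R * `|x - y|); exists y.
by move=> _ [y ey <-]; exact: h.
Qed.

Lemma envelope_le k x y : e y -> envelope k x <= capped_inverse k y + k.+1%:R * `|x - y|.
Proof.
move=> ey; apply: ge_inf; last by exists y.
exists 0 => _ [z ez <-]; rewrite addr_ge0 ?mulr_ge0//.
by rewrite invr_ge0 ltW.
Qed.

Lemma envelope_ge_inv k x : M^-1 <= envelope k x.
Proof.
apply: envelope_ge => y ey; rewrite (le_trans (capped_inverse_ge k ey))//.
by rewrite lerDl mulr_ge0.
Qed.

Lemma envelope_gt0 k x : 0 < envelope k x.
Proof.
by rewrite (lt_le_trans _ (envelope_ge_inv k x))// invr_gt0 (lt_le_trans ltr01).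
Qed.

Lemma envelope_lipschitz k x y : `|envelope k x - envelope k y| <= k.+1%:R * `|x - y|.
Proof.
have half a b : envelope k a - k.+1%:R * `|a - b| <= envelope k b.
  apply: envelope_ge => z ez; rewrite lerBlDr (le_trans (envelope_le k a ez))//.
  by rewrite -addrA lerD2l -mulrDr ler_wpM2l// [leRHS]addrC ler_distD.
rewrite ler_norml; apply/andP; split.
  by have := half y x; rewrite distrC; lra.
by have := half x y; lra.
Qed.

Lemma envelope_mul_le1 k x : e x -> w x * envelope k x <= 1.
Proof.
move=> ex; have := envelope_le k x ex; rewrite subrr normr0 mulr0 addr0 => h.
apply: (@le_trans _ _ (Num.max (w x) k.+1%:R^-1 * capped_inverse k x)).
  apply: ler_pM => //; [exact: w0|exact: ltW (envelope_gt0 _ _)|].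
  by rewrite le_max lexx.
by rewrite mulfV// gt_eqF.
Qed.

(** Near [x], upper semi-continuity gives [w < a^-1], which bounds the capped inverse from below;
    away from [x], the penalty [k.+1 * d] exceeds [a]. *)
Lemma envelope_near x a : e x -> 0 < a -> w x < a^-1 ->
  \forall k \near \oo, a <= envelope k x.
Proof.
move=> ex a0 wa; have := wu ex wa; rewrite near_withinE => /nbhs_ballP[d /= d0 dP].
have h1 : \forall k \near \oo, a / d < k%:R by exact: nbhs_infty_gtr.
have h2 : \forall k \near \oo, a < k%:R by exact: nbhs_infty_gtr.
apply: (filterS _ (filterI h1 h2)) => k [/= k1 k2]; apply: envelope_ge => y ey.
have kk : k%:R <= k.+1%:R :> R by rewrite ler_nat.
have ci0 : 0 <= capped_inverse k y by rewrite invr_ge0 ltW.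
have [xy|xy] := ltP `|x - y| d.
  have wy : w y < a^-1 by apply: dP.
  rewrite (@le_trans _ _ (capped_inverse k y))//; last by rewrite lerDl mulr_ge0.
  rewrite -[a]invrK lef_pV2 ?posrE ?invr_gt0// ge_max (ltW wy)/=.
  by rewrite lef_pV2 ?posrE ?ltr0n// ltW// (lt_le_trans k2).
rewrite (@le_trans _ _ (k.+1%:R * `|x - y|)) ?lerDr//.
rewrite (@le_trans _ _ (k.+1%:R * d)) ?ler_wpM2l// -ler_pdivrMr// ltW//.
exact: lt_le_trans kk.
Qed.

Lemma envelope_continuous k : continuous (envelope k).
Proof.
move=> x; apply/cvgrPdist_le => eps e1.
have ek : 0 < eps / k.+1%:R by rewrite divr_gt0// ltr0n.
near=> y; apply: (le_trans (envelope_lipschitz k x y)).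
rewrite -ler_pdivlMl ?ltr0n// mulrC.
near: y; apply: cvgr_dist_le => //; exact: cvg_id.
Unshelve. all: by end_near. Qed.

(** Three quarters of the envelope are approximated within [M^-1 / 4], which is at most a quarter of
    the envelope. *)
Lemma envelope_poly (B : R) k : (forall x, e x -> `|x| <= B) -> 0 < B ->
  exists q : {poly R}, forall x, e x ->
    envelope k x / 2 <= q.[x] <= envelope k x.
Proof.
move=> eB B0; have M0 : 0 < M^-1 by rewrite invr_gt0 (lt_le_trans ltr01).
have [|x y|q qP] := @lipschitz_poly_approx R (fun x => 3 / 4 * envelope k x)
  k.+1%:R B (M^-1 / 4) B0.
- by rewrite divr_gt0.
- rewrite -mulrBr normrM ger0_norm ?divr_ge0//.
  have := envelope_lipschitz k x y; have := normr_ge0 (envelope k x - envelope k y); lra.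
- exists q => x ex; have := qP x (eB _ ex); have := envelope_ge_inv k x.
  by rewrite ler_norml => ? /andP[]; lra.
Qed.

End Envelope.
End Weight.

(** * The logarithmic integral of the weight *)

Section LogWeight.
Context {R : realType}.
Local Notation T := (measurableTypeR R).

Context (e : set R) (rho : probability T R) (w : R -> R) (M : R).
Context (ce : compact e) (re : rho e = 1%E).
Context (w0 : forall x, e x -> 0 <= w x).
Context (M1 : 1 <= M) (wM : forall x, e x -> w x <= M) (wu : usc_on e w).

Let me : measurable (e : set T) := compact_measurable ce.
Let M0 : 0 < M. Proof. exact: lt_le_trans M1. Qed.
Let lM0 : 0 <= ln M. Proof. exact: ln_ge0. Qed.

(** Measured downwards from [ln M], the logarithm of the weight becomes nonnegative on the set, with
    value [+oo] at the zeros of [w]. *)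
Definition log_deficit (x : R) : \bar R := ((ln M)%:E - lne (w x)%:E)%E.

Lemma measurable_log_weight : measurable_fun (e : set T) (fun x : T => lne (w x)%:E).
Proof. exact: (measurableT_comp measurable_lne (usc_measurable me wu)). Qed.

Lemma measurable_log_deficit : measurable_fun (e : set T) (log_deficit : T -> \bar R).
Proof.
apply: emeasurable_funB; first exact: measurable_cst.
exact: measurable_log_weight.
Qed.

Lemma lne_le_ln x : e x -> (lne (w x)%:E <= (ln M)%:E)%E.
Proof.
move=> ex; rewrite /=; case: ifPn => [_|]; first by rewrite leNye.
rewrite -ltNge => wx; rewrite lee_fin ler_ln ?posrE//; exact: wM.
Qed.

Lemma log_deficit_ge0 x : e x -> (0 <= log_deficit x)%E.
Proof. by move=> ex; rewrite /log_deficit sube_ge0 ?orbT//; exact: lne_le_ln. Qed.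

Lemma integral_log_deficit :
  (\int[rho]_(x in e) log_deficit x = (ln M)%:E - \int[rho]_(x in e) lne (w x)%:E)%E.
Proof.
have pos : (\int[rho]_(x in e) (fun x : T => lne (w x)%:E)^\+%E x <= (ln M)%:E)%E.
  apply: (@le_trans _ _ (\int[rho]_(x in e) (ln M)%:E)%E); last first.
    by rewrite integral_cst// [X in (_ * X)%E]re mule1.
  apply: ge0_le_integral => //; first by apply: measurable_funepos; exact: measurable_log_weight.
  by move=> x ex; rewrite funeposE ge_max lne_le_ln//= lee_fin.
have pfin : (\int[rho]_(x in e) (fun x : T => lne (w x)%:E)^\+%E x)%E \is a fin_num.
  rewrite ge0_fin_numE ?(le_lt_trans pos) ?ltry//.
  by apply: integral_ge0 => x _; exact: funepos_ge0.
have := integral_sub_cst (ln M) me re measurable_log_deficit log_deficit_ge0.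
have -> : (\int[rho]_(x in e) (log_deficit x - (ln M)%:E) =
    \int[rho]_(x in e) - lne (w x)%:E)%E.
  apply: eq_integral => x _; rewrite /log_deficit addeC addeA -EFinN -EFinD addNr add0e.
  by [].
rewrite integralN; last by rewrite fin_num_adde_defr.
by move=> ->; rewrite [RHS]addeC subeK.
Qed.

(** The functions [ln (psi k) + ln M] are nonnegative, with lower limit at least the deficit on the
    set, so by Fatou's lemma their integrals are unbounded. A polynomial between [psi k / 2] and
    [psi k] loses only [ln 2]. *)
Lemma polynomial_minorant (A : R) : (\int[rho]_(x in e) log_deficit x = +oo)%E ->
  exists q : {poly R}, [/\ forall x, e x -> 0 < q.[x],
    forall x, e x -> w x * q.[x] <= 1 & A <= \int[rho]_(x in e) ln q.[x]].
Proof.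
move=> hoo; apply: contrapT => no.
have [B B1 eB] := compact_norm_bound ce; have B0 : 0 < B by lra.
have e0 : e !=set0.
  apply/set0P/eqP => e0; have := re.
  by rewrite e0 measure0 => -[/eqP]; rewrite eq_sym oner_eq0.
pose psi k x := envelope e w k x.
pose f k (x : T) : \bar R := (ln (psi k x) + ln M)%:E.
have psi0 k x : 0 < psi k x by exact: (envelope_gt0 e0 M1 wM).
have f0 k x : (0 <= f k x)%E.
  rewrite lee_fin -lnM ?posrE// ln_ge0//.
  have := envelope_ge_inv e0 M1 wM k x.
  by rewrite -ler_pdivrMr// mul1r.
have mf k : measurable_fun (e : set T) (f k).
  apply/measurable_EFinP; apply: measurable_funD => //.
  apply: (@measurableT_comp _ _ _ _ _ _ (@ln R)); first exact: measurable_ln.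
  apply: measurable_funTS; apply: continuous_measurable_fun.
  exact: (envelope_continuous e0).
have fA k : (\int[rho]_(x in e) f k x <= (A + ln 2 + ln M)%:E)%E.
  have [q qP] := envelope_poly e0 M1 wM k eB B0.
  have q0 x : e x -> 0 < q.[x].
    by move=> /qP/andP[+ _]; apply: lt_le_trans; rewrite divr_gt0.
  have qi := ln_poly_integrable rho ce q0.
  have qA : \int[rho]_(x in e) ln q.[x] < A.
    rewrite ltNge; apply/negP => h; apply: no; exists q; split=> // x ex.
    apply: (le_trans _ (envelope_mul_le1 e0 w0 M1 wM k ex)).
    by rewrite ler_wpM2l ?w0//; have /andP[] := qP _ ex.
  have ci : rho.-integrable e (EFin \o (fun=> ln 2 + ln M)).
    by have := finite_measure_integrable_cst rho (ln 2 + ln M) me.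
  apply: (@le_trans _ _ (\int[rho]_(x in e) ((ln q.[x])%:E + (ln 2 + ln M)%:E))%E).
    apply: ge0_le_integral => //.
    - by have /integrableP[] := integrableD me qi ci.
    - move=> x ex; rewrite -EFinD lee_fin addrA lerD2r -lnM ?posrE ?q0//.
      rewrite ler_ln ?posrE ?mulr_gt0 ?q0//.
      by have /andP[] := qP _ ex; rewrite /psi; lra.
  rewrite integralD// integral_cst// [X in (_ + _ * X)%E]re mule1.
  rewrite -(fineK (integrable_fin_num me qi)) -EFinD lee_fin.
  by move: qA; rewrite /Rintegral; lra.
have := fatou rho me mf (fun k x _ => f0 k x).
have : (limn_einf (fun k => \int[rho]_(x in e) f k x) <= (A + ln 2 + ln M)%:E)%E.
  apply: limn_einf_le => eps e1; apply: nearW => k; apply: (le_trans (fA k)).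
  by rewrite lee_fin lerDl ltW.
move=> h1 h2; have := le_trans h2 h1; rewrite leNgt => /negP; apply.
apply: (@lt_le_trans _ _ (\int[rho]_(x in e) log_deficit x)%E); first by rewrite hoo ltry.
apply: ge0_le_integral => //.
- exact: log_deficit_ge0.
- exact: measurable_log_deficit.
- rewrite /limn_einf; apply: measurableT_comp => //; apply: measurable_fun_limn_esup => m.
  by apply: measurableT_comp => //; exact: mf.
- move=> x ex; apply: limn_einf_ge => a ah.
  have ea : w x < (expR (a - ln M))^-1.
    rewrite -expRN opprB; move: ah; rewrite /log_deficit/=.
    case: ifPn => [h _|]; first by rewrite (le_lt_trans h)// expR_gt0.
    rewrite -ltNge => wx; rewrite -EFinB lte_fin => ah.
    by rewrite -ltr_ln ?posrE ?expR_gt0// expRK; lra.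
  have := envelope_near e0 wu ex (expR_gt0 _) ea.
  apply: (filterS _) => k hk; rewrite lee_fin -lerBlDr.
  by rewrite -[leLHS]expRK ler_ln ?posrE ?expR_gt0.
Qed.

End LogWeight.

(** * Widom factors *)

Section WidomFactors.
Context {R : realType}.
Local Notation plane := (R * R)%type.
Local Notation T := (measurableTypeR R).
Import ComplexField.

Lemma monic_modulus (P : {poly R[i]}) : P \is monic ->
  exists2 s : seq plane, size P = (size s).+1 &
    forall x : R, Normc.normc P.[x%:C%C] = \prod_(z <- s) modulus (z.1 - x, z.2).
Proof.
move=> Pm; have [r Pr] := closed_field_poly_normal P.
rewrite (monicP Pm) scale1r in Pr.
exists [seq (complex.Re z, complex.Im z) | z <- r].
  by rewrite Pr size_prod_XsubC size_map.
move=> x; rewrite Pr big_map horner_prod.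
rewrite (big_morph _ (@Normc.normcM R) (Normc.normc1 R)).
apply: eq_bigr => -[a b] _; rewrite hornerXsubC /= /modulus/=.
by rewrite sub0r sqrrN -[in LHS](opprB a) sqrrN.
Qed.

Lemma normc_real_poly (P : {poly R}) (x : R) :
  Normc.normc (map_poly (real_complex R) P).[x%:C%C] = `|P.[x]|.
Proof.
by rewrite (horner_map (real_complex R)) /= expr0n/= addr0 sqrtr_sqr.
Qed.

Section Bounds.
Context (e : set R) (rho : probability T R) (w : R -> R) (M : R).
Context (ce : compact e) (rho_eq : is_equilibrium_measure e rho).
Context (w0 : forall x, e x -> 0 <= w x).
Context (M1 : 1 <= M) (wM : forall x, e x -> w x <= M) (wu : usc_on e w).
Context (e0 : e !=set0).

Local Notation I := (robin e rho).
Let me : measurable (e : set T) := compact_measurable ce.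

Lemma capacity_robin : capacity e = expR (- I).
Proof.
rewrite /capacity; have -> : ereal_inf [set log_energy e mu | mu in
    [set mu : probability T R | mu e = 1%E]] = I%:E; last by [].
apply/eqP; rewrite eq_le; apply/andP; split.
  apply: ereal_inf_lbound; exists rho; last exact: log_energy_robin.
  by case: rho_eq.
by apply: le_ereal_inf_tmp => _ [mu mu1 <-]; exact: robin_min.
Qed.

Lemma weighted_norm_le (P : {poly R[i]}) (t : R) :
  (forall x, e x -> w x * Normc.normc P.[x%:C%C] <= t) ->
  weighted_sup_norm e w P <= t.
Proof.
move=> h; apply: ge_sup; last by move=> _ [x ex <-]; exact: h.
by have [x ex] := e0; exists (w x * Normc.normc P.[x%:C%C]); exists x.
Qed.

Lemma le_weighted_norm (P : {poly R[i]}) (x : R) : P \is monic -> e x ->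
  w x * Normc.normc P.[x%:C%C] <= weighted_sup_norm e w P.
Proof.
move=> Pm ex; have [B B1 eB] := compact_norm_bound ce.
have [s _ Ps] := monic_modulus Pm.
apply: ub_le_sup; last by exists x.
exists (M * \prod_(z <- s) (modulus z + B)) => _ [y ey <-].
have p0 : 0 <= \prod_(z <- s) modulus (z.1 - y, z.2).
  by apply: prodr_ge0 => z _; exact: modulus_ge0.
rewrite Ps; apply: ler_pM => //; [exact: w0|exact: wM|].
apply: ler_prod => z _; rewrite modulus_ge0/=.
by apply: (le_trans (modulus_sub _ _)); rewrite lerD2l eB.
Qed.

Lemma weighted_norm_ge0 (P : {poly R[i]}) : P \is monic -> 0 <= weighted_sup_norm e w P.
Proof.
move=> Pm; have [x ex] := e0; apply: le_trans (le_weighted_norm Pm ex).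
have [s _ ->] := monic_modulus Pm; rewrite mulr_ge0 ?w0//.
by apply: prodr_ge0 => z _; exact: modulus_ge0.
Qed.

Lemma widom_upper (n : nat) (P : {poly R}) (t c : R) : P \is monic -> size P = n.+1 ->
  0 < t -> (forall x, e x -> w x * `|P.[x]| <= t) -> ln t <= c - n%:R * I ->
  widom_factor e w n <= expR c.
Proof.
move=> Pm Ps t0 wP lt.
rewrite /widom_factor capacity_robin ler_pdivrMr ?exprn_gt0 ?expR_gt0//.
rewrite -expRM_natl -expRD mulrN.
apply: (@le_trans _ _ t); last by rewrite -[t]lnK ?posrE// ler_expR.
pose Pc := map_poly (real_complex R) P.
apply: (@le_trans _ _ (weighted_sup_norm e w Pc)).
  apply: ge_inf; first by exists 0 => _ [Q [Qm _] <-]; exact: weighted_norm_ge0.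
  exists Pc => //; split; first by rewrite map_monic.
  by rewrite size_map_poly.
by apply: weighted_norm_le => x ex; rewrite normc_real_poly; exact: wP.
Qed.

(** The inequality [ln (w |P|) <= ln N] is integrated after moving terms so that all integrands are
    nonnegative; zeros of [w] and of [P] then put [+oo] on the larger side. Frostman's bound limits
    the cost of each zero of [P] to [I + L z]. *)
Lemma product_lower (s : seq plane) (N H : R) : 0 < N ->
  (forall x, e x -> w x * \prod_(z <- s) modulus (z.1 - x, z.2) <= N) ->
  (\int[rho]_(x in e) log_deficit w M x <= H%:E)%E ->
  expR (ln M - H - (size s)%:R * I) <= N.
Proof.
move=> N0 wN HH; have [re _ _] := rho_eq.
have nNy (u : \bar R) : (0 <= u)%E -> u != -oo%E by case: u.
have /choice[L LP] := potential_kernel ce rho_eq.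
pose K x := (\sum_(z <- s) log_kernel (L z) (z.1, x))%E.
have K0 x : (0 <= K x)%E by apply: sume_ge0 => z _; exact: log_kernel_ge0.
have KP x : e x -> K x = +oo%E \/
    0 < \prod_(z <- s) modulus (z.1 - x, z.2) /\
    ((\sum_(z <- s) L z - ln (\prod_(z <- s) modulus (z.1 - x, z.2)))%:E <= K x)%E.
  move=> ex; rewrite /K; elim: s {K K0 wN} => [|z s IH].
    by right; rewrite !big_nil ln1 subr0.
  rewrite !big_cons; have [_ _ Lz] := LP z; have {}Lz := Lz x ex.
  have Ks0 : (0 <= \sum_(z <- s) log_kernel (L z) (z.1, x))%E.
    by apply: sume_ge0 => ? _; exact: log_kernel_ge0.
  have [z0|z0] := eqVneq (z.1 - x, z.2) (0, 0).
    left; case: z0 => /eqP; rewrite subr_eq0 => /eqP -> _.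
    by rewrite log_kernel_diag addye// nNy.
  case: IH => [->|[p0 pK]].
    by left; rewrite addey// nNy// log_kernel_ge0.
  right; split; first by rewrite mulr_gt0// modulus_gt0.
  rewrite lnM ?posrE ?modulus_gt0// opprD addrACA EFinD leeD//.
  by rewrite -log_modE.
have mD := measurable_log_deficit M ce wu.
have mK (z : plane) : measurable_fun (e : set T) (fun x : T => log_kernel (L z) (z.1, x)).
  exact: measurable_funTS (measurable_log_kernel_r _ _).
have D0 := log_deficit_ge0 M1 wM.
pose c := ln M + \sum_(z <- s) L z - ln N.
(* The maximum with 0 keeps the smaller side nonnegative, as monotonicity of these integrals
   requires. *)
have ptw x : e x -> ((Num.max c 0)%:E <= log_deficit w M x + K x)%E.
  move=> ex; rewrite EFin_max ge_max adde_ge0 ?D0// andbT.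
  have [wx|wx] := leP (w x) 0.
    by rewrite /log_deficit/= wx /= addye ?leey// nNy.
  have [->|[p0 pK]] := KP _ ex.
    by rewrite addey ?leey// nNy// D0.
  apply: (le_trans _ (leeD2l _ pK)).
  rewrite /log_deficit lne_EFin// -EFinB -EFinD lee_fin.
  have : ln (w x) + ln (\prod_(z <- s) modulus (z.1 - x, z.2)) <= ln N.
    by rewrite -lnM ?posrE// ler_ln ?posrE ?mulr_gt0// wN.
  rewrite /c; lra.
have KI : (\int[rho]_(x in e) K x <= (\sum_(z <- s) (I + L z))%:E)%E.
  rewrite ge0_integral_sum//; last by move=> z x _; exact: log_kernel_ge0.
  by rewrite -sumEFin; apply: lee_sum => z _; case: (LP z).
have cI : ((Num.max c 0)%:E <= H%:E + (\sum_(z <- s) (I + L z))%:E)%E.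
  apply: (@le_trans _ _ (\int[rho]_(x in e) (log_deficit w M x + K x))%E).
    apply: (@le_trans _ _ (\int[rho]_(x in e) (Num.max c 0)%:E)%E).
      by rewrite integral_cst// [X in (_ * X)%E]re mule1.
    apply: ge0_le_integral => //.
    - by move=> x _; rewrite lee_fin le_max lexx orbT.
    - by apply: emeasurable_funD => //; exact: emeasurable_sum.
  rewrite ge0_integralD//; first exact: leeD.
  exact: emeasurable_sum.
move: cI; rewrite -EFinD lee_fin ge_max => /andP[+ _].
rewrite big_split/= big_const_seq count_predT iter_addr_0 -mulr_natl /c => h.
by rewrite -[leRHS]lnK ?posrE// ler_expR; lra.
Qed.

(** When [H] is the integral of the deficit, the lower bound is the exponential of the integral of
    [lne w]. *)
Lemma widom_lower (n : nat) (H : R) :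
  (\int[rho]_(x in e) log_deficit w M x <= H%:E)%E ->
  expR (ln M - H) <= widom_factor e w n.
Proof.
move=> HH; rewrite /widom_factor capacity_robin ler_pdivlMr ?exprn_gt0 ?expR_gt0//.
rewrite -expRM_natl -expRD mulrN.
apply: lb_le_inf.
  exists (weighted_sup_norm e w 'X^n); exists 'X^n => //=.
  by split; [exact: monicXn|rewrite size_polyXn].
move=> _ [P [Pm Ps] <-]; have [s ss Pn] := monic_modulus Pm.
have {ss}-> : n = size s by move: ss; rewrite Ps => -[].
set E := expR _; have E0 : 0 < E by exact: expR_gt0.
have N0 := weighted_norm_ge0 Pm.
rewrite leNgt; apply/negP => NE.
(* [product_lower] asks for a positive bound, whereas the norm is only known to be nonnegative;
   [E / 2] is positive and still below [E]. *)
pose N := Num.max (weighted_sup_norm e w P) (E / 2).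
have := @product_lower s N H _ _ HH; rewrite -/E => h.
have : E <= N.
  apply: h; first by rewrite lt_max divr_gt0 ?orbT.
  by move=> x ex; rewrite -Pn le_max le_weighted_norm.
by rewrite leNgt gt_max NE/=; move/negP; apply; lra.
Qed.

End Bounds.
End WidomFactors.

(** * Conclusion: the criterion for Widom factors *)

Lemma distinct_points (R : realType) (e : set R) (n : nat) : infinite_set e ->
  exists2 x : 'I_n -> R, forall i, e (x i) & injective x.
Proof.
move=> /(infinite_set_fset n)[B Be Bn].
have iB (i : 'I_n) : (i < size (finmap.enum_fset B))%N by exact: leq_trans Bn.
exists (fun i : 'I_n => nth 0 (finmap.enum_fset B) i).
  by move=> i; apply: Be; rewrite /= mem_nth.
by move=> i j /eqP; rewrite nth_uniq ?finmap.fset_uniq// => /eqP/val_inj.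
Qed.

Theorem theorem1p1 (R : realType) (e : set R) (w : R -> R)
    (rho : probability (measurableTypeR R) R)
    (e_compact : compact e)
    (e_regular : dirichlet_regular (on_real_axis e))
    (e_PW : parreau_widom (on_real_axis e))
    (w_weight : is_weight e w)
    (rho_eq : is_equilibrium_measure e rho) :
  let a := (0 < ereal_inf [set (widom_factor e w n)%:E | n in
                             [set n | (1 <= n)%N]])%E in
  let b := (-oo < \int[rho]_(x in e) lne (w x)%:E)%E in
  (a <-> b) /\
  (a \/ b ->
   (ereal_sup [set (widom_factor e w n)%:E | n in
                 [set n | (1 <= n)%N]] < +oo)%E).
Proof.
move=> a b; have [w0 wu winf] := w_weight.
have einf : infinite_set e by apply: sub_infinite_set winf => x [].
have e0 := infinite_setN0 einf; have [re _ _] := rho_eq.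
have [M M1 wM] := usc_bounded e_compact wu.
have M0 : 0 < M by exact: lt_le_trans M1.
have [_ _ [g [gr PWfin]]] := e_PW.
have gg := is_green_green_like e_regular gr e_compact.
have [gh _ _ _] := gr.
have [PW PWle] : exists PW : R,
    (\esum_(z in critical_points (on_real_axis e) g) (g z)%:E <= PW%:E)%E.
  by move: PWfin; case: (esum _ _) => [r _|//|_]; [exists r|exists 0; rewrite leNye].
have upper (q : {poly R}) n : (forall x, e x -> 0 < q.[x]) ->
    (forall x, e x -> w x * q.[x] <= 1) -> (size q <= n)%N ->
    widom_factor e w n <= expR (6 + PW - \int[rho]_(x in e) ln q.[x]).
  move=> q0 wq qn; have [x0 ex0 x0i] := distinct_points n.+1 einf.
  have [P [t [Pm Ps t0 Pt lt]]] := chebyshev_upper e_compact rho_eq gh gg PWle q0 qn ex0 x0i.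
  apply: (widom_upper e_compact rho_eq w0 wM e0 Pm Ps t0); last by lra.
  move=> x ex; apply: (le_trans (ler_wpM2l (w0 _ ex) (Pt _ ex))).
  by rewrite mulrCA ler_piMr ?(ltW t0)// wq.
have deficit := integral_log_deficit e_compact re M1 wM wu.
have deficit0 : (0 <= \int[rho]_(x in e) log_deficit w M x)%E.
  by apply: integral_ge0 => x; exact: log_deficit_ge0.
split; [split|] => [ha|hb|_].
- rewrite /b ltNge; apply/negP; rewrite leeNy_eq => /eqP lw.
  have {}lw : (\int[rho]_(x in e) log_deficit w M x = +oo)%E by rewrite deficit lw.
  have [c c0 hc] : exists2 c : R, 0 < c & forall n, (1 <= n)%N -> c <= widom_factor e w n.
    have hle n : (1 <= n)%N -> (ereal_inf [set (widom_factor e w n)%:E | n in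
        [set n | (1 <= n)%N]] <= (widom_factor e w n)%:E)%E.
      by move=> n1; apply: ereal_inf_lbound; exists n.
    move: ha hle; rewrite /a; case: (ereal_inf _) => [r|_ /(_ 1%N isT)|//].
      by rewrite lte_fin => r0 hle; exists r => // n /hle; rewrite lee_fin.
    by rewrite leye_eq.
  have [q [q0 wq qA]] := polynomial_minorant e_compact re w0 M1 wM wu
    (6 + PW - ln c + 1) lw.
  (* The contradiction occurs at one [n], fixed by the size of [q]: the chosen lower bound on the
     integral of [ln q] gives a Widom factor of at most [expR (ln c - 1)], which is less than
     [c]. *)
  have := upper q (maxn 1 (size q)) q0 wq (leq_maxr _ _).
  have := hc (maxn 1 (size q)) (leq_maxl _ _).
  move=> /le_trans/[apply]; rewrite -[X in X <= _ -> _](lnK (x := c)) ?posrE//.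
  by rewrite ler_expR; lra.
- have [H HE] : exists H : R, (\int[rho]_(x in e) log_deficit w M x <= H%:E)%E.
    move: hb deficit0; rewrite /b deficit; case: (integral _ _ _) => [r _ _|_|//].
      by exists (ln M - r); rewrite -EFinB.
    by rewrite /= leeNy_eq.
  apply: (@lt_le_trans _ _ (expR (ln M - H))%:E); first by rewrite lte_fin expR_gt0.
  apply: le_ereal_inf_tmp => _ [n _ <-]; rewrite lee_fin.
  exact: (widom_lower e_compact rho_eq w0 M1 wM wu e0 n HE).
(* The constant polynomial [M^-1] has size at most 1, so it is admissible for every [n >= 1] at
   once. *)
- have iM0 : 0 < M^-1 by rewrite invr_gt0.
  have q0 x : e x -> 0 < (M^-1)%:P.[x] by rewrite hornerC.
  have wq x : e x -> w x * (M^-1)%:P.[x] <= 1.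
    by move=> ex; rewrite hornerC ler_pdivrMr// mul1r wM.
  apply: (@le_lt_trans _ _ (expR (6 + PW - \int[rho]_(x in e) ln (M^-1)%:P.[x]))%:E);
    last exact: ltry.
  apply: ge_ereal_sup => _ [n /= n1 <-]; rewrite lee_fin; apply: upper => //.
  by rewrite (leq_trans (size_polyC_leq1 _)).
Qed.
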